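(* Let $k\ge 2$, $p\ge 1$, and let $a_1,a_2$ be integers coprime to $k$ with $a_1>-k$ and $a_1+a_2-kp=-2k$. For the stratum $\Omega^{k}\mathcal{M}_{0}(a_{1},a_{2},-k,\dots,-k)$ (with $p$ poles of order $-k$), the degree of the isoresidual cover is given by $$\binom{p-1}{\lceil a_{1}/k \rceil}\cdot a_{1}!_{(k)}\cdot a_{2}!_{(k)}.$$
   Context: The $k$-factorial of an integer $a$ is $a!_{(k)}=\prod_{i=0}^{\lfloor a/k\rfloor}(a-ik)$, where an empty product equals $1$. A $k$-differential on $\mathbb{CP}^1$ is a nonzero meromorphic section of $K^{\otimes k}$, $K$ the canonical bundle. It is primitive if it is not a power of a differential of lower order. At a pole of order $-k$ there is a local coordinate $z$ in which it equals $(r/z)^k(dz)^k$ with $r\in\mathbb{C}^*$; its $k$-residue there is $r^k$. The stratum $\Omega^k\mathcal{M}_0(a_1,a_2,-k,\dots,-k)$ is the moduli space (up to isomorphism) of tuples $(\mathbb{CP}^1,\zeta,z_1,z_2;p_1,\dots,p_p)$, where $\zeta$ is a primitive $k$-differential whose singularities are the marked points (all labelled), with order $a_i$ at $z_i$ and order $-k$ at each $p_j$. The isoresidual cover is the map to $\mathbb{C}^p$ sending $\zeta$ to its tuple of $k$-residues $(\operatorname{Res}_{p_1}\zeta,\dots,\operatorname{Res}_{p_p}\zeta)$. Its degree is the number of elements of a fiber over a generic point of $\mathbb{C}^p$.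
   Formalization: The formal theorem also assumes a_2 > -k; without it the formula fails (k=2, p=1, a_1=1, a_2=-3: the degree is 1 but the formula gives 0), and for every a_2 < -k the binomial vanishes while the degree is positive. *)

(* Defs.v *)
From mathcomp Require Import all_boot all_order all_algebra.
From mathcomp Require Import generic_quotient fraction.
From mathcomp Require Import classical_sets cardinality reals complex mpoly.

Set Implicit Arguments.
Unset Strict Implicit.
Unset Printing Implicit Defensive.

Import Order.TTheory GRing.Theory Num.Theory.

Local Open Scope ring_scope.
Local Open Scope classical_set_scope.
Local Open Scope card_scope.

Definition kfactorial (k : nat) (a : int) : int :=
  if Num.floor (a%:~R / k%:R : rat) is Posz m
  then \prod_(i < m.+1) (a - i%:Z * k%:Z) else 1.

(* The projective line: Some z is the point with affine coordinate z, and None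
   is the point at infinity. *)
Notation P1 C := (option C).

(* The automorphisms of P1 are the homographies z |-> (a z + b) / (c z + d);
   an invertible matrix M stands for the one with a = M 0 0, b = M 0 1,
   c = M 1 0, d = M 1 1. *)
Definition homography (C : fieldType) (M : 'M[C]_2) (q : P1 C) : P1 C :=
  match q with
  | Some z => if M 1 0 * z + M 1 1 == 0 then None
              else Some ((M 0 0 * z + M 0 1) / (M 1 0 * z + M 1 1))
  | None => if M 1 0 == 0 then None else Some (M 0 0 / M 1 0)
  end.

(* The meromorphic functions on P1 form the field C(z). *)
Notation ratfun C := {fraction {poly C}}.

Definition ratfun_of_poly (C : fieldType) (P : {poly C}) : ratfun C :=
  @FracField.tofrac {poly C} P.

Definition ratfun_horner (C : fieldType) (P : {poly C}) (phi : ratfun C)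
    : ratfun C :=
  (map_poly (fun c => ratfun_of_poly c%:P) P).[phi].

(* f o phi, which makes sense when phi is not constant *)
Definition ratfun_comp (C : fieldType) (f phi : ratfun C) : ratfun C :=
  ratfun_horner \n_(repr f) phi / ratfun_horner \d_(repr f) phi.

(* A meromorphic section of the k-th power of the canonical bundle of P1 is
   f (dz)^k in the affine coordinate z; it is represented by f. *)
Definition kdiff (C : fieldType) (k : nat) : Type := ratfun C.

(* phi^* (f (dz)^k) = (f o phi) phi'^k (dz)^k, where phi is the homography of M
   and phi' = det M / (c z + d)^2. *)
Definition pullback (C : fieldType) (k : nat) (M : 'M[C]_2) (zeta : kdiff C k)
    : kdiff C k :=
  let num := ratfun_of_poly (M 0 0 *: 'X + (M 0 1)%:P) in
  let den := ratfun_of_poly (M 1 0 *: 'X + (M 1 1)%:P) in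
  (ratfun_comp zeta (num / den) : ratfun C)
    * (ratfun_of_poly (\det M)%:P / den ^+ 2) ^+ k.

Definition primitive (C : fieldType) (k : nat) (zeta : kdiff C k) : Prop :=
  forall (l d : nat) (eta : kdiff C l), (l * d = k)%N -> (l < k)%N ->
    zeta <> (eta : ratfun C) ^+ d :> ratfun C.

(* An automorphism of P1 sending 0 to q: z |-> z + x if q = x is finite, and
   z |-> 1 / z if q is the point at infinity. *)
Definition chart (C : fieldType) (q : P1 C) : 'M[C]_2 :=
  if q is Some x then 1%:M + x *: delta_mx 0 1
  else delta_mx 0 1 + delta_mx 1 0.

Definition local_expr (C : fieldType) (k : nat) (zeta : kdiff C k) (q : P1 C)
    : ratfun C := pullback (chart q) zeta.

(* order at q of a nonzero k-differential *)
Definition order_at (C : fieldType) (k : nat) (zeta : kdiff C k) (q : P1 C)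
    : int :=
  let f := local_expr zeta q in
  (mup 0 \n_(repr f))%:Z - (mup 0 \d_(repr f))%:Z.

(* The power series t = \sum_i t_i z^i, a local coordinate at 0, puts f (dz)^k
   in the form (r / t)^k (dt)^k. With f = N / D this is the identity
   N t^k = r^k (dt/dz)^k D of power series, which is stated modulo z^n for
   all n. *)
Definition normal_form (C : fieldType) (k : nat) (f : ratfun C) (r : C)
    (t : nat -> C) : Prop :=
  [/\ t 0%N = 0, t 1%N != 0
    & forall n : nat,
      let T := \poly_(i < n.+1) t i in
      'X^n %| \n_(repr f) * T ^+ k - r ^+ k *: (T^`() ^+ k * \d_(repr f))].

Definition is_kresidue (C : fieldType) (k : nat) (zeta : kdiff C k) (q : P1 C)
    (rho : C) : Prop :=
  exists r : C, exists t : nat -> C,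
    [/\ r != 0, normal_form k (local_expr zeta q) r t & rho = r ^+ k].

Record marked_kdiff (C : fieldType) (k p : nat) := MarkedKDiff {
  diff : kdiff C k;
  sing1 : P1 C;
  sing2 : P1 C;
  pole : 'I_p -> P1 C }.

Definition marked_points (C : fieldType) (k p : nat) (X : marked_kdiff C k p)
    : seq (P1 C) := [:: sing1 X, sing2 X & codom (pole X)].

Record of_type (C : fieldType) (k p : nat) (a1 a2 : int)
    (X : marked_kdiff C k p) : Prop := OfType {
  diff_neq0 : diff X <> 0 :> ratfun C;
  diff_primitive : primitive (diff X);
  marked_points_uniq : uniq (marked_points X);
  order_sing1 : order_at (diff X) (sing1 X) = a1;
  order_sing2 : order_at (diff X) (sing2 X) = a2;
  order_pole : forall j, order_at (diff X) (pole X j) = - k%:Z;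
  order_regular :
    forall q, q \notin marked_points X -> order_at (diff X) q = 0 }.

Definition isomorphic (C : fieldType) (k p : nat) (X Y : marked_kdiff C k p)
    : Prop :=
  exists2 M : 'M[C]_2, M \in unitmx
    & [/\ pullback M (diff Y) = diff X,
          homography M (sing1 X) = sing1 Y,
          homography M (sing2 X) = sing2 Y
        & forall j, homography M (pole X j) = pole Y j].

(* The points of the stratum are isomorphism classes. *)
Definition stratum (C : fieldType) (k p : nat) (a1 a2 : int)
    : set (set (marked_kdiff C k p)) :=
  [set [set Y | isomorphic X Y] | X in [set X | of_type a1 a2 X]].

Definition isoresidual_fiber (C : fieldType) (k p : nat) (a1 a2 : int)
    (rho : 'I_p -> C) : set (set (marked_kdiff C k p)) :=
  [set S | stratum a1 a2 S /\
    exists2 X, S X & forall j, is_kresidue (diff X) (pole X j) (rho j)].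

(* A generic point is one outside some proper algebraic subset P = 0. *)
Definition isoresidual_degree (C : fieldType) (k p : nat) (a1 a2 : int)
    (d : nat) : Prop :=
  exists2 P : {mpoly C[p]}, P != 0
    & forall rho : 'I_p -> C, P.@[rho] != 0 ->
        @isoresidual_fiber C k p a1 a2 rho #= `I_d.

(* Main.v *)
(* Homographies move z_1, z_2 and the first pole to 0, oo and 1, which turns zeta into
   c z^a1 / prod_j (z - x_j)^k (dz)^k, whose k-residue at x_j is
   c x_j^a1 / prod_(i <> j) (x_j - x_i)^k. Let r_j be a k-th root of the prescribed
   k-residue. As a1 is coprime to k, there is exactly one y_j with y_j^k = x_j such that
   r_j y_j^(-a1) is proportional to 1 / prod_(i <> j) (x_j - x_i), and by Lagrange
   interpolation the residue conditions become
     sum_j r_j y_j^(i k - a1) = 0 for 0 <= i < p - 1, with y_1 = 1.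
   For generic r the solutions of this system are nondegenerate and stay in a compact part
   of the torus, so their number is locally constant in r and, the non-generic values of
   one weight being finite in number, independent of r. Let N(n, e) be the number of
   solutions for n equations with exponents e + i k. When one weight tends to 0, the
   corresponding unknown tends to oo or to 0 on every solution; the substitution of
   tau / theta for it, where theta^(e + n k) is the weight, counts the solutions of the
   first kind, and y |-> 1 / y exchanges the two kinds. Hence
     N(n + 1, e) = (e + n k)^+ N(n, e) + (- e)^+ N(n, - (e + n k)),
   which the closed formula satisfies. *)
From HB Require Import structures.
Require Import Defs.
From mathcomp Require Import all_boot all_order all_algebra.
From mathcomp Require Import fraction separable cyclotomic zify ring.
From mathcomp Require Import boolp classical_sets cardinality reals topology.
From mathcomp Require Import normedtype complex.
From mathcomp Require Import (canonicals) mpoly.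

Set Implicit Arguments.
Unset Strict Implicit.
Unset Printing Implicit Defensive.

Import Order.TTheory GRing.Theory Num.Theory.
Import numFieldNormedType.Exports.

Local Open Scope ring_scope.
Local Open Scope classical_set_scope.

(** * Limits along ultrafilters *)

(** Compactness is the main tool, and it is used along ultrafilters: there a bounded function
    converges, and an index chosen at each parameter (the largest coordinate, say) can be taken
    constant. Apart from its absolute value, the field enters the counting only through
    [bounded_converge] and [has_all_roots]. One lemma, [local_count], serves both for moving a
    generic weight and for the degeneration, since the substitution of tau / theta makes theta = 0
    an ordinary point of a square system with nondegenerate solutions. Differences of Laurent
    monomials factor exactly through divided differences, so no remainder terms occur. Genericity
    forbids relations among the r_j whose coefficients are 0 or k-th roots of unity. By a
    Vandermonde argument it forces more distinct values y_j^k than there are equations; distinct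
    poles, nondegenerate solutions and solutions bounded away from 0 and infinity all come from this
    count. Coprimality makes every exponent e + i k nonzero, so that each equation can be normalised
    by the largest or by the smallest coordinate. *)

Lemma filter_from_ultra (T : Type) (F : set_system T) (A : set T) :
  Filter F -> (forall U, UltraFilter U -> F `<=` U -> U A) -> F A.
Proof.
move=> FF H; apply: contrapT => nFA.
(* If [F] misses [A], the traces of its members on the complement of [A] still generate a proper
   filter. *)
pose G := filter_from F (fun B => B `&` ~` A).
have FG : ProperFilter G.
  apply: filter_from_proper; first apply: filter_from_filter.
  - by exists setT; exact: filterT.
  - move=> B D FB FD; exists (B `&` D); first exact: filterI.
    by move=> x [[? ?] ?]; split; split.
  - move=> B FB; apply: contrapT => /set0P/negP/negPn/eqP B0; apply: nFA.
    apply: filterS FB => x Bx; apply: contrapT => nAx.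
    by have : (B `&` ~` A) x by []; rewrite B0.
have [U [UU GU]] := ultraFilterLemma FG.
have UA : U A.
  apply: H => // B FB; apply: GU; exists B => //; exact: subIsetl.
have UnA : U (~` A).
  by apply: GU; exists setT; [exact: filterT | exact: subIsetr].
by have /filter_ex[x []] : U (A `&` ~` A) by exact: filterI.
Qed.

(** This makes pointwise finite choices, such as the index of a largest coordinate, independent of
    the parameter. *)
Lemma ultra_finite_choice (T : Type) (U : set_system T) (J : finType) (P : J -> set T) :
  UltraFilter U -> U [set t | exists j, P j t] -> exists j, U (P j).
Proof.
move=> UU UP; apply: contrapT => nP.
have H j : U (~` P j).
  have [UPj|//] := in_ultra_setVsetC (P j) UU; by case: nP; exists j.
have : U [set t | forall j, ~ P j t].
  by apply: filter_forall => j; exact: H.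
move=> /(filterI UP) /filter_ex[t [[j Pj]] /(_ j)]; exact.
Qed.

Lemma ultra_not (T : Type) (U : set_system T) (A : set T) :
  UltraFilter U -> ~ U A -> U (~` A).
Proof. by move=> UU nA; have [|] := in_ultra_setVsetC A UU. Qed.

Section Limits.
Variable C : numFieldType.
Variables (T : Type) (U : set_system T).
Context {UU : ProperFilter U}.
Implicit Types f g : T -> C.

Lemma cvg_expn f (c : C) n : f @ U --> c -> (fun t => f t ^+ n) @ U --> c ^+ n.
Proof.
move=> fc; elim: n => [|n IHn].
  by under eq_fun do rewrite expr0; rewrite expr0; exact: cvg_cst.
by under eq_fun do rewrite exprS; rewrite exprS; exact: cvgM.
Qed.

Lemma cvg_exprz f (c : C) (n : int) : c != 0 ->
  f @ U --> c -> (fun t => f t ^ n) @ U --> c ^ n.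
Proof.
move=> c0 fc; case: n => n; first exact: cvg_expn.
by apply: (@cvgV _ _ _ _ (fun t => f t ^+ n.+1));
  [rewrite expf_neq0 | exact: cvg_expn].
Qed.

Lemma cvg_bigsum (I : Type) (s : seq I) (P : pred I) (f : I -> T -> C) (c : I -> C) :
  (forall i, f i @ U --> c i) ->
  (fun t => \sum_(i <- s | P i) f i t) @ U --> \sum_(i <- s | P i) c i.
Proof.
move=> fc; elim: s => [|i s IHs].
  by under eq_fun do rewrite big_nil; rewrite big_nil; exact: cvg_cst.
under eq_fun do rewrite big_cons; rewrite big_cons.
by case: ifP => _ //; apply: cvgD.
Qed.

Lemma cvg_bigprod (I : Type) (s : seq I) (P : pred I) (f : I -> T -> C) (c : I -> C) :
  (forall i, f i @ U --> c i) ->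
  (fun t => \prod_(i <- s | P i) f i t) @ U --> \prod_(i <- s | P i) c i.
Proof.
move=> fc; elim: s => [|i s IHs].
  by under eq_fun do rewrite big_nil; rewrite big_nil; exact: cvg_cst.
under eq_fun do rewrite big_cons; rewrite big_cons.
by case: ifP => _ //; apply: cvgM.
Qed.

Lemma cvg_det n (f : T -> 'M[C]_n) (A : 'M[C]_n) :
  (forall i j, (fun t => f t i j) @ U --> A i j) ->
  (fun t => \det (f t)) @ U --> \det A.
Proof.
move=> fA; rewrite /determinant; apply: cvg_bigsum => s.
by apply: cvgM; [exact: cvg_cst | apply: cvg_bigprod].
Qed.

Lemma cvg_near_neq f (c d : C) : c != d -> f @ U --> c -> \forall t \near U, f t != d.
Proof.
move=> cd /cvgrPdist_lt/(_ `|c - d|); rewrite normr_gt0 subr_eq0 => /(_ cd).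
by apply: filterS => t; apply: contraTN => /eqP->; rewrite ltxx.
Qed.

Lemma cvg_eq_near f g (c d : C) : f @ U --> c -> g @ U --> d ->
  (\forall t \near U, f t = g t) -> c = d.
Proof.
move=> fc gd fg; apply: (@cvg_unique _ _ (f @ U)) => //.
apply: cvg_trans gd; apply: near_eq_cvg; near=> t; apply/esym.
by near: t.
Unshelve. all: by end_near. Qed.

Lemma cvg_le_near f (c M : C) : f @ U --> c ->
  (\forall t \near U, `|f t| <= M) -> `|c| <= M.
Proof.
move=> fc fM.
have nf : (fun t => `|f t|) @ U --> `|c| by exact: cvg_norm.
have M0 : M \is Num.real.
  have [t ft] := filter_ex fM; by rewrite (ger0_real (le_trans _ ft)).
rewrite real_leNgt //; apply/negP => Mc.
have /cvgrPdist_lt/(_ (`|c| - M)) := nf; rewrite subr_gt0 => /(_ Mc) H.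
have HI : U ((fun t => `| `|c| - `|f t| | < `|c| - M) `&` (fun t => `|f t| <= M)).
  exact: filterI.
have [t [/= h1 h2]] := filter_ex HI.
suff : `|c| - M <= `| `|c| - `|f t| | by rewrite real_leNgt ?rpredB ?normr_real // h1.
apply: (@le_trans _ _ (`|c| - `|f t|)); first by rewrite lerD2l lerN2.
by apply: real_ler_norm; rewrite rpredB ?normr_real.
Qed.
End Limits.

Definition has_card (V : eqType) (A : V -> Prop) (d : nat) : Prop :=
  exists l : seq V, [/\ uniq l, size l = d & forall y, A y <-> y \in l].

Lemma has_card_unique (V : eqType) (A : V -> Prop) d d' :
  has_card A d -> has_card A d' -> d = d'.
Proof.
case=> l [ul <- Al] [l' [ul' <- Al']].
by apply/perm_size/uniq_perm => // y; apply/idP/idP => [/Al/Al'|/Al'/Al].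
Qed.

Lemma eq_has_card (V : eqType) (A B : V -> Prop) d :
  (forall y, A y <-> B y) -> has_card A d -> has_card B d.
Proof.
by move=> AB [l [ul sl Al]]; exists l; split=> // y; rewrite -AB.
Qed.

Lemma has_card_bij (V W : eqType) (A : V -> Prop) (B : W -> Prop) (f : V -> W) d :
  (forall x, A x -> B (f x)) ->
  (forall x y, A x -> A y -> f x = f y -> x = y) ->
  (forall z, B z -> exists2 x, A x & f x = z) ->
  has_card A d -> has_card B d.
Proof.
move=> AB finj fsurj [l [ul <- Al]]; exists (map f l); split.
- by rewrite map_inj_in_uniq // => x y /Al Ax /Al Ay; exact: finj.
- by rewrite size_map.
- move=> z; split=> [/fsurj[x /Al xl <-]|/mapP[x /Al Ax ->]]; last exact: AB.
  exact: map_f.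
Qed.

Lemma has_cardU (V : eqType) (A B : V -> Prop) d d' :
  (forall x, A x -> B x -> False) ->
  has_card A d -> has_card B d' -> has_card (fun x => A x \/ B x) (d + d').
Proof.
move=> AB [l [ul <- Al]] [l' [ul' <- Bl']]; exists (l ++ l'); split.
- rewrite cat_uniq ul ul' andbT /=; apply/hasPn => x /Bl' Bx.
  by apply/negP => /Al /AB; apply.
- by rewrite size_cat.
- by move=> y; rewrite mem_cat Al Bl'; split=> /orP.
Qed.

(* Stands for local compactness; it is checked for [R[i]] only at the end, so that the
   counting needs no identification of [R[i]] with the plane. *)
Definition bounded_converge (C : numFieldType) : Prop :=
  forall (T : Type) (U : set_system T) (f : T -> C) (M : C),
    UltraFilter U -> U [set t | `|f t| <= M] -> exists c : C, f @ U --> c.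

(** * Square systems of Laurent equations *)

Section Laurent.
Variable C : numFieldType.

(** Divided difference of the monomial of exponent [m], written without division by [a - c] so that
    it makes sense at [a = c], where it is the derivative. [Negz m] is the exponent -(m + 1). *)
Definition diff_quot (m : int) (a c : C) : C :=
  match m with
  | Posz m => \sum_(i < m) a ^+ (m.-1 - i) * c ^+ i
  | Negz m => - (\sum_(i < m.+1) a ^+ (m - i) * c ^+ i) / (a ^+ m.+1 * c ^+ m.+1)
  end.

Lemma diff_quotP m a c : a != 0 -> c != 0 -> a ^ m - c ^ m = diff_quot m a c * (a - c).
Proof.
move=> a0 c0; case: m => m /=; first by rewrite [LHS]subrXX mulrC.
have am : a ^+ m.+1 != 0 by rewrite expf_neq0.
have cm : c ^+ m.+1 != 0 by rewrite expf_neq0.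
rewrite mulrAC mulNr [_ * (a - c)]mulrC -subrXX opprB !NegzE -!exprnN.
by rewrite mulrBl invfM mulrA [_ * (c ^- _)]mulrC !mulrA mulVf // mul1r mulfV // mul1r.
Qed.

Lemma diff_quot_diag m a : a != 0 -> diff_quot m a a = m%:~R * a ^ (m - 1).
Proof.
move=> a0; case: m => m /=.
  case: m => [|m]; first by rewrite big_ord0 mul0r.
  rewrite (eq_bigr (fun=> a ^+ m)); last first.
    by move=> i _; rewrite -exprD subnK // -ltnS.
  have -> : m.+1%:Z - 1 = m by rewrite -addn1 PoszD addrK.
  by rewrite sumr_const card_ord -mulr_natl.
rewrite (eq_bigr (fun=> a ^+ m)); last first.
  by move=> i _; rewrite -exprD subnK // -ltnS.
rewrite sumr_const card_ord.
rewrite NegzE mulrNz !mulNr -[a ^+ m *+ m.+1]mulr_natl -mulrA; congr (- (_ * _)).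
have -> : - m.+1%:Z - 1 = - (m + 2)%:Z by rewrite -opprD -[1]/(1%:Z) -PoszD addn1 addn2.
rewrite -exprnN -exprD; apply: (@mulIf _ (a ^+ (m.+1 + m.+1))); first by rewrite expf_neq0.
rewrite mulfVK ?expf_neq0 //.
have -> : (m.+1 + m.+1 = (m + 2) + m)%N by rewrite addn2 !addSn addnS.
by rewrite [a ^+ (m + 2 + m)]exprD mulKf ?expf_neq0.
Qed.

Variables (T : Type) (U : set_system T).
Context {UU : ProperFilter U}.

Lemma cvg_diff_quot m (f g : T -> C) a c : a != 0 -> c != 0 ->
  f @ U --> a -> g @ U --> c -> (fun t => diff_quot m (f t) (g t)) @ U --> diff_quot m a c.
Proof.
move=> a0 c0 fa gc; case: m => m /=.
  by apply: cvg_bigsum => i; apply: cvgM; exact: cvg_expn.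
apply: cvgM; first by apply: cvgN; apply: cvg_bigsum => i; apply: cvgM; exact: cvg_expn.
apply: (@cvgV _ _ _ _ (fun t => f t ^+ m.+1 * g t ^+ m.+1)).
  by rewrite mulf_neq0 ?expf_neq0.
by apply: cvgM; exact: cvg_expn.
Qed.
End Laurent.

Section System.
Variable C : numFieldType.
Variable n : nat.
Variable nu : 'I_n -> int.
Variable b : C.
Implicit Types (R : 'M[C]_n) (y z : 'cV[C]_n).

Definition torus y : Prop := forall j, y j 0 != 0.

Definition residual R y : 'cV[C]_n :=
  \col_i (b + \sum_j R i j * y j 0 ^ nu i).

Definition laurent_sol R y : Prop := torus y /\ residual R y = 0.

(** Secant matrix: the difference of the residuals at [y] and [z] is exactly this matrix times
    [y - z], and for [z = y] it is the usual Jacobian matrix. Continuity of its determinant replaces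
    estimates of remainders. *)
Definition jacobian R y z : 'M[C]_n := \matrix_(i, j) (R i j * diff_quot (nu i) (y j 0) (z j 0)).

(** Triviality of the kernel is spelled out as linear equations, the form in which Vandermonde
    arguments verify it. *)
Definition nondegenerate R y : Prop :=
  forall v : 'cV[C]_n,
    (forall i, \sum_j (nu i)%:~R * R i j * y j 0 ^ (nu i - 1) * v j 0 = 0) -> v = 0.

Definition cvgv (T : Type) (U : set_system T) (y : T -> 'cV[C]_n) z : Prop :=
  forall j, (fun t => y t j 0) @ U --> z j 0.

Lemma residualB R y z : torus y -> torus z ->
  residual R y - residual R z = jacobian R y z *m (y - z).
Proof.
move=> ty tz; apply/colP => i; rewrite !mxE opprD addrACA subrr add0r -sumrB.
apply: eq_bigr => j _; rewrite !mxE -mulrBr diff_quotP ?mulrA //.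
Qed.

Lemma unitmx_kernel R : (forall v : 'cV[C]_n, R *m v = 0 -> v = 0) -> R \in unitmx.
Proof.
move=> H; rewrite -unitmx_tr -row_free_unit -kermx_eq0.
apply/eqP/row_matrixP => i; rewrite row0.
apply: trmx_inj; rewrite trmx0; apply: H.
by rewrite -{1}[R]trmxK -trmx_mul -row_mul mulmx_ker row0 trmx0.
Qed.

Lemma unitmx_inj R v : R \in unitmx -> R *m v = 0 :> 'cV[C]_n -> v = 0.
Proof. by move=> uR Rv; rewrite -[v](mulKmx uR) Rv mulmx0. Qed.

Lemma nondegenerate_unit R y : torus y -> nondegenerate R y ->
  jacobian R y y \in unitmx.
Proof.
move=> ty nd; apply: unitmx_kernel => v Jv; apply: nd => i.
have := congr1 (fun w : 'cV[C]_n => w i 0) Jv; rewrite !mxE; apply: etrans.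
apply: eq_bigr => j _; rewrite !mxE diff_quot_diag; last exact: ty.
by rewrite !mulrA [R i j * _]mulrC.
Qed.

Section SystemLimits.
Variables (T : Type) (U : set_system T).
Context {UU : ProperFilter U}.

Lemma cvg_torus (y : T -> 'cV[C]_n) z : torus z -> cvgv U y z -> U [set t | torus (y t)].
Proof.
move=> tz yz; apply: filter_forall => j.
exact: (cvg_near_neq (tz j) (yz j)).
Qed.

Lemma cvg_residual (Rt : T -> 'M[C]_n) R (y : T -> 'cV[C]_n) z :
  (forall i j, (fun t => Rt t i j) @ U --> R i j) -> torus z -> cvgv U y z ->
  forall i, (fun t => residual (Rt t) (y t) i 0) @ U --> residual R z i 0.
Proof.
move=> RR tz yz i; rewrite mxE.
under eq_fun do rewrite mxE.
apply: cvgD; first exact: cvg_cst.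
apply: cvg_bigsum => j; apply: cvgM => //.
by apply: cvg_exprz => //; exact: yz.
Qed.

Lemma cvg_jacobian (Rt : T -> 'M[C]_n) R (y y' : T -> 'cV[C]_n) z z' :
  (forall i j, (fun t => Rt t i j) @ U --> R i j) -> torus z -> torus z' ->
  cvgv U y z -> cvgv U y' z' ->
  forall i j, (fun t => jacobian (Rt t) (y t) (y' t) i j) @ U --> jacobian R z z' i j.
Proof.
move=> RR tz tz' yz yz' i j; rewrite mxE.
under eq_fun do rewrite mxE.
by apply: cvgM => //; apply: cvg_diff_quot => //.
Qed.

Lemma jacobian_unit_near (Rt : T -> 'M[C]_n) R (y y' : T -> 'cV[C]_n) z :
  (forall i j, (fun t => Rt t i j) @ U --> R i j) -> torus z -> nondegenerate R z ->
  cvgv U y z -> cvgv U y' z ->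
  U [set t | jacobian (Rt t) (y t) (y' t) \in unitmx].
Proof.
move=> RR tz nd yz yz'.
have := nondegenerate_unit tz nd; rewrite unitmxE unitfE => d0.
apply: filterS (cvg_near_neq d0 (cvg_det (cvg_jacobian RR tz tz yz yz'))) => t.
by rewrite /= unitmxE unitfE.
Qed.

(** The difference of the two solutions lies in the kernel of their secant matrix, which tends to
    the invertible Jacobian matrix at [z]. *)
Lemma sol_unique_near (Rt : T -> 'M[C]_n) R (y y' : T -> 'cV[C]_n) z :
  (forall i j, (fun t => Rt t i j) @ U --> R i j) -> torus z -> nondegenerate R z ->
  cvgv U y z -> cvgv U y' z ->
  U [set t | laurent_sol (Rt t) (y t) /\ laurent_sol (Rt t) (y' t)] ->
  U [set t | y t = y' t].
Proof.
move=> RR tz nd yz yz' sol.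
have Ju : U [set t | jacobian (Rt t) (y t) (y' t) \in unitmx].
  exact: jacobian_unit_near RR tz nd yz yz'.
apply: filterS (filterI Ju sol) => t [/= uJ [[ty ry] [ty' ry']]].
apply/eqP; rewrite -subr_eq0; apply/eqP; apply: (unitmx_inj uJ).
by rewrite -residualB // ry ry' subrr.
Qed.

End SystemLimits.
End System.

(** * Continuation of nondegenerate solutions *)

Section LocalCount.
Variable C : numFieldType.
Hypothesis bC : bounded_converge C.
Variable n : nat.
Variable nu : 'I_n -> int.
Variable b : C.
Implicit Types (R : 'M[C]_n) (y z w : 'cV[C]_n).

Definition polydisc z (rho : C) : set 'cV[C]_n :=
  [set y | forall j, `|y j 0 - z j 0| <= rho].

Definition norm1 (y : 'cV[C]_n) : C := \sum_i `|y i 0|.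

Lemma norm1_ge0 y : 0 <= norm1 y. Proof. exact: sumr_ge0. Qed.

Lemma norm1_eq0 y : norm1 y = 0 -> y = 0.
Proof.
move/eqP; rewrite psumr_eq0 // => /allP H; apply/colP => i; rewrite mxE.
by apply/eqP; rewrite -normr_eq0; apply: H; rewrite mem_index_enum.
Qed.

Lemma cvg_norm1 (T : Type) (U : set_system T) (y : T -> 'cV[C]_n) z :
  ProperFilter U -> cvgv U y z -> (fun t => norm1 (y t)) @ U --> norm1 z.
Proof.
by move=> UU yz; apply: cvg_bigsum => i; apply: cvg_norm; apply: yz.
Qed.

Lemma bounded_converge_vec (T : Type) (U : set_system T) (y : T -> 'cV[C]_n) (M : C) :
  UltraFilter U -> U [set t | forall j, `|y t j 0| <= M] -> exists z, cvgv U y z.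
Proof.
move=> UU yM.
have /choice[f fP] : forall j, exists c : C, (fun t => y t j 0) @ U --> c.
  by move=> j; apply: (bC (M := M)); apply: filterS yM => t; apply.
by exists (\col_j f j) => j; rewrite mxE.
Qed.

Lemma polydisc_closed (T : Type) (U : set_system T) (y : T -> 'cV[C]_n) z w rho :
  ProperFilter U -> cvgv U y w -> U [set t | polydisc z rho (y t)] -> polydisc z rho w.
Proof.
move=> UU yw Uy j; apply: (@cvg_le_near _ _ U _ (fun t => y t j 0 - z j 0)).
  by apply: cvgB; [exact: yw | exact: cvg_cst].
by apply: filterS Uy => t; apply.
Qed.

Lemma polydisc_cvg (T : Type) (U : set_system T) (y : T -> 'cV[C]_n) z rho :
  UltraFilter U -> U [set t | polydisc z rho (y t)] ->
  exists2 w, cvgv U y w & polydisc z rho w.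
Proof.
move=> UU Uy.
have [w yw] : exists w, cvgv U y w.
  apply: (@bounded_converge_vec _ _ _ (rho + norm1 z)) => //.
  apply: filterS Uy => t yt j; rewrite -[y t j 0](subrK (z j 0)).
  rewrite (le_trans (ler_normD _ _)) // lerD //.
  by rewrite /norm1 (bigD1 j) //= lerDl sumr_ge0.
by exists w => //; apply: polydisc_closed yw Uy.
Qed.

(** An ultrafilter refining the sublevel sets of [phi] converges in the polydisc, and its limit is a
    minimum by continuity. *)
Lemma polydisc_min z rho (phi : 'cV[C]_n -> C) :
  0 <= rho -> (forall y, 0 <= phi y) ->
  (forall (U : set_system 'cV[C]_n) w, UltraFilter U -> polydisc z rho w ->
     cvgv U id w -> phi @ U --> phi w) ->
  exists2 w, polydisc z rho w & forall y, polydisc z rho y -> phi w <= phi y.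
Proof.
move=> rho0 phi0 phic.
pose G := filter_from (polydisc z rho) (fun a => [set y | polydisc z rho y /\ phi y <= phi a]).
have z_in : polydisc z rho z by move=> j; rewrite subrr normr0.
have FG : ProperFilter G.
  apply: filter_from_proper; first apply: filter_from_filter.
  - by exists z.
  - move=> a c Da Dc.
    have /orP[ac|ca] : (phi a <= phi c) || (phi c <= phi a).
      exact: real_leVge (ger0_real (phi0 a)) (ger0_real (phi0 c)).
    + by exists a => // y [Dy ya]; split; split=> //; exact: le_trans ac.
    + by exists c => // y [Dy yc]; split; split=> //; exact: le_trans ca.
  - by move=> a Da; exists a.
have [U [UU GU]] := ultraFilterLemma FG.
have UD : U (polydisc z rho) by apply: GU; exists z => // y [].
have [w yw Dw] := @polydisc_cvg _ U id z rho UU UD.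
exists w => // a Da.
have := phic U w UU Dw yw => phiw.
rewrite -(ger0_norm (phi0 w)); apply: (cvg_le_near phiw).
by apply: GU; exists a => // y [_ ?] /=; rewrite ger0_norm.
Qed.

(* A minimum of the sum of the moduli of the equations at which the Jacobian is
   invertible is a zero, since the Newton direction decreases that sum. *)
Lemma minimum_is_zero R z (w : 'cV[C]_n) (rho : C) :
  (forall y, polydisc z rho y -> torus y) ->
  (forall j, `|w j 0 - z j 0| < rho) -> jacobian nu R w w \in unitmx ->
  (forall y, polydisc z rho y -> norm1 (residual nu b R w) <= norm1 (residual nu b R y)) ->
  residual nu b R w = 0.
Proof.
move=> Dt wz uJ wmin; apply: contrapT => r0.
set r := residual nu b R w in r0 *.
have r_gt0 : 0 < norm1 r.
  by rewrite lt0r norm1_ge0 andbT; apply/eqP => /norm1_eq0.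
pose J := jacobian nu R w w.
have [h Jh] : exists h, J *m h = - r.
  by exists (- (invmx J *m r)); rewrite mulmxN mulKVmx.
have [F [FF cvgF F_gt0]] : exists F : set_system C,
    [/\ ProperFilter F, id @ F --> (0 : C) & F [set e | 0 < e]].
  exists (within [set e | 0 < e] (nbhs (0 : C))); split.
  - apply: Build_ProperFilter_ex => P; rewrite /within /= => /nbhs_ballP[e /= e0 eP].
    exists (e / 2); apply: eP; last by rewrite /= divr_gt0.
    rewrite /ball /= sub0r normrN ger0_norm ?divr_ge0 ?ltW //.
    by rewrite ltr_pdivrMr // mulr_natr mulr2n ltrDl.
  - by apply: cvg_trans (@cvg_id _ (nbhs (0:C))); exact: cvg_within.
  - exact: withinT.
have wt : torus w by apply: Dt => j; exact: ltW.
have yw : cvgv F (fun e => w + e *: h) w.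
  move=> j; under eq_fun do rewrite !mxE.
  have -> : nbhs (w j 0) = nbhs (w j 0 + 0 * h j 0) by rewrite mul0r addr0.
  apply: cvgD; first exact: cvg_cst.
  apply: cvgM; first exact: cvgF.
  exact: cvg_cst.
have FD : F [set e | polydisc z rho (w + e *: h)].
  apply: filter_forall => j.
  have : (fun e => (w + e *: h) j 0 - z j 0) @ F --> (w j 0 - z j 0).
    by apply: cvgB; [exact: yw | exact: cvg_cst].
  move=> /cvgrPdist_lt/(_ (rho - `|w j 0 - z j 0|)); rewrite subr_gt0 => /(_ (wz j)).
  apply: filterS => e; rewrite ltrBrDl => le1; apply: ltW; apply: le_lt_trans le1.
  by rewrite -[X in `|X| <= _](subKr (w j 0 - z j 0)); exact: ler_normB.
pose E e := (jacobian nu R (w + e *: h) w - J) *m h.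
have E0 : (fun e => norm1 (E e)) @ F --> norm1 (0 : 'cV[C]_n).
  apply: cvg_norm1 => i; rewrite mxE.
  under eq_fun do rewrite mxE.
  have -> : nbhs (0 : C) = nbhs (\sum_(j < n) 0 * h j 0).
    by congr nbhs; rewrite big1 // => j _; rewrite mul0r.
  apply: cvg_bigsum => j; apply: cvgM; last exact: cvg_cst.
  under eq_fun do rewrite mxE [X in _ + X]mxE.
  rewrite -(subrr (J i j)); apply: cvgB; last exact: cvg_cst.
  by apply: cvg_jacobian => //; [move=> *; exact: cvg_cst | move=> ?; exact: cvg_cst].
have E_lt : F [set e | norm1 (E e) < norm1 r].
  have s0 : norm1 (0 : 'cV[C]_n) = 0.
    by apply: big1 => i _; rewrite mxE normr0.
  move: E0; rewrite s0 => /cvgrPdist_lt/(_ _ r_gt0).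
  by apply: filterS => e; rewrite sub0r normrN ger0_norm // norm1_ge0.
have F_lt1 : F [set e | e < 1].
  move: cvgF => /cvgrPdist_lt/(_ 1 ltr01) H.
  apply: filterS (filterI H F_gt0) => e [/=].
  by rewrite sub0r normrN => + /ltW e0; rewrite ger0_norm.
have [e [[e_gt0 e_lt1] [De Ee]]] := filter_ex (filterI (filterI F_gt0 F_lt1) (filterI FD E_lt)).
suff lt : norm1 (residual nu b R (w + e *: h)) < norm1 r.
  by have := lt_le_trans lt (wmin _ De); rewrite ltxx.
(* As [J *m h = - r], the secant identity gives this exactly. The norm of [E e] is below that of
   [r], so the convex combination has norm less than [norm1 r]. *)
have -> : residual nu b R (w + e *: h) = (1 - e) *: r + e *: E e.
  have := @residualB _ _ nu b R _ _ (Dt _ De) wt; rewrite [w + _ - w]addrAC subrr add0r.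
  move=> /eqP; rewrite subr_eq -/r => /eqP ->; rewrite /E mulmxBl Jh opprK -scalemxAr.
  by rewrite scalerDr scalerBl scale1r addrCA subrK.
apply: (@le_lt_trans _ _ ((1 - e) * norm1 r + e * norm1 (E e))).
  rewrite /norm1 !mulr_sumr -big_split /=; apply: ler_sum => i _.
  rewrite !mxE (le_trans (ler_normD _ _)) // !normrM lerD //.
    by rewrite ger0_norm // subr_ge0 ltW.
  by rewrite ger0_norm // ltW.
by rewrite mulrBl mul1r -addrA gtrDl addrC subr_lt0 ltr_pM2l.
Qed.
End LocalCount.

Section LocalCountUniqueness.
Variable C : numFieldType.
Hypothesis bC : bounded_converge C.
Variable n : nat.
Variable nu : 'I_n -> int.
Variable b : C.
Implicit Types (R : 'M[C]_n) (y z w : 'cV[C]_n).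

(** The second argument of the secant matrix stays at [z]: its invertibility on the whole polydisc
    makes a solution [z] the only zero of the residual there. *)
Lemma polydisc_small R z : torus z -> nondegenerate nu R z ->
  exists2 rho : C, 0 < rho & forall y, polydisc z rho y ->
    torus y /\ jacobian nu R y z \in unitmx.
Proof.
move=> tz nd.
pose F := filter_from [set rho : C | 0 < rho] (polydisc z).
have FF : ProperFilter F.
  apply: filter_from_proper; first apply: filter_from_filter.
  - by exists 1; rewrite /=.
  - move=> r s /= r0 s0.
    have /orP[rs|sr] := real_leVge (gtr0_real r0) (gtr0_real s0).
    + by exists r => // y yr; split=> // j; exact: le_trans (yr j) rs.
    + by exists s => // y ys; split=> // j; exact: le_trans (ys j) sr.
  - by move=> r /= r0; exists z => j; rewrite subrr normr0 ltW.
have idz : cvgv F id z.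
  move=> j; apply/cvgrPdist_lt => e e0; exists (e / 2); first by rewrite /= divr_gt0.
  move=> y /(_ j) yj; rewrite distrC; apply: le_lt_trans yj _.
  by rewrite ltr_pdivrMr // mulr_natr mulr2n ltrDl.
have zz : cvgv F (fun=> z) z by move=> j; exact: cvg_cst.
have RR i j : (fun _ : 'cV[C]_n => R i j) @ F --> R i j by exact: cvg_cst.
have Ft : F [set y | torus y] by exact: (cvg_torus tz idz).
have FJ : F [set y | jacobian nu R y z \in unitmx].
  exact: (jacobian_unit_near RR tz nd idz zz).
have [rho /= rho0 H] : F ([set y | torus y] `&` [set y | jacobian nu R y z \in unitmx]).
  exact: filterI.
by exists rho => // y /H.
Qed.

(** For each [t] take a minimum of the sum of moduli over a fixed closed polydisc. The minima tend
    to a zero of the limit system, hence to [z]; so they are eventually interior points with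
    invertible Jacobian matrix, and [minimum_is_zero] applies. *)
Lemma sol_exists_near (T : Type) (U : set_system T) (Rt : T -> 'M[C]_n) R z :
  UltraFilter U -> (forall i j, (fun t => Rt t i j) @ U --> R i j) ->
  laurent_sol nu b R z -> nondegenerate nu R z ->
  exists2 y : T -> 'cV[C]_n, U [set t | laurent_sol nu b (Rt t) (y t)] & cvgv U y z.
Proof.
move=> UU RR [tz rz] nd.
have [rho rho0 D] := polydisc_small tz nd.
have z_in : polydisc z rho z by move=> j; rewrite subrr normr0 ltW.
have /choice[y yP] : forall t, exists w, polydisc z rho w /\ forall y, polydisc z rho y ->
    norm1 (residual nu b (Rt t) w) <= norm1 (residual nu b (Rt t) y).
  move=> t; have [||w pw wmin] := @polydisc_min _ bC n z rho
    (fun y => norm1 (residual nu b (Rt t) y)) (ltW rho0).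
  - by move=> y; exact: norm1_ge0.
  - move=> W w UW pw Ww; apply: cvg_norm1; apply: cvg_residual => //.
    + by move=> *; exact: cvg_cst.
    + by have [] := D _ pw.
  - by exists w.
have [w yw pw] : exists2 w, cvgv U y w & polydisc z rho w.
  apply: (polydisc_cvg bC); apply: nearW => t; by have [] := yP t.
have [tw wu] := D _ pw.
(* The minimum is at most the value at the centre [z], which tends to 0. *)
have rw0 : residual nu b R w = 0.
  apply: norm1_eq0; apply/eqP; rewrite -normr_le0.
  have c0 : (fun t => norm1 (residual nu b (Rt t) z)) @ U --> (0 : C).
    have <- : norm1 (residual nu b R z) = 0.
      by rewrite rz; apply: big1 => i _; rewrite mxE normr0.
    apply: cvg_norm1; apply: cvg_residual => //.
    by move=> j; exact: cvg_cst.
  have cw : (fun t => norm1 (residual nu b (Rt t) (y t))) @ U --> norm1 (residual nu b R w).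
    by apply: cvg_norm1; exact: cvg_residual.
  apply/negP => /negP; rewrite normr_le0 -normr_gt0 => s0.
  set s := norm1 _ in cw s0.
  have s2 : 0 < `|s| / 2 by rewrite divr_gt0.
  have : `|s| <= `|s| / 2.
    apply: (cvg_le_near cw); move: c0 => /cvgrPdist_lt/(_ _ s2); apply: filterS => t.
    rewrite sub0r normrN !ger0_norm ?norm1_ge0 // => /ltW lt; apply: le_trans lt.
    by have [_] := yP t; apply.
  by apply/negP; rewrite -real_ltNge ?gtr0_real // ltr_pdivrMr // mulr_natr mulr2n ltrDl.
have wz : w = z.
  apply/eqP; rewrite -subr_eq0; apply/eqP; apply: (unitmx_inj wu).
  by rewrite -(residualB _ b) // rz rw0 subrr.
rewrite {w tw wu rw0 pw}wz in yw.
exists y => //.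
have J : U [set t | jacobian nu (Rt t) (y t) (y t) \in unitmx].
  exact: (jacobian_unit_near RR tz nd yw yw).
have I : U [set t | forall j, `|y t j 0 - z j 0| < rho].
  apply: filter_forall => j; have /cvgrPdist_lt/(_ _ rho0) := yw j.
  by apply: filterS => t; rewrite distrC.
apply: filterS (filterI J I) => t [/= uJ yI].
have [yD ymin] := yP t.
split; first by have [] := D _ yD.
by apply: (minimum_is_zero _ yI uJ ymin) => u /D [].
Qed.

(** The bound on the inverses keeps the limit in the torus. *)
Lemma bounded_torus_limit (T : Type) (U : set_system T) (y : T -> 'cV[C]_n) (M : C) :
  UltraFilter U -> U [set t | forall j, `|y t j 0| <= M /\ `|(y t j 0)^-1| <= M] ->
  U [set t | torus (y t)] -> exists2 z, cvgv U y z & torus z.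
Proof.
move=> UU yM ty.
have [z yz] : exists z, cvgv U y z.
  by apply: (bounded_converge_vec bC (M := M)); apply: filterS yM => t H j; have [] := H j.
exists z => // j; apply/eqP => z0.
have M0 : 0 <= M.
  by have [t /(_ j)[+ _]] := filter_ex yM; apply: le_trans.
have /cvgrPdist_lt/(_ (M + 1)^-1) := yz j; rewrite invr_gt0 ltr_wpDl // => /(_ isT) H.
have [t [/= [h1 h2] h3]] := filter_ex (filterI (filterI H yM) ty).
move: h1; rewrite z0 sub0r normrN => h1.
have [_] := h2 j; rewrite normfV => h4.
have : `|y t j 0|^-1 < M + 1 by apply: le_lt_trans h4 _; rewrite ltrDl.
have yp : 0 < `|y t j 0| by rewrite normr_gt0; exact: h3.
rewrite -[M + 1]invrK ltf_pV2 ?posrE ?invr_gt0 ?ltr_wpDl //.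
by move=> h5; have := lt_trans h1 h5; rewrite ltxx.
Qed.

Lemma cvg_laurent_sol (T : Type) (U : set_system T) (Rt : T -> 'M[C]_n) R
    (y : T -> 'cV[C]_n) z :
  ProperFilter U -> (forall i j, (fun t => Rt t i j) @ U --> R i j) ->
  torus z -> cvgv U y z -> U [set t | laurent_sol nu b (Rt t) (y t)] ->
  laurent_sol nu b R z.
Proof.
move=> UU RR tz yz sol; split=> //; apply/colP => i; rewrite [RHS]mxE.
have cr : (fun t => residual nu b (Rt t) (y t) i 0) @ U --> residual nu b R z i 0.
  exact: cvg_residual.
have c0 : (fun=> 0 : C) @ U --> (0 : C) by exact: cvg_cst.
apply: (cvg_eq_near cr c0).
by apply: filterS sol => t [_ ->]; rewrite mxE.
Qed.

(** Infinitely many solutions would carry an ultrafilter containing no finite set; its limit is a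
    solution, near which uniqueness leaves only that one point. *)
Lemma laurent_sol_finite R :
  (forall z, laurent_sol nu b R z -> nondegenerate nu R z) ->
  (forall U : set_system 'cV[C]_n, UltraFilter U ->
     U [set y | laurent_sol nu b R y] ->
     exists M, U [set y : 'cV[C]_n | forall j, `|y j 0| <= M /\ `|(y j 0)^-1| <= M]) ->
  exists d, has_card (laurent_sol nu b R) d.
Proof.
move=> nd bd; have [fin|inf] := pselect (finite_set [set y | laurent_sol nu b R y]).
  have /finite_seqP[l lP] := fin; exists (size (undup l)), (undup l); split=> //.
    exact: undup_uniq.
  by move=> y; rewrite mem_undup; have := congr1 (fun A : set _ => A y) lP => /= ->.
exfalso; set S := [set y | laurent_sol nu b R y] in inf.
pose G : set_system 'cV[C]_n := [set A | finite_set (S `\` A)].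
have FG : ProperFilter G.
  split; first by rewrite /G /= setD0.
  split.
  - by rewrite /G /= setDT.
  - by move=> A B; rewrite /G /= setDIr finite_setU.
  - by move=> A B AB; apply: sub_finite_set; exact: setDS.
have [U [UU GU]] := ultraFilterLemma FG.
have US : U S by apply: GU; rewrite /G /= setDv.
have [M yM] := bd U UU US.
have ty : U [set y | torus y] by apply: filterS US => y [].
have [z yz tz] := bounded_torus_limit UU yM ty.
have RR i j : (fun _ : 'cV[C]_n => R i j) @ U --> R i j by exact: cvg_cst.
have solz : laurent_sol nu b R z by exact: (cvg_laurent_sol _ RR tz yz US).
have zz : cvgv U (fun=> z) z by move=> j; exact: cvg_cst.
have Uz : U [set y | y = z].
  apply: (sol_unique_near RR tz (nd _ solz) yz zz (b := b)).
  by apply: filterS US => y.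
have Unz : U (~` [set z]) by apply: GU; rewrite /G /= setDE setCK; apply: finite_setIr.
by have [y []] := filter_ex (filterI Uz Unz).
Qed.

(** [D] is a side condition that selects solutions and must hold along every family tending to a
    solution of the limit system. Each of the [d] limit solutions continues to a family of selected
    solutions; the families stay distinct because their limits are, and any further solution would
    by compactness tend to some limit solution and coincide with its family. *)
Lemma local_count (T : Type) (F : set_system T) (Rt : T -> 'M[C]_n) R
    (D : T -> 'cV[C]_n -> Prop) d :
  Filter F -> (forall i j, (fun t => Rt t i j) @ F --> R i j) ->
  (forall z, laurent_sol nu b R z -> nondegenerate nu R z) ->
  (forall (U : set_system T) (y : T -> 'cV[C]_n), UltraFilter U -> F `<=` U ->
     U [set t | laurent_sol nu b (Rt t) (y t) /\ D t (y t)] ->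
     exists M, U [set t | forall j, `|y t j 0| <= M /\ `|(y t j 0)^-1| <= M]) ->
  (forall (U : set_system T) (y : T -> 'cV[C]_n) z, UltraFilter U -> F `<=` U ->
     laurent_sol nu b R z -> cvgv U y z -> U [set t | D t (y t)]) ->
  has_card (laurent_sol nu b R) d ->
  F [set t | has_card (fun y => laurent_sol nu b (Rt t) y /\ D t y) d].
Proof.
move=> FF RF nd bd DU [l [ul sl lP]]; apply: filter_from_ultra => U UU FU.
have RR i j : (fun t => Rt t i j) @ U --> R i j.
  by apply: cvg_trans (RF i j); exact: cvg_app.
have /choice[Y YP] : forall z, exists y : T -> 'cV[C]_n, z \in l ->
    U [set t | laurent_sol nu b (Rt t) (y t)] /\ cvgv U y z.
  move=> z; have [zl|zl] := boolP (z \in l); last by exists (fun=> 0).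
  have [y y1 y2] := sol_exists_near UU RR (proj2 (lP z) zl) (nd _ (proj2 (lP z) zl)).
  by exists y.
have Ysol : U [set t | forall z : seq_sub l, laurent_sol nu b (Rt t) (Y (val z) t)
    /\ D t (Y (val z) t)].
  apply: filter_forall => z.
  have [s1 s2] := YP _ (valP z).
  by apply: filterI s1 _; apply: (DU U _ (val z)) => //; apply/lP; exact: valP.
have Ydist : U [set t | forall z z' : seq_sub l, Y (val z) t = Y (val z') t -> z = z'].
  apply: filter_forall => z; apply: filter_forall => z'.
  have [->|zz'] := eqVneq z z'; first by apply: nearW.
  have [j zj] : exists j, val z j 0 != val z' j 0.
    apply: contrapT => H; case/eqP: zz'; apply/val_inj/colP => j.
    by apply/eqP; apply: contraPT (H) => ?; apply; exists j.
  have [_ c1] := YP _ (valP z); have [_ c2] := YP _ (valP z').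
  have cB : (fun t => Y (val z) t j 0 - Y (val z') t j 0) @ U --> val z j 0 - val z' j 0.
    by apply: cvgB; [exact: c1 | exact: c2].
  have B0 : val z j 0 - val z' j 0 != 0 by rewrite subr_eq0.
  apply: filterS (cvg_near_neq B0 cB) => t /= + E; rewrite E subrr eqxx; by [].
have Yall : U [set t | forall y, laurent_sol nu b (Rt t) y /\ D t y ->
    exists z : seq_sub l, y = Y (val z) t].
  apply: contrapT => /ultra_not nU.
  have /choice[y yP] : forall t, exists y, ~ (forall y, laurent_sol nu b (Rt t) y /\ D t y ->
    exists z : seq_sub l, y = Y (val z) t) -> (laurent_sol nu b (Rt t) y /\ D t y) /\
     ~ exists z : seq_sub l, y = Y (val z) t.
    move=> t; have [H|nH] := pselect (forall y, laurent_sol nu b (Rt t) y /\ D t y ->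
      exists z : seq_sub l, y = Y (val z) t); first by exists 0.
    by move/existsNP: (nH) => [y /not_implyP[y1 y2]]; exists y.
  have Uy : U [set t | laurent_sol nu b (Rt t) (y t) /\ D t (y t)].
    by apply: filterS nU => t /yP[].
  have [M yM] := bd U y UU FU Uy.
  have ty : U [set t | torus (y t)] by apply: filterS Uy => t [[]].
  have [z yz tz] := bounded_torus_limit UU yM ty.
  have solz : laurent_sol nu b R z.
    by apply: (cvg_laurent_sol _ RR tz yz); apply: filterS Uy => t [].
  have zl : z \in l by apply/lP.
  have [s1 s2] := YP _ zl.
  have Ue : U [set t | y t = Y z t].
    apply: (sol_unique_near RR tz (nd _ solz) yz s2 (b := b)).
    by apply: filterS (filterI Uy s1) => t [[]].
  have [t [/yP[_ n1] e1]] := filter_ex (filterI nU Ue).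
  by apply: n1; exists (SeqSub zl).
apply: filterS (filterI Ysol (filterI Ydist Yall)) => t [h1 [h2 h3]].
have finj : {in l &, injective (fun z => Y z t)}.
  by move=> z z' zl zl' E; have /(congr1 val) := h2 (SeqSub zl) (SeqSub zl') E.
exists (map (fun z => Y z t) l); split.
- by rewrite map_inj_in_uniq.
- by rewrite size_map.
- move=> y; split=> [/h3[z ->]|/mapP[z zl ->]]; first by apply: map_f; exact: valP.
  exact: (h1 (SeqSub zl)).
Qed.

End LocalCountUniqueness.

(** Pair the vanishing moments with the polynomial whose roots are the values in [s] other than
    [x0]; its degree is less than [A]. *)
Lemma vandermonde_group (F : fieldType) (J : finType) (P : pred J) (v x : J -> F)
    (s : seq F) (A : nat) :
  uniq s -> (size s <= A)%N -> (forall j, P j -> x j \in s) ->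
  (forall i, (i < A)%N -> \sum_(j | P j) v j * x j ^+ i = 0) ->
  forall x0, x0 \in s -> \sum_(j | P j && (x j == x0)) v j = 0.
Proof.
move=> us sA xs H x0 x0s.
pose q : {poly F} := \prod_(y <- rem x0 s) ('X - y%:P).
have sq : (size q <= A)%N.
  by rewrite size_prod_XsubC size_rem // prednK //; case: (s) x0s.
have Hq : \sum_(j | P j) v j * q.[x j] = 0.
  under eq_bigr => j _ do rewrite (horner_coef_wide _ sq) mulr_sumr.
  rewrite exchange_big /= big1 // => i _.
  under eq_bigr => j _ do rewrite mulrCA.
  by rewrite -mulr_sumr H ?mulr0.
have q0 : q.[x0] != 0.
  rewrite horner_prod prodf_seq_neq0; apply/allP => y; rewrite mem_rem_uniq // !inE.
  by case/andP => yx _; rewrite hornerXsubC subr_eq0 eq_sym.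
apply: (mulIf q0); rewrite mul0r -[RHS]Hq [RHS](bigID (fun j => x j == x0)) /=.
rewrite mulr_suml [X in _ + X]big1 ?addr0.
  by apply: eq_bigr => j /andP[_ /eqP->].
move=> j /andP[/xs xjs xj]; have : root q (x j).
  by rewrite root_prod_XsubC mem_rem_uniq // !inE xj.
by rewrite /root => /eqP ->; rewrite mulr0.
Qed.

(** * The system of residue conditions *)

Section Generic.
Variables (F : fieldType) (k : nat).

(* This prevents the coordinates of a limit of solutions from vanishing, from going to
   infinity, and from colliding after the [k]-th power. *)
Definition generic_weights (J : finType) (r : J -> F) : Prop :=
  forall eps : J -> F, (forall j, eps j = 0 \/ eps j ^+ k = 1) ->
    (exists j, eps j != 0) -> \sum_j r j * eps j != 0.

(** If there were at most [A] values u_j^k, the sum of r_j u_j^m over one class of equal k-th powers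
    would vanish. Within a class the quotients of the u_j are k-th roots of unity, so this is a
    relation that genericity forbids. *)
Lemma generic_support (J : finType) (r u : J -> F) (m : int) (A : nat) :
  generic_weights r -> (exists j, u j != 0) ->
  (forall i, (i < A)%N -> \sum_(j | u j != 0) r j * u j ^ (m + (i * k)%N%:Z) = 0) ->
  (A < size (undup [seq u j ^+ k | j <- enum J & u j != 0%R]))%N.
Proof.
move=> gr [j0 uj0] H; rewrite ltnNge; apply/negP.
set s := undup _ => sA.
have us : uniq s by exact: undup_uniq.
have xs j : u j != 0 -> u j ^+ k \in s.
  by move=> uj; rewrite mem_undup; apply: map_f; rewrite mem_filter uj mem_enum.
have H' i : (i < A)%N -> \sum_(j | u j != 0) (r j * u j ^ m) * (u j ^+ k) ^+ i = 0.
  move=> iA; rewrite -[RHS](H i iA); apply: eq_bigr => j uj.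
  by rewrite -mulrA -exprM mulnC expfzDr.
have G := vandermonde_group us sA xs H' (xs _ uj0).
pose eps j := if (u j != 0) && (u j ^+ k == u j0 ^+ k) then (u j / u j0) ^ m else 0.
have /negP[] : \sum_j r j * eps j != 0.
  apply: gr => [j|]; last first.
    by exists j0; rewrite /eps uj0 eqxx mulfV // exp1rz oner_neq0.
  rewrite /eps; case: ifP => [/andP[uj /eqP E]|]; [right|by left].
  by rewrite -[X in X = 1]/(_ ^ (k%:Z)) exprzAC -[_ ^ k%:Z]/(_ ^+ k)
    expr_div_n E mulfV ?expf_neq0 // exp1rz.
rewrite (bigID (fun j => (u j != 0) && (u j ^+ k == u j0 ^+ k))) /=.
rewrite [X in _ + X]big1 ?addr0; last first.
  by move=> j /negbTE nj; rewrite /eps nj mulr0.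
apply/eqP; apply: (mulIf (_ : u j0 ^ m != 0)); first by rewrite expfz_neq0.
rewrite mul0r -[RHS]G mulr_suml; apply: eq_bigr => j jP.
by rewrite /eps jP -mulrA -expfzMl divfK.
Qed.

Lemma generic_support_card (J : finType) (r u : J -> F) (m : int) (A : nat) :
  generic_weights r -> (exists j, u j != 0) ->
  (forall i, (i < A)%N -> \sum_(j | u j != 0) r j * u j ^ (m + (i * k)%N%:Z) = 0) ->
  (A < #|[pred j | u j != 0%R]|)%N.
Proof.
move=> gr uj H; apply: leq_trans (generic_support gr uj H) _.
rewrite (leq_trans (size_undup _)) // size_map cardE.
apply: uniq_leq_size; first by rewrite filter_uniq ?enum_uniq.
by move=> j; rewrite mem_filter !mem_enum => /andP[].
Qed.

End Generic.

(** * Compactness of the set of solutions *)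

Section Proper.
Variable C : numFieldType.
Hypothesis bC : bounded_converge C.
Variables (k : nat) (e : int) (J : finType).
Notation expo i := (e + (i * k)%N%:Z).
Hypothesis expo_neq0 : forall i : nat, expo i != 0.

(** The exponents do not decrease with [i], so the negative ones come first. *)
Lemma expo_sign (N : nat) : exists2 B, (B <= N)%N &
  (forall i, (i < B)%N -> expo i < 0) /\ (forall i, (B <= i < N)%N -> 0 < expo i).
Proof.
have ex : exists i, (0 < expo i) || (i == N) by exists N; rewrite eqxx orbT.
exists (ex_minn ex); case: ex_minnP => B PB Bmin; first by apply: Bmin; rewrite eqxx orbT.
split=> [i iB|i /andP[Bi iN]].
  have : ~~ (0 < expo i).
    by apply: contraL iB => Pi; rewrite -leqNgt; apply: Bmin; rewrite Pi.
  by rewrite -leNgt le_eqVlt (negbTE (expo_neq0 i)).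
case/orP: PB => [PB|/eqP BN]; last by move: iN; rewrite -BN ltnNge Bi.
by apply: lt_le_trans PB _; rewrite lerD2l lez_nat leq_mul2r Bi orbT.
Qed.

(* The coordinates of largest modulus solve the equations with positive exponents
   in the limit, and those of smallest modulus the ones with negative exponents;
   there are too few coordinates for these two classes to be disjoint. *)
Lemma ratios_converge (T : Type) (U : set_system T) (rt : T -> J -> C) (r : J -> C)
    (Y : T -> J -> C) (jmax jmin : J) :
  UltraFilter U -> (forall j, (fun t => rt t j) @ U --> r j) -> generic_weights k r ->
  U [set t | forall j, Y t j != 0] ->
  U [set t | forall j, `|Y t j| <= `|Y t jmax|] ->
  U [set t | forall j, `|Y t jmin| <= `|Y t j|] ->
  (forall i, (i < #|J|.-1)%N -> 0 < expo i ->
     (fun t => \sum_j rt t j * (Y t j / Y t jmax) ^ expo i) @ U --> (0 : C)) ->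
  (forall i, (i < #|J|.-1)%N -> expo i < 0 ->
     (fun t => \sum_j rt t j * (Y t j / Y t jmin) ^ expo i) @ U --> (0 : C)) ->
  forall o, exists c : J -> C, forall j, c j != 0 /\ (fun t => Y t j / Y t o) @ U --> c j.
Proof.
move=> UU rr gr Y0 Ymax Ymin Hpos Hneg o.
have le1 (a c : C) : c != 0 -> `|a| <= `|c| -> `|a / c| <= 1.
  by move=> c0 ac; rewrite normf_div ler_pdivrMr ?normr_gt0 // mul1r.
(* The limits may vanish at some coordinates: [u j != 0] means that coordinate [j] is comparable
   with the largest one, and [w j != 0] below that it is comparable with the smallest one. *)
have /choice[u uP] : forall j, exists c : C, (fun t => Y t j / Y t jmax) @ U --> c.
  move=> j; apply: (bC (M := 1)).
  by apply: filterS (filterI Y0 Ymax) => t [/= y0 ym]; apply: le1.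
have /choice[w wP] : forall j, exists c : C, (fun t => Y t jmin / Y t j) @ U --> c.
  move=> j; apply: (bC (M := 1)).
  by apply: filterS (filterI Y0 Ymin) => t [/= y0 ym]; apply: le1.
have c1 : (fun=> 1 : C) @ U --> (1 : C) by exact: cvg_cst.
have umax : u jmax = 1.
  apply: (cvg_eq_near (uP jmax) c1); apply: filterS Y0 => t /= y0.
  by rewrite mulfV.
have wmin : w jmin = 1.
  apply: (cvg_eq_near (wP jmin) c1); apply: filterS Y0 => t /= y0.
  by rewrite mulfV.
have [B BN [Bneg Bpos]] := expo_sign #|J|.-1.
have supp (x : J -> C) m : (0 < m)%N ->
    \sum_(j | x j != 0) r j * x j ^+ m = \sum_j r j * x j ^+ m.
  move=> m0; rewrite [RHS](bigID (fun j => x j != 0)) /= [X in _ + X]big1 ?addr0 //.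
  by move=> j /negPn/eqP ->; rewrite expr0n gtn_eqF // mulr0.
(* Put N = #|J| - 1. In the limit the N - B equations with positive exponents involve only the
   support of [u], which genericity makes larger than N - B. *)
have cu : (#|J|.-1 - B < #|[pred j | u j != 0%R]|)%N.
  apply: (@generic_support_card _ k J r u (expo B)) => //.
    by exists jmax; rewrite umax oner_neq0.
  move=> i iA; have iB : (B <= B + i < #|J|.-1)%N by rewrite leq_addr -ltn_subRL.
  have -> : expo B + (i * k)%N%:Z = expo (B + i)%N by rewrite -addrA -PoszD -mulnDl.
  have /andP[_ iN] := iB.
  have := Hpos _ iN (Bpos _ iB); have := Bpos _ iB.
  case: (expo (B + i)%N) => // m m0 c0; rewrite supp //.
  apply: (cvg_unique _ _ c0) => //.
  by apply: cvg_bigsum => j; apply: cvgM => //; exact: cvg_expn.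
(* Likewise for the B negative exponents, taken from the last to the first so that their negatives
   increase from [- expo B.-1]. *)
have cw : (B < #|[pred j | w j != 0%R]|)%N.
  case: (posnP B) => [->|B0].
    by apply/card_gt0P; exists jmin; rewrite inE wmin oner_neq0.
  apply: (@generic_support_card _ k J r w (- expo B.-1)) => //.
    by exists jmin; rewrite wmin oner_neq0.
  move=> i iB; have iB' : (B.-1 - i < B)%N by rewrite (leq_ltn_trans (leq_subr _ _)) // prednK.
  have -> : - expo B.-1 + (i * k)%N%:Z = - expo (B.-1 - i)%N.
    have iB1 : (i <= B.-1)%N by rewrite -ltnS prednK.
    by rewrite -{1}(subnK iB1) mulnDl PoszD addrA opprD subrK.
  have := Hneg _ (leq_trans iB' BN) (Bneg _ iB'); have := Bneg _ iB'.
  case: (expo (B.-1 - i)%N) => // m _; rewrite NegzE opprK => c0; rewrite supp //.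
  apply: (cvg_unique _ _ c0) => //.
  apply: cvg_bigsum => j; apply: cvgM => //.
  under eq_fun do rewrite -exprnN -exprVn invf_div.
  exact: cvg_expn.
(* The supports together have at least (N - B + 1) + (B + 1) = N + 2 elements, one more than [J]
   has. A common coordinate makes the largest and the smallest comparable. *)
have [j [uj wj]] : exists j, u j != 0 /\ w j != 0.
  apply: contrapT => nj.
  have := max_card (predU [pred j | u j != 0] [pred j | w j != 0]).
  rewrite -[X in (X <= _)%N]addn0.
  have <- : #|predI [pred j | u j != 0%R] [pred j | w j != 0%R]| = 0%N.
    apply: eq_card0 => j; rewrite !inE; apply/negP => /andP[h1 h2]; apply: nj.
    by exists j.
  rewrite cardUI; apply/negP; rewrite -ltnNge.
  apply: leq_trans (leq_add cu cw); rewrite addnS addSn subnK // ltnS.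
  by rewrite prednK //; apply/card_gt0P; exists jmax.
have uw0 : u j * w j != 0 by rewrite mulf_neq0.
have cr : (fun t => Y t jmin / Y t jmax) @ U --> u j * w j.
  apply: cvg_trans (cvgM (uP j) (wP j)); apply: near_eq_cvg.
  by apply: filterS Y0 => t /= y0; rewrite mulrC [LHS]mulrA divfK.
have ccv i : (fun t => Y t i / Y t jmin) @ U --> u i / (u j * w j).
  apply: cvg_trans (cvgM (uP i) (cvgV uw0 cr)); apply: near_eq_cvg.
  by apply: filterS Y0 => t /= y0; rewrite /= invf_div mulrA divfK.
have cn0 i : u i / (u j * w j) != 0.
  apply/eqP => c0.
  have : (fun t => (Y t i / Y t jmin) * (Y t jmin / Y t i)) @ U --> u i / (u j * w j) * w i.
    by apply: cvgM.
  rewrite c0 mul0r => cc.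
  have : (1 : C) = 0.
    apply: (cvg_eq_near c1 cc); apply: filterS Y0 => t /= y0.
    by rewrite mulrA divfK // mulfV.
  by move/eqP; rewrite oner_eq0.
exists (fun i => (u i / (u j * w j)) / (u o / (u j * w j))) => i; split.
  by rewrite mulf_neq0 ?invr_neq0.
apply: cvg_trans (cvgM (ccv i) (cvgV (cn0 o) (ccv o))); apply: near_eq_cvg.
by apply: filterS Y0 => t /= y0; rewrite /= invf_div mulrA divfK.
Qed.
End Proper.

Lemma big_option (V : nmodType) (I : finType) (F : option I -> V) :
  \sum_o F o = F None + \sum_i F (Some i).
Proof.
rewrite (bigD1 None) //=; congr (_ + _).
rewrite (reindex_omap Some id) /=; last by case.
by apply: eq_bigl => i; rewrite eqxx.
Qed.

Lemma vandermonde_inj (F : fieldType) (J : finType) (v x : J -> F) (A : nat) :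
  injective x -> (#|J| <= A)%N ->
  (forall i, (i < A)%N -> \sum_j v j * x j ^+ i = 0) -> forall j, v j = 0.
Proof.
move=> xinj JA H j.
have us : uniq (codom x) by apply/injectiveP.
have sA : (size (codom x) <= A)%N by rewrite size_codom.
have := @vandermonde_group _ _ predT v x _ A us sA (fun j _ => codom_f x j) H _ (codom_f x j).
by rewrite (eq_bigl (pred1 j)) ?big_pred1_eq // => i; rewrite /= (inj_eq xinj).
Qed.

(** * The residue system with one unknown normalised to 1 *)

Section Problem.
Variable C : numFieldType.
Variable k : nat.

Definition exponent (e : int) (i : nat) : int := e + (i * k)%N%:Z.

(** The index [None] belongs to the unknown normalised to 1. Its weight [b] never moves, and the
    remaining unknowns form a square system. *)
Definition weights n (b : C) (r : 'I_n -> C) (o : option 'I_n) : C := oapp r b o.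

Definition coords n (y : 'cV[C]_n) (o : option 'I_n) : C := oapp (fun j => y j 0) 1 o.

Definition residue_sol n (e : int) (b : C) (r : 'I_n -> C) (y : 'cV[C]_n) : Prop :=
  laurent_sol (fun i : 'I_n => exponent e i) b (\matrix_(i, j) r j) y.

Lemma coords_neq0 n (y : 'cV[C]_n) o : torus y -> coords y o != 0.
Proof. by move=> ty; case: o => [j|] /=; [exact: ty | exact: oner_neq0]. Qed.

Lemma weights_coords n b (r : 'I_n -> C) y m :
  \sum_o weights b r o * coords y o ^ m = b + \sum_j r j * y j 0 ^ m.
Proof. by rewrite big_option /= exp1rz mulr1. Qed.

Lemma residue_solP n e b (r : 'I_n -> C) y :
  residue_sol e b r y <-> torus y /\
    forall i, (i < n)%N -> \sum_o weights b r o * coords y o ^ exponent e i = 0.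
Proof.
split=> -[ty H]; split=> //.
  move=> i ni; rewrite weights_coords.
  have := congr1 (fun w : 'cV[C]_n => w (Ordinal ni) 0) H; rewrite !mxE; apply: etrans.
  by congr (_ + _); apply: eq_bigr => j _; rewrite mxE.
apply/colP => i; rewrite !mxE -[RHS](H i (ltn_ord i)) weights_coords.
by congr (_ + _); apply: eq_bigr => j _; rewrite mxE.
Qed.

Lemma coords_support n b (r : 'I_n -> C) y e A : generic_weights k (weights b r) ->
  torus y -> (forall i, (i < A)%N -> \sum_o weights b r o * coords y o ^ exponent e i = 0) ->
  (A < size (undup (codom (fun o => coords y o ^+ k))))%N.
Proof.
move=> gr ty H.
have cn0 o := @coords_neq0 _ y o ty.
have := @generic_support _ k _ (weights b r) (coords y) e A gr.
have -> : [seq coords y j ^+ k | j <- enum {: option 'I_n} & coords y j != 0%R] =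
    codom (fun o => coords y o ^+ k).
  by rewrite codomE; congr map; apply/all_filterP/allP => o _; exact: cn0.
apply; first by exists None.
by move=> i iA; rewrite -[RHS](H i iA); apply: eq_bigl => o; rewrite cn0.
Qed.

(** With n + 1 equations, the n + 1 coordinates would need n + 2 distinct k-th powers. *)
Lemma coords_overdetermined n b (r : 'I_n -> C) y e : generic_weights k (weights b r) ->
  torus y ->
  ~ (forall i, (i < n.+1)%N -> \sum_o weights b r o * coords y o ^ exponent e i = 0).
Proof.
move=> gr ty /(coords_support gr ty); rewrite ltnNge => /negP; apply.
by rewrite (leq_trans (size_undup _)) // size_codom card_option card_ord.
Qed.

(** The n equations force n + 1 distinct k-th powers among n + 1 coordinates. For differentials this
    says that the poles do not collide. *)
Lemma coords_injective n b (r : 'I_n -> C) y e : generic_weights k (weights b r) ->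
  residue_sol e b r y -> injective (fun o => coords y o ^+ k).
Proof.
move=> gr /residue_solP[ty H]; apply/injectiveP; rewrite /injectiveb /dinjectiveb.
rewrite -codomE -[uniq _]negbK -ltn_size_undup -leqNgt size_codom card_option card_ord.
exact: coords_support H.
Qed.

Lemma weights_neq0 (J : finType) (r : J -> C) : generic_weights k r -> forall j, r j != 0.
Proof.
move=> gr j; have := gr (fun i => (i == j)%:R).
rewrite (bigD1 j) //= eqxx mulr1 big1 ?addr0; last by move=> i /negbTE ->; rewrite mulr0.
apply; last by exists j; rewrite eqxx oner_neq0.
by move=> i; case: eqP; [right; rewrite expr1n | left].
Qed.

(** Divided by the nonzero exponents, the linearised system is a Vandermonde system in the distinct
    values y_j^k. *)
Lemma residue_sol_nondegenerate n e b (r : 'I_n -> C) y :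
  (forall i, exponent e i != 0) -> generic_weights k (weights b r) -> residue_sol e b r y ->
  nondegenerate (fun i : 'I_n => exponent e i) (\matrix_(i, j) r j) y.
Proof.
move=> e0 gr sol v Hv; have [ty _] := sol; apply/colP => j; rewrite mxE.
have xinj : injective (fun j => y j 0 ^+ k).
  by move=> i j' E; have [] := coords_injective gr sol (x1 := Some i) (x2 := Some j') E.
have := @vandermonde_inj _ _ (fun j => r j * y j 0 ^ (e - 1) * v j 0) _ n xinj.
rewrite card_ord => /(_ (leqnn n)) H.
suff Hs : forall i, (i < n)%N ->
    \sum_(j < n) r j * y j 0 ^ (e - 1) * v j 0 * (y j 0 ^+ k) ^+ i = 0.
  have /eqP := H Hs j; rewrite !mulf_eq0 (negbTE (weights_neq0 gr (Some j))) expfz_eq0.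
  by rewrite (negbTE (ty j)) andbF /= => /eqP.
move=> i ni.
have ei : (exponent e i)%:~R != 0 :> C by rewrite intr_eq0.
apply: (mulfI ei); rewrite mulr0 -[RHS](Hv (Ordinal ni)) mulr_sumr.
apply: eq_bigr => h _; rewrite mxE /=.
have -> : exponent e i - 1 = e - 1 + (k * i)%N%:Z by rewrite /exponent addrAC mulnC.
rewrite [_ ^ (e - 1 + _)]expfzDr // -exprM -!mulrA; congr (_ * (_ * (_ * _))).
by rewrite mulrC.
Qed.

End Problem.

Lemma exists_max (C : numFieldType) (J : finType) (j0 : J) (g : J -> C) :
  (forall j, g j \is Num.real) -> exists j, forall i, g i <= g j.
Proof.
move=> gr; suff [j H] : exists j, forall i, i \in enum J -> g i <= g j.
  by exists j => i; apply: H; rewrite mem_enum.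
elim: (enum J) => [|a s [j Hj]]; first by exists j0.
have /orP[aj|ja] := real_leVge (gr a) (gr j).
  by exists j => i; rewrite inE => /orP[/eqP->|/Hj].
exists a => i; rewrite inE => /orP[/eqP->//|/Hj ij]; exact: le_trans ja.
Qed.

Section UltraMax.
Variables (C : numFieldType) (T : Type) (U : set_system T) (J : finType) (f : T -> J -> C).
Hypothesis UU : UltraFilter U.

Lemma ultra_max (j0 : J) : exists j, U [set t | forall i, `|f t i| <= `|f t j|].
Proof.
apply: ultra_finite_choice; apply: nearW => t.
have [j H] := @exists_max C J j0 (fun j => `|f t j|) (fun j => normr_real _).
by exists j.
Qed.

Lemma ultra_min (j0 : J) : exists j, U [set t | forall i, `|f t j| <= `|f t i|].
Proof.
apply: ultra_finite_choice; apply: nearW => t.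
have [|j H] := @exists_max C J j0 (fun j => - `|f t j|).
  by move=> j; rewrite rpredN normr_real.
by exists j => i; rewrite -lerN2; exact: H.
Qed.

Lemma cvgv_bounded n (y : T -> 'cV[C]_n) z : torus z -> cvgv U y z ->
  exists M, U [set t | forall j, `|y t j 0| <= M /\ `|(y t j 0)^-1| <= M].
Proof.
move=> tz yz; exists (\sum_j (`|z j 0| + 1 + (`|(z j 0)^-1| + 1))).
apply: filter_forall => j.
have le_sum (a : C) : a <= `|z j 0| + 1 + (`|(z j 0)^-1| + 1) ->
    a <= \sum_j (`|z j 0| + 1 + (`|(z j 0)^-1| + 1)).
  move=> le; rewrite (bigD1 j) //=; apply: le_trans le _; rewrite lerDl sumr_ge0 // => i _.
  by rewrite !addr_ge0.
have bound (g : T -> C) c : g @ U --> c -> U [set t | `|g t| <= `|c| + 1].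
  move=> /cvgrPdist_lt/(_ 1 ltr01); apply: filterS => t /ltW H.
  rewrite /= -[g t](subKr c) (le_trans (ler_normB _ _)) // lerD2l //.
have b1 := bound _ _ (yz j).
have b2 : U [set t | `|(y t j 0)^-1| <= `|(z j 0)^-1| + 1].
  by apply: bound; exact: (@cvgV _ _ _ _ (fun t => y t j 0) _ (tz j) (yz j)).
apply: filterS (filterI b1 b2) => t [/= h1 h2]; split; apply: le_sum.
  by apply: le_trans h1 _; rewrite lerDl addr_ge0.
by apply: le_trans h2 _; rewrite lerDr addr_ge0.
Qed.
End UltraMax.

Definition ord_cons (X : Type) n (s : X) (r : 'I_n -> X) (j : 'I_n.+1) : X :=
  oapp r s (unlift ord0 j).

Lemma ord_cons0 (X : Type) n (s : X) (r : 'I_n -> X) : ord_cons s r ord0 = s.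
Proof. by rewrite /ord_cons unlift_none. Qed.

Lemma ord_consS (X : Type) n (s : X) (r : 'I_n -> X) j : ord_cons s r (lift ord0 j) = r j.
Proof. by rewrite /ord_cons liftK. Qed.

Lemma cvg_ord_cons (X : topologicalType) (T : Type) (F : set_system T) (FF : Filter F)
    n (s : X) (r : 'I_n -> X)
    (f : T -> X) j : f @ F --> s -> (fun t => ord_cons (f t) r j) @ F --> ord_cons s r j.
Proof.
move=> fs; have [i ->|->] := unliftP ord0 j.
  have -> : (fun t => ord_cons (f t) r (lift ord0 i)) = fun=> r i.
    by apply/funext => t; rewrite ord_consS.
  by rewrite ord_consS; exact: cvg_cst.
have -> : (fun t => ord_cons (f t) r ord0) = f by apply/funext => t; rewrite ord_cons0.
by rewrite ord_cons0.
Qed.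

Section Good.
Variable C : numFieldType.
Hypothesis bC : bounded_converge C.
Variable k : nat.
Hypothesis k_gt0 : (0 < k)%N.
Variable e : int.
Hypothesis e_neq0 : forall i, exponent k e i != 0.

(** Division by a power of one coordinate keeps the equations exact, so [ratios_converge] applies;
    the ratios to the coordinate [None], which is 1, are the unknowns themselves. *)
Lemma residue_sol_bounded n (b : C) (T : Type) (U : set_system T) (rt : T -> 'I_n -> C)
    (r : 'I_n -> C) (y : T -> 'cV[C]_n) :
  UltraFilter U -> (forall j, (fun t => rt t j) @ U --> r j) ->
  generic_weights k (weights b r) ->
  U [set t | residue_sol k e b (rt t) (y t)] ->
  exists M, U [set t | forall j, `|y t j 0| <= M /\ `|(y t j 0)^-1| <= M].
Proof.
move=> UU rr gr sol.
pose Y t := coords (y t).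
have ty : U [set t | torus (y t)] by apply: filterS sol => t [].
have Y0 : U [set t | forall o, Y t o != 0].
  by apply: filterS ty => t tt o; exact: coords_neq0.
have [jM HM] := ultra_max Y UU None; have [jm Hm] := ultra_min Y UU None.
have c0 : (fun=> 0 : C) @ U --> (0 : C) by exact: cvg_cst.
have zero j0 i : (i < n)%N ->
    (fun t => \sum_o weights b (rt t) o * (Y t o / Y t j0) ^ exponent k e i) @ U --> (0 : C).
  move=> ni; apply: cvg_trans c0; apply: near_eq_cvg.
  apply: filterS (filterI Y0 sol) => t /= [y0 /residue_solP[_ /(_ i ni) H]].
  under eq_bigr => o _ do rewrite expfzMl mulrA.
  by rewrite -mulr_suml H mul0r.
have wr o : (fun t => weights b (rt t) o) @ U --> weights b r o.
  by case: o => [j|]; [exact: rr | exact: cvg_cst].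
have [||c cP] := @ratios_converge C bC k e _ e_neq0 T U
   (fun t => weights b (rt t)) (weights b r) Y jM jm UU wr gr Y0 HM Hm _ _ None.
- by move=> i; rewrite card_option card_ord => ni _; exact: zero.
- by move=> i; rewrite card_option card_ord => ni _; exact: zero.
apply: (@cvgv_bounded _ _ _ UU _ _ (\col_j c (Some j))).
  by move=> j; rewrite mxE; have [] := cP (Some j).
move=> j; rewrite mxE; have [_] := cP (Some j); rewrite /Y /=.
by under eq_fun do rewrite divr1.
Qed.

Lemma residue_sol_finite n (b : C) (r : 'I_n -> C) : generic_weights k (weights b r) ->
  exists d, has_card (residue_sol k e b r) d.
Proof.
move=> gr; apply: (laurent_sol_finite bC).
  by move=> z; exact: residue_sol_nondegenerate.
move=> U UU sol; apply: (@residue_sol_bounded n b _ U (fun=> r) r id) => //.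
by move=> j; exact: cvg_cst.
Qed.

Lemma residue_sol_locally_constant n (b s0 : C) (r : 'I_n -> C) d :
  generic_weights k (weights b (ord_cons s0 r)) ->
  has_card (residue_sol k e b (ord_cons s0 r)) d ->
  \forall s \near s0, has_card (residue_sol k e b (ord_cons s r)) d.
Proof.
move=> gr hd.
have cs j : (fun s => ord_cons s r j) @ nbhs s0 --> ord_cons s0 r j.
  by apply: cvg_ord_cons; exact: cvg_id.
have H : nbhs s0 [set s | has_card (fun y => laurent_sol (fun i : 'I_n.+1 => exponent k e i) b
    (\matrix_(i, j) ord_cons s r j) y /\ True) d].
  apply: (@local_count _ bC n.+1 _ b C (nbhs s0) (fun s => \matrix_(i, j) ord_cons s r j)
    (\matrix_(i, j) ord_cons s0 r j) (fun _ _ => True) d (nbhs_filter s0) _ _ _ _ hd).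
  - by move=> i j; rewrite mxE; under eq_fun do rewrite mxE; exact: cs.
  - by move=> z; exact: residue_sol_nondegenerate.
  - move=> U y UU sU sol.
    apply: (@residue_sol_bounded n.+1 b _ U (fun s => ord_cons s r) (ord_cons s0 r) y) => //.
      by move=> j; apply: cvg_trans (cs j); exact: cvg_app.
    by apply: filterS sol => t [].
  - by move=> U y z UU _ _ _; exact: nearW.
by apply: filterS H => s; apply: eq_has_card => y; split=> [[] //|?]; split.
Qed.
End Good.

(** * A weight tending to zero *)

Section Degenerate.
Variable C : numFieldType.
Hypothesis bC : bounded_converge C.
Variable k : nat.
Hypothesis k_gt0 : (0 < k)%N.
Variable e : int.
Hypothesis e_neq0 : forall i, exponent k e i != 0.
Variables (n : nat) (b : C) (r : 'I_n -> C) (m : nat).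
Hypothesis gr : generic_weights k (weights b r).
Hypothesis top_exponent : exponent k e n = m.

(* The system of [ord_cons (theta ^+ m) r] after the substitution of [tau / theta] for
   the first unknown, which makes sense also at [theta = 0]. *)
Definition blowup (theta : C) : 'M[C]_n.+1 :=
  \matrix_(i, j) ord_cons (theta ^+ ((n - i) * k)%N) r j.

Definition tail (y : 'cV[C]_n.+1) : 'cV[C]_n := \col_j y (lift ord0 j) 0.

Lemma tail_torus y : torus y -> torus (tail y).
Proof. by move=> ty j; rewrite mxE; exact: ty. Qed.

Definition blowup_sol (theta : C) (y : 'cV[C]_n.+1) : Prop :=
  laurent_sol (fun i : 'I_n.+1 => exponent k e i) b (blowup theta) y.

Lemma blowup_solP theta y : blowup_sol theta y <-> torus y /\
  forall i, (i <= n)%N -> \sum_o weights b r o * coords (tail y) o ^ exponent k e i =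
    - (theta ^+ ((n - i) * k)%N * y ord0 0 ^ exponent k e i).
Proof.
have E (i : 'I_n.+1) : b + \sum_j (blowup theta) i j * y j 0 ^ exponent k e i =
   \sum_o weights b r o * coords (tail y) o ^ exponent k e i +
   theta ^+ ((n - i) * k)%N * y ord0 0 ^ exponent k e i.
  rewrite weights_coords big_ord_recl !mxE ord_cons0 addrCA addrC; congr (_ + _ + _).
  by apply: eq_bigr => j _; rewrite !mxE ord_consS.
split=> -[ty H]; split=> //.
  move=> i ni; have := congr1 (fun w : 'cV[C]_n.+1 => w (Ordinal (ni : (i < n.+1)%N)) 0) H.
  by rewrite /residual mxE E mxE /= => /eqP; rewrite addr_eq0 => /eqP.
by apply/colP => i; rewrite mxE E H ?addNr ?mxE // -ltnS.
Qed.

(** This accounts for the powers in [blowup]: theta^m (tau / theta)^(e + i k) = theta^((n - i) k)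
    tau^(e + i k). *)
Lemma exponent_sub i : (i <= n)%N -> exponent k e i = m%:Z - ((n - i) * k)%N%:Z.
Proof.
move=> ni; rewrite -top_exponent /exponent -addrA; congr (_ + _).
by rewrite -[X in (X * k)%N%:Z - _](subnK ni) mulnDl PoszD addrC addKr.
Qed.

Lemma m_gt0 : (0 < m)%N.
Proof. by have := e_neq0 n; rewrite top_exponent lt0n. Qed.

Lemma expr0_lt i : (i < n)%N -> (0 : C) ^+ ((n - i) * k)%N = 0.
Proof. by move=> ni; rewrite expr0n muln_eq0 subn_eq0 leqNgt ni gtn_eqF. Qed.

(** At theta = 0 only the last row still involves tau, so the system splits into n equations for the
    tail and a prescribed value of tau^m. That value is nonzero because the tail cannot satisfy n +
    1 equations. *)
Lemma blowup_sol0P y : blowup_sol 0 y <-> residue_sol k e b r (tail y) /\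
   y ord0 0 ^+ m = - \sum_o weights b r o * coords (tail y) o ^ (m%:Z).
Proof.
rewrite blowup_solP residue_solP.
split=> [[ty H]|[[ty H] Hm]].
  split; first split.
  - exact: tail_torus.
  - by move=> i ni; rewrite H 1?ltnW // expr0_lt // mul0r oppr0.
  - by have := H n (leqnn n); rewrite subnn mul0n expr0 mul1r top_exponent => ->; rewrite opprK.
have y0 : y ord0 0 != 0.
  apply/eqP => y00; apply: (@coords_overdetermined _ k n b r (tail y) e) => //.
  move=> i; rewrite ltnS leq_eqVlt => /orP[/eqP->|/H //].
  rewrite top_exponent; move: Hm; rewrite y00 expr0n gtn_eqF ?m_gt0 // => /esym/eqP.
  by rewrite oppr_eq0 => /eqP.
split.
  move=> j; have [i ->|->//] := unliftP ord0 j.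
  by have := ty i; rewrite mxE.
move=> i; rewrite leq_eqVlt => /orP[/eqP->|ni]; last by rewrite H // expr0_lt // mul0r oppr0.
by rewrite subnn mul0n expr0 mul1r top_exponent -exprnP Hm opprK.
Qed.

(** The linearisation is block triangular: the tail block is nondegenerate, and tau has the
    coefficient m tau^(m - 1) in the last row. *)
Lemma blowup_nondegenerate y : blowup_sol 0 y ->
  nondegenerate (fun i : 'I_n.+1 => exponent k e i) (blowup 0) y.
Proof.
move=> sol v Hv; have [ty _] := sol; have [sol' _] := (blowup_sol0P y).1 sol.
have tv : tail v = 0.
  apply: (residue_sol_nondegenerate e_neq0 gr sol') => i.
  have ni : (i < n.+1)%N by exact: leq_trans (ltn_ord i) _.
  rewrite -[RHS](Hv (Ordinal ni)) big_ord_recl !mxE ord_cons0 /= expr0_lt ?ltn_ord //.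
  rewrite mulr0 !mul0r add0r.
  by apply: eq_bigr => j _; rewrite !mxE ord_consS.
have v0 : v ord0 0 = 0.
  have := Hv ord_max; rewrite big_ord_recl [X in _ + X]big1 ?addr0; last first.
    move=> j _; have := congr1 (fun w : 'cV[C]_n => w j 0) tv; rewrite !mxE => ->.
    by rewrite mulr0.
  rewrite mxE ord_cons0 /= subnn mul0n expr0 mulr1 top_exponent => /eqP.
  rewrite !mulf_eq0 expfz_eq0 (negbTE (ty _)) andbF orbF intr_eq0.
  by rewrite -[_ == 0 :> int]/(m == 0%N) gtn_eqF ?m_gt0 // => /eqP.
apply/colP => j; have [i ->|->] := unliftP ord0 j; last by rewrite v0 mxE.
by have := congr1 (fun w : 'cV[C]_n => w i 0) tv; rewrite !mxE.
Qed.

(** The condition on moduli says that the original unknown tau / t has modulus at least 1; it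
    controls the equations with negative exponents. Once the tail converges in the torus, a zero
    limit of tau would again give n + 1 equations for n + 1 coordinates. *)
Lemma blowup_bounded (U : set_system C) (y : C -> 'cV[C]_n.+1) :
  UltraFilter U -> nbhs (0 : C) `<=` U ->
  U [set t | blowup_sol t (y t) /\ `|t| <= `|y t ord0 0|] ->
  exists M, U [set t | forall j, `|y t j 0| <= M /\ `|(y t j 0)^-1| <= M].
Proof.
move=> UU U0 sol.
pose Y t := coords (tail (y t)); pose tau t := y t ord0 0.
have ty : U [set t | torus (y t)] by apply: filterS sol => t [[]].
have Y0 : U [set t | forall o, Y t o != 0].
  by apply: filterS ty => t tt o; apply: coords_neq0; exact: tail_torus.
have tau0 : U [set t | tau t != 0] by apply: filterS ty => t; apply.
have [jM HM] := ultra_max Y UU None; have [jm Hm] := ultra_min Y UU None.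
have cid : id @ U --> (0 : C) by move=> A /U0.
pose S i t := \sum_o weights b r o * Y t o ^ exponent k e i.
have SE i : (i <= n)%N -> U [set t | S i t = - (t ^+ ((n - i) * k)%N * tau t ^ exponent k e i)].
  by move=> ni; apply: filterS sol => t /= [/blowup_solP[_ /(_ i ni)]].
(* The last equation, whose exponent m is positive, bounds |tau / Y_max|^m by [K]. *)
have [tl tlP] : exists tl : C, (fun t => tau t / Y t jM) @ U --> tl.
  pose K := \sum_o `|weights b r o|.
  have K0 : 0 <= K by exact: sumr_ge0.
  apply: (bC (M := K + 1)).
  apply: filterS (filterI Y0 (filterI HM (SE n (leqnn n)))) => t /= [y0 [ym]].
  rewrite /S subnn mul0n expr0 mul1r top_exponent => /(congr1 -%R); rewrite opprK => /esym E.
  have yM0 : 0 < `|Y t jM| by rewrite normr_gt0.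
  have le1 : `|tau t / Y t jM| ^+ m <= K.
    rewrite normf_div expr_div_n ler_pdivrMr ?exprn_gt0 // -normrX exprnP E normrN.
    apply: le_trans (ler_norm_sum _ _ _) _; rewrite mulr_suml; apply: ler_sum => o _.
    by rewrite normrM ler_wpM2l // -exprnP normrX lerXn2r ?nnegrE.
  have [//|lt] := real_leP (y := K + 1) (normr_real (tau t / Y t jM))
    (rpredD (ger0_real K0) (real1 _)).
  have x1 : 1 <= `|tau t / Y t jM| by apply: le_trans (ltW lt); rewrite lerDr.
  have := lt_le_trans lt (le_trans (ler_eXnr m_gt0 x1) le1).
  by rewrite gtrDl ltr10.
have cpos i : (i < n)%N -> 0 < exponent k e i ->
    (fun t => S i t / Y t jM ^ exponent k e i) @ U --> (0 : C).
  move=> ni; have := SE i (ltnW ni); case: (exponent k e i) => // q Hq _.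
  have : (fun t => - (t ^+ ((n - i) * k)%N * (tau t / Y t jM) ^+ q)) @ U -->
      - (0 ^+ ((n - i) * k)%N * tl ^+ q).
    by apply: cvgN; apply: cvgM; exact: cvg_expn.
  rewrite expr0_lt // mul0r oppr0; apply: cvg_trans; apply: near_eq_cvg.
  apply: filterS (filterI Y0 Hq) => t [/= y0 ->].
  by rewrite -exprnP expr_div_n mulrA mulNr.
have cneg i : (i < n)%N -> exponent k e i < 0 ->
    (fun t => S i t / Y t jm ^ exponent k e i) @ U --> (0 : C).
  move=> ni; have := SE i (ltnW ni); have := exponent_sub (ltnW ni).
  case: (exponent k e i) => // q; rewrite NegzE => Eq Hq _.
  have [z zP] : exists z : C, (fun t => t * (Y t jm / tau t)) @ U --> z.
    apply: (bC (M := 1)).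
    apply: filterS (filterI tau0 (filterI Hm sol)) => t /= [t0 [ym [_ lt]]].
    rewrite mulrCA normrM -[1]mulr1 ler_pM //.
      by have := ym None; rewrite /Y /= normr1.
    by rewrite normf_div ler_pdivrMr ?normr_gt0 // mul1r.
  (* As e + i k = -(q + 1), the power t^((n - i) k) is t^(q + 1), which balances (Y_min / tau)^(q +
     1), times t^m, which tends to 0. *)
  have nk : ((n - i) * k = m + q.+1)%N.
    by apply/eqP; rewrite -eqz_nat PoszD -[q.+1%:Z]opprK Eq opprB addrC subrK.
  have : (fun t => - (t ^+ m * (t * (Y t jm / tau t)) ^+ q.+1)) @ U --> - (0 ^+ m * z ^+ q.+1).
    by apply: cvgN; apply: cvgM; exact: cvg_expn.
  rewrite expr0n gtn_eqF ?m_gt0 // mul0r oppr0; apply: cvg_trans; apply: near_eq_cvg.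
  apply: filterS (filterI Y0 Hq) => t [/= y0 ->].
  rewrite nk -!exprnN invrK exprD exprMn expr_div_n mulNr !mulrA.
  by congr (- _); rewrite mulrAC.
have ratio j0 i t : (forall o, Y t o != 0) ->
    \sum_o weights b r o * (Y t o / Y t j0) ^ exponent k e i = S i t / Y t j0 ^ exponent k e i.
  move=> y0; rewrite mulr_suml; apply: eq_bigr => o _.
  by rewrite expfzMl mulrA exprz_inv invr_expz.
have wr o : (fun _ : C => weights b r o) @ U --> weights b r o by exact: cvg_cst.
have [||c cP] := @ratios_converge C bC k e _ e_neq0 C U
   (fun _ => weights b r) (weights b r) Y jM jm UU wr gr Y0 HM Hm _ _ None.
- move=> i; rewrite card_option card_ord => ni Pi; apply: cvg_trans (cpos i ni Pi).
  by apply: near_eq_cvg; apply: filterS Y0 => t y0; rewrite -ratio.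
- move=> i; rewrite card_option card_ord => ni Pi; apply: cvg_trans (cneg i ni Pi).
  by apply: near_eq_cvg; apply: filterS Y0 => t y0; rewrite -ratio.
have cY o : (fun t => Y t o) @ U --> c o.
  have [_] := cP o; apply: cvg_trans; apply: near_eq_cvg; apply: nearW => t.
  by rewrite /Y /= divr1.
have cn0 o : c o != 0 by have [] := cP o.
have ctau : tau @ U --> tl * c jM.
  apply: cvg_trans (cvgM tlP (cY jM)); apply: near_eq_cvg.
  by apply: filterS Y0 => t /= y0; rewrite divfK.
have cS i : S i @ U --> \sum_o weights b r o * c o ^ exponent k e i.
  apply: cvg_bigsum => o; apply: cvgM; first exact: cvg_cst.
  by apply: cvg_exprz => //; exact: cY.
have c1 : c None = 1.
  apply: (cvg_eq_near (cY None) (_ : (fun=> 1) @ U --> (1 : C))); first exact: cvg_cst.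
  exact: nearW.
pose z := \col_j c (Some j).
have cz : coords z =1 c by case=> [j|] /=; rewrite ?mxE // c1.
have tz : torus z by move=> j; rewrite mxE.
have tl0 : tl * c jM != 0.
  apply/eqP => t0; apply: (coords_overdetermined (e := e) gr tz) => i.
  under eq_bigr => o _ do rewrite cz.
  have cE j0 : (fun t => S i t / Y t j0 ^ exponent k e i) @ U -->
      (\sum_o weights b r o * c o ^ exponent k e i) / c j0 ^ exponent k e i.
    apply: cvgM; first exact: cS.
    apply: (@cvgV _ _ _ _ (fun t => Y t j0 ^ exponent k e i)).
      by rewrite expfz_neq0.
    by apply: cvg_exprz => //; exact: cY.
  have fin j0 : (\sum_o weights b r o * c o ^ exponent k e i) / c j0 ^ exponent k e i = 0 ->
      \sum_o weights b r o * c o ^ exponent k e i = 0.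
    by move=> /eqP; rewrite mulf_eq0 invr_eq0 expfz_eq0 (negbTE (cn0 _)) andbF orbF => /eqP.
  rewrite ltnS leq_eqVlt => /orP[/eqP ni|ni].
    have : (fun t => - tau t ^+ m) @ U --> - (tl * c jM) ^+ m.
      by apply: cvgN; exact: cvg_expn.
    rewrite t0 expr0n gtn_eqF ?m_gt0 // oppr0 => c0.
    apply: (cvg_eq_near (cS i) c0); rewrite ni; apply: filterS (SE n (leqnn n)) => t /= ->.
    by rewrite subnn mul0n expr0 mul1r top_exponent.
  have := e_neq0 i; rewrite neq_lt => /orP[ei|ei].
    by apply: (fin jm); apply: (cvg_unique _ (cE jm) (cneg i ni ei)).
  by apply: (fin jM); apply: (cvg_unique _ (cE jM) (cpos i ni ei)).
apply: (@cvgv_bounded _ _ _ UU _ _ (\col_j ord_cons (tl * c jM) (fun j => c (Some j)) j)).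
  move=> j; rewrite mxE; have [i ->|->] := unliftP ord0 j; last by rewrite ord_cons0.
  by rewrite ord_consS.
move=> j; rewrite mxE; have [i ->|->] := unliftP ord0 j; last by rewrite ord_cons0; exact: ctau.
rewrite ord_consS; have := cY (Some i); rewrite /Y /=.
by under eq_fun do rewrite mxE.
Qed.

End Degenerate.

Lemma has_card_fiber (V W : eqType) (A : V -> Prop) (B : V -> W -> Prop) d m :
  has_card A d -> (forall v, A v -> has_card (B v) m) ->
  has_card (fun p : V * W => A p.1 /\ B p.1 p.2) (d * m).
Proof.
case=> l [ul <- Al] Bm.
have {Bm} : forall v, v \in l -> has_card (B v) m by move=> v /Al; exact: Bm.
suff : forall l, uniq l -> (forall v, v \in l -> has_card (B v) m) ->
    has_card (fun p : V * W => p.1 \in l /\ B p.1 p.2) (size l * m).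
  move=> /(_ l ul) H /H; apply: eq_has_card => p; by rewrite Al.
move=> {A l ul Al}; elim=> [|v l IH] /=.
  by move=> _ _; exists [::]; split=> // p; rewrite in_nil; split=> [[]|].
move=> /andP[vl ul] H.
have [|s [us ss sP]] := IH ul; first by move=> w wl; apply: H; rewrite inE wl orbT.
have [|t [ut st tP]] := H v; first by rewrite inE eqxx.
exists ([seq (v, w) | w <- t] ++ s); split.
- rewrite cat_uniq us map_inj_uniq ?ut; last by move=> ? ? [].
  rewrite andbT /=; apply/hasPn => -[v' w'] /sP[/= v'l _].
  by apply/mapP => -[w _ [E _]]; rewrite -E v'l in vl.
- by rewrite size_cat size_map st ss mulSn.
- case=> v' w' /=; rewrite mem_cat inE.
  split=> [[/orP[/eqP->|v'l] Bw]|/orP[/mapP[w /tP Bw [-> ->]]|/sP[/= v'l Bw]]].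
  + by rewrite map_f //; apply/tP.
  + by apply/orP; right; apply/sP.
  + by rewrite eqxx.
  + by rewrite v'l orbT.
Qed.

Definition has_all_roots (C : numFieldType) : Prop :=
  forall (m : nat) (c : C), (0 < m)%N -> c != 0 -> has_card (fun x : C => x ^+ m = c) m.

Lemma closed_field_all_roots (C : numClosedFieldType) : has_all_roots C.
Proof.
move=> m c m0 c0.
have [s sP] := closed_field_poly_normal ('X^m - 1 : {poly C}).
have m1 : 'X^m - 1 \is @monic C by rewrite monicXnsubC.
rewrite (monicP m1) scale1r in sP.
pose a := m.-root c.
have am : a ^+ m = c by rewrite rootCK.
have a0 : a != 0 by apply: contra_neq c0 => a0; rewrite -am a0 expr0n gtn_eqF.
have card1 : has_card (fun x : C => x ^+ m = 1) m.
  exists s; split.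
  - by rewrite -separable_prod_XsubC -sP separable_Xn_sub_1 // pnatr_eq0 -lt0n.
  - apply: succn_inj; rewrite -(size_prod_XsubC s id) -sP size_XnsubC //.
  - move=> x; rewrite -root_prod_XsubC -sP /root !hornerE subr_eq0.
    by split=> [->|/eqP].
apply: (has_card_bij (f := fun x => x * a)) card1.
- by move=> x x1; rewrite exprMn x1 mul1r.
- by move=> x y _ _; exact: mulIf.
- move=> z zc; exists (z / a); last by rewrite divfK.
  by rewrite expr_div_n zc am mulfV.
Qed.

(** * Solutions whose first unknown is large *)

Section Large.
Variable C : numFieldType.
Hypothesis bC : bounded_converge C.
Hypothesis rC : has_all_roots C.
Variable k : nat.
Hypothesis k_gt0 : (0 < k)%N.
Variable e : int.
Hypothesis e_neq0 : forall i, exponent k e i != 0.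
Variables (n : nat) (b : C) (r : 'I_n -> C).
Hypothesis gr : generic_weights k (weights b r).
Variable D : C -> Prop.
Hypothesis D_ge1 : forall c, D c -> 1 <= `|c|.
Hypothesis D_gt1 : forall c, 1 < `|c| -> D c.

Definition cons_col (p : 'cV[C]_n * C) : 'cV[C]_n.+1 := \col_j ord_cons p.2 (fun i => p.1 i 0) j.

Lemma tail_cons p : tail (cons_col p) = p.1.
Proof. by apply/colP => j; rewrite !mxE ord_consS. Qed.

Lemma cons_col0 p : cons_col p ord0 0 = p.2.
Proof. by rewrite mxE ord_cons0. Qed.

Lemma cons_tail y : cons_col (tail y, y ord0 0) = y.
Proof.
apply/colP => j; rewrite mxE; have [i ->|->] := unliftP ord0 j; last by rewrite ord_cons0.
by rewrite ord_consS mxE.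
Qed.

Lemma torus_cons (y : 'cV[C]_n.+1) : torus y <-> torus (tail y) /\ y ord0 0 != 0.
Proof.
split=> [ty|[ty y0] j]; first by split; [exact: tail_torus | exact: ty].
by have [i ->|->] := unliftP ord0 j; [have := ty i; rewrite mxE | exact: y0].
Qed.

Lemma residue_sol_consP s y : residue_sol k e b (ord_cons s r) y <-> torus y /\
  forall i, (i <= n)%N -> \sum_o weights b r o * coords (tail y) o ^ exponent k e i =
    - (s * y ord0 0 ^ exponent k e i).
Proof.
have E i : \sum_o weights b (ord_cons s r) o * coords y o ^ exponent k e i =
    \sum_o weights b r o * coords (tail y) o ^ exponent k e i + s * y ord0 0 ^ exponent k e i.
  rewrite !weights_coords big_ord_recl ord_cons0 addrCA addrC; congr (_ + _ + _).
  by apply: eq_bigr => j _; rewrite ord_consS mxE.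
rewrite residue_solP; split=> -[ty H]; split=> // i ni.
  by have := H i ni; rewrite E => /eqP; rewrite addr_eq0 => /eqP.
by rewrite E H ?addNr // -ltnS.
Qed.

(** Each solution for the tail extends by the m-th roots of a nonzero number. *)
Lemma blowup0_card (m d : nat) : exponent k e n = m -> has_card (residue_sol k e b r) d ->
  has_card (blowup_sol k e b r 0) (d * m).
Proof.
move=> em hd.
have m0 : (0 < m)%N by exact: (m_gt0 e_neq0 em).
have := has_card_fiber (B := fun Y x => x ^+ m = - \sum_o weights b r o * coords Y o ^ (m%:Z)) hd.
move=> /(_ m) H; apply: (has_card_bij (f := cons_col)) (H _).
- move=> [Y x] /= [h1 h2]; apply/(blowup_sol0P k_gt0 e_neq0 gr em).
  by rewrite tail_cons cons_col0.
- by move=> p q _ _ E; rewrite [p]surjective_pairing [q]surjective_pairing -!tail_cons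
    -!cons_col0 E.
- move=> y /(blowup_sol0P k_gt0 e_neq0 gr em) [h1 h2]; exists (tail y, y ord0 0) => //.
  exact: cons_tail.
- move=> Y /residue_solP[tY HY]; apply: rC => //.
  rewrite oppr_eq0; apply/eqP => Y0; apply: (coords_overdetermined (e := e) gr tY) => i.
  by rewrite ltnS leq_eqVlt => /orP[/eqP->|/HY //]; rewrite em.
Qed.

(** Along solutions tending to one at theta = 0, tau has a nonzero limit, so tau / theta becomes
    large and [D] holds automatically. The disjunct [t = 0] covers the parameter where this quotient
    has no meaning. *)
Lemma blowup_near (m d : nat) : exponent k e n = m -> has_card (residue_sol k e b r) d ->
  nbhs (0 : C) [set t | has_card (fun y => blowup_sol k e b r t y /\
     (t = 0 \/ D (y ord0 0 / t))) (d * m)].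
Proof.
move=> em hd; have hd0 := blowup0_card em hd.
apply: (@local_count _ bC n.+1 _ b C (nbhs (0 : C)) (blowup k r) (blowup k r 0)
    (fun t y => t = 0 \/ D (y ord0 0 / t)) _ (nbhs_filter (0 : C)) _ _ _ _ hd0).
- move=> i j; rewrite mxE; under eq_fun do rewrite mxE.
  by apply: cvg_ord_cons; apply: cvg_expn; exact: cvg_id.
- exact: (blowup_nondegenerate k_gt0 e_neq0 gr em).
- move=> U y UU U0 sol; apply: (blowup_bounded bC k_gt0 e_neq0 gr em UU U0).
  apply: filterS sol => t [h1 h2]; split=> //; case: h2 => [->|/D_ge1].
    by rewrite normr0.
  have [->|t0] := eqVneq t 0; first by rewrite normr0.
  by rewrite normf_div ler_pdivlMr ?normr_gt0 // mul1r.
- move=> U y z UU U0 [tz _] yz.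
  have z0 : 0 < `|z ord0 0| / 2 by rewrite divr_gt0 // normr_gt0; exact: tz.
  have cid : id @ U --> (0 : C) by move=> A /U0.
  have /cvgrPdist_lt/(_ _ z0) h1 := cid.
  have /cvgrPdist_lt/(_ _ z0) h2 := yz ord0.
  apply: filterS (filterI h1 h2) => t [/=]; rewrite sub0r normrN => lt1 lt2.
  have [->|t0] := eqVneq t 0; first by left.
  right; apply: D_gt1; rewrite normf_div ltr_pdivlMr ?normr_gt0 // mul1r.
  apply: lt_trans lt1 _; rewrite -(ltrD2r (`|z ord0 0| / 2)) -splitr.
  rewrite -[X in `|X| < _](subrK (y t ord0 0)) addrC.
  by apply: le_lt_trans (ler_normD _ _) _; rewrite ltrD2l.
Qed.

(** Any one m-th root [t] of [s] serves: for fixed [t] the substitution y_0 = tau / t is a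
    bijection, so the number of roots does not enter again. *)
Lemma large_count_pos (m d : nat) : exponent k e n = m -> has_card (residue_sol k e b r) d ->
  exists2 delta : C, 0 < delta & forall s, s != 0 -> `|s| < delta ->
    has_card (fun y => residue_sol k e b (ord_cons s r) y /\ D (y ord0 0)) (d * m).
Proof.
move=> em hd; have m0 : (0 < m)%N by exact: (m_gt0 e_neq0 em).
have /nbhs_ballP[delta /= d0 H] := blowup_near em hd.
exists (delta ^+ m); first by rewrite exprn_gt0.
move=> s s0 sd.
have [t tm] : exists t : C, t ^+ m = s.
  have [[|t l] [_ ls lP]] := rC m0 s0; first by move: m0; rewrite -ls.
  by exists t; apply/lP; rewrite inE eqxx.
have t0 : t != 0 by apply: contra_neq s0 => t0; rewrite -tm t0 expr0n gtn_eqF.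
have td : `|t| < delta.
  have : `|t| ^+ m < delta ^+ m by rewrite -normrX tm.
  by rewrite ltr_pXn2r ?nnegrE // ltW.
have {}H : has_card (fun y => blowup_sol k e b r t y /\ (t = 0 \/ D (y ord0 0 / t))) (d * m).
  by apply: H; rewrite /ball /= sub0r normrN.
have ek i : (i <= n)%N -> forall c, c != 0 -> t ^+ ((n - i) * k)%N * (t * c) ^ exponent k e i =
    s * c ^ exponent k e i.
  move=> ni c c0; rewrite expfzMl mulrA -tm; congr (_ * _).
  by rewrite [_ ^+ ((n - i) * k)]exprnP -expfzDr // (exponent_sub em ni) addrC subrK.
pose f (y : 'cV[C]_n.+1) := cons_col (tail y, y ord0 0 / t).
have fE y : blowup_sol k e b r t y <-> residue_sol k e b (ord_cons s r) (f y).
  rewrite residue_sol_consP blowup_solP !torus_cons /f tail_cons cons_col0 /=.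
  have -> : (y ord0 0 / t != 0) = (y ord0 0 != 0).
    by rewrite mulf_eq0 invr_eq0 (negbTE t0) orbF.
  split=> -[[h1 h2] h3]; split=> // i ni; rewrite h3 //; congr (- _).
    by rewrite -ek ?mulf_neq0 ?invr_neq0 // [t * _]mulrC divfK.
  by rewrite -ek ?mulf_neq0 ?invr_neq0 // [t * _]mulrC divfK.
apply: (has_card_bij (f := f)) H.
- by move=> y [/fE h1 [/eqP|h2]]; rewrite ?(negbTE t0) // /f cons_col0.
- move=> y z _ _ E; rewrite -[y]cons_tail -[z]cons_tail.
  have := congr1 (@tail C n) E; rewrite !tail_cons /= => ->.
  by have := congr1 (fun w : 'cV[C]_n.+1 => w ord0 0) E; rewrite !cons_col0 /= => /(divIf t0) ->.
- move=> z [h1 h2]; exists (cons_col (tail z, z ord0 0 * t)).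
    rewrite cons_col0 /= mulfK //; split; last by right.
    by apply/fE; rewrite /f tail_cons cons_col0 /= mulfK // cons_tail.
  by rewrite /f tail_cons cons_col0 /= mulfK // cons_tail.
Qed.

(** All exponents are negative here. Along such solutions with [s] tending to 0, normalise by the
    smallest tail coordinate: since |y_0| >= 1 the term with [s] disappears, and the limits of n + 1
    ratios satisfy n + 1 equations with positive exponents, against genericity. *)
Lemma large_count_neg : exponent k e n < 0 ->
  exists2 delta : C, 0 < delta & forall s, s != 0 -> `|s| < delta ->
    has_card (fun y => residue_sol k e b (ord_cons s r) y /\ D (y ord0 0)) 0.
Proof.
move=> en.
have neg i : (i <= n)%N -> exponent k e i < 0.
  move=> ni; apply: le_lt_trans en; rewrite lerD2l lez_nat leq_mul2r ni orbT //.
suff : nbhs (0 : C) [set s | forall y, residue_sol k e b (ord_cons s r) y -> D (y ord0 0) -> False].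
  case/nbhs_ballP => delta /= d0 H; exists delta => // s _ sd.
  exists [::]; split=> // y; rewrite in_nil; split=> // -[h1 h2].
  by exfalso; apply: (H s _ y h1 h2); rewrite /ball /= sub0r normrN.
apply: (@filter_from_ultra _ _ _ (nbhs_filter (0 : C))) => U UU U0.
apply: contrapT => /ultra_not nU.
have /choice[y yP] : forall s, exists y, ~ (forall y, residue_sol k e b (ord_cons s r) y ->
    D (y ord0 0) -> False) -> residue_sol k e b (ord_cons s r) y /\ D (y ord0 0).
  move=> s; have [H|nH] := pselect (forall y, residue_sol k e b (ord_cons s r) y ->
    D (y ord0 0) -> False); first by exists 0.
  by move/existsNP: (nH) => [y /not_implyP[y1 /not_implyP[y2 _]]]; exists y.
have sol : U [set s | residue_sol k e b (ord_cons s r) (y s) /\ D (y s ord0 0)].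
  by apply: filterS nU => s /yP.
pose Y s := coords (tail (y s)).
have ty : U [set t | torus (y t)] by apply: filterS sol => t [[]].
have Y0 : U [set t | forall o, Y t o != 0].
  by apply: filterS ty => t tt o; apply: coords_neq0; exact: tail_torus.
have [jm Hm] := ultra_min Y UU None.
have cid : id @ U --> (0 : C) by move=> A /U0.
have /choice[w wP] : forall o, exists c : C, (fun t => Y t jm / Y t o) @ U --> c.
  move=> o; apply: (bC (M := 1)).
  apply: filterS (filterI Y0 Hm) => t [/= y0 ym].
  by rewrite normf_div ler_pdivrMr ?normr_gt0 // mul1r.
have c1 : (fun=> 1 : C) @ U --> (1 : C) by exact: cvg_cst.
have wmin : w jm = 1.
  apply: (cvg_eq_near (wP jm) c1); apply: filterS Y0 => t /= y0.
  by rewrite mulfV.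
have [x xP] : exists c : C, (fun t => Y t jm / y t ord0 0) @ U --> c.
  apply: (bC (M := 1)).
  apply: filterS (filterI sol Hm) => t [/= [[ty0 _] /D_ge1 ge1] ym].
  rewrite normf_div ler_pdivrMr ?normr_gt0 ?mul1r; last exact: ty0.
  by apply: le_trans (ym None) _; rewrite /Y /= normr1.
have zero i : (i <= n)%N -> \sum_(o | w o != 0) weights b r o * w o ^ (- exponent k e i) = 0.
  move=> ni; have := neg i ni.
  have : U [set t | \sum_o weights b r o * Y t o ^ exponent k e i =
      - (t * y t ord0 0 ^ exponent k e i)].
    by apply: filterS sol => t [/residue_sol_consP[_ /(_ i ni)]].
  case: (exponent k e i) => // q Hq _; rewrite NegzE opprK in Hq *.
  have -> : \sum_(o | w o != 0) weights b r o * w o ^+ q.+1 = \sum_o weights b r o * w o ^+ q.+1.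
    rewrite [RHS](bigID (fun j => w j != 0)) /= [X in _ + X]big1 ?addr0 //.
    by move=> j /negPn/eqP ->; rewrite expr0n mulr0.
  have cl : (fun t => \sum_o weights b r o * (Y t jm / Y t o) ^+ q.+1) @ U -->
      \sum_o weights b r o * w o ^+ q.+1.
    apply: cvg_bigsum => o; apply: cvgM; first exact: cvg_cst.
    by apply: cvg_expn; exact: wP.
  have cr : (fun t => - (t * (Y t jm / y t ord0 0) ^+ q.+1)) @ U --> - (0 * x ^+ q.+1).
    by apply: cvgN; apply: cvgM => //; exact: cvg_expn.
  rewrite mul0r oppr0 in cr; apply: (cvg_eq_near cl cr).
  apply: filterS (filterI Y0 Hq) => t [/= y0 E].
  apply: (@etrans _ _ ((\sum_o weights b r o * Y t o ^ (- q.+1%:Z)) * Y t jm ^+ q.+1)).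
    rewrite mulr_suml; apply: eq_bigr => o _.
    by rewrite expr_div_n -exprnN -mulrA; congr (_ * _); rewrite mulrC.
  by rewrite E -exprnN expr_div_n mulNr -mulrA; congr (- (_ * _)); rewrite mulrC.
have := @generic_support_card _ k _ (weights b r) w (- exponent k e n) n.+1 gr.
suff H : (forall i, (i < n.+1)%N -> \sum_(o | w o != 0)
    weights b r o * w o ^ (- exponent k e n + (i * k)%N%:Z) = 0).
  move=> /(_ _ H); rewrite ltnNge => /(_ _)/negP; apply.
    by exists jm; rewrite wmin oner_neq0.
  by rewrite (leq_trans (max_card _)) // card_option card_ord.
move=> i; rewrite ltnS => ni.
have -> : - exponent k e n + (i * k)%N%:Z = - exponent k e (n - i).
  by rewrite /exponent -{1}(subnK ni) mulnDl PoszD addrA opprD subrK.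
exact: zero (leq_subr _ _).
Qed.
End Large.

Definition pos_part (a : int) : nat := if a is Posz m then m else 0%N.

(* When the weight of one unknown tends to 0, that unknown tends to infinity on the
   solutions counted by the first term, and to 0 on those counted by the second. *)
Fixpoint solution_count (k : nat) (e : int) (n : nat) : nat :=
  if n is n'.+1 then
    (solution_count k e n' * pos_part (exponent k e n') +
     solution_count k (- exponent k e n') n' * pos_part (- e))%N
  else 1%N.

(** * The recursion for small weights, and genericity in one weight *)

Section Count.
Variable C : numFieldType.
Hypothesis bC : bounded_converge C.
Hypothesis rC : has_all_roots C.
Variable k : nat.
Hypothesis k_gt0 : (0 < k)%N.

Definition inv_col n (y : 'cV[C]_n) : 'cV[C]_n := \col_j (y j 0)^-1.

Lemma inv_colK n : involutive (@inv_col n).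
Proof. by move=> y; apply/colP => j; rewrite !mxE invrK. Qed.

(** Inversion changes the sign of each exponent e + i k; in reverse order the new exponents again
    form a progression with step k, starting at -(e + n k). *)
Lemma residue_sol_inv n e b (r : 'I_n.+1 -> C) y : residue_sol k e b r y ->
  residue_sol k (- exponent k e n) b r (inv_col y).
Proof.
move=> /residue_solP[ty H]; apply/residue_solP; split=> [j|i].
  by rewrite mxE invr_eq0; exact: ty.
rewrite ltnS => ni; rewrite -[RHS](H (n - i)%N (leq_subr _ _)).
apply: eq_bigr => o _; congr (_ * _).
have -> : coords (inv_col y) o = (coords y o)^-1.
  by case: o => [j|] /=; rewrite ?mxE ?invr1.
have -> : exponent k (- exponent k e n) i = - exponent k e (n - i).
  by rewrite /exponent -{1}(subnK ni) mulnDl PoszD addrA opprD subrK.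
by rewrite -exprz_inv invrK.
Qed.

Lemma large_count n e (b : C) (r : 'I_n -> C) (D : C -> Prop) d :
  (forall i, exponent k e i != 0) -> generic_weights k (weights b r) ->
  (forall c, D c -> 1 <= `|c|) -> (forall c, 1 < `|c| -> D c) ->
  has_card (residue_sol k e b r) d ->
  exists2 delta : C, 0 < delta & forall s, s != 0 -> `|s| < delta ->
    has_card (fun y => residue_sol k e b (ord_cons s r) y /\ D (y ord0 0))
      (d * pos_part (exponent k e n)).
Proof.
move=> e0 gr D1 D2 hd; have := e0 n.
case En : (exponent k e n) => [m|m] _ /=.
  exact: (large_count_pos bC rC k_gt0 e0 gr D1 D2 En hd).
by rewrite muln0; apply: large_count_neg => //; rewrite En.
Qed.

(** Solutions with |y_0| > 1 are counted directly, those with |y_0| <= 1 after inversion. Hence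
    [large_count] admits both the strict and the weak inequality as [D]: solutions with |y_0| = 1
    are counted exactly once. *)
Lemma punctured_count n e (b : C) (r : 'I_n -> C) d1 d2 :
  (forall i, exponent k e i != 0) -> (forall i, exponent k (- exponent k e n) i != 0) ->
  generic_weights k (weights b r) ->
  has_card (residue_sol k e b r) d1 ->
  has_card (residue_sol k (- exponent k e n) b r) d2 ->
  exists2 delta : C, 0 < delta & forall s, s != 0 -> `|s| < delta ->
    has_card (residue_sol k e b (ord_cons s r))
      (d1 * pos_part (exponent k e n) + d2 * pos_part (- e)).
Proof.
move=> e0 e0' gr h1 h2.
have [||t1 t1_gt0 H1] := large_count (D := fun c : C => 1 < `|c|) e0 gr _ _ h1.
- by move=> c /ltW.
- by [].
have [||t2 t2_gt0 H2] := large_count (D := fun c : C => 1 <= `|c|) e0' gr _ _ h2.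
- by [].
- by move=> c /ltW.
have eE : exponent k (- exponent k e n) n = - e.
  by rewrite /exponent opprD subrK.
rewrite eE in H2.
have [t t_gt0 [tt1 tt2]] : exists2 t : C, 0 < t & t <= t1 /\ t <= t2.
  have /orP[le|le] := real_leVge (gtr0_real t1_gt0) (gtr0_real t2_gt0).
    by exists t1.
  by exists t2.
exists t => // s s0 st.
have {}H1 := H1 s s0 (lt_le_trans st tt1).
have {}H2 := H2 s s0 (lt_le_trans st tt2).
have H3 : has_card (fun y => residue_sol k e b (ord_cons s r) y /\ `|y ord0 0| <= 1)
    (d2 * pos_part (- e)).
  apply: (has_card_bij (f := @inv_col n.+1)) H2.
  - move=> y [h3 h4]; split.
      by have := residue_sol_inv h3; rewrite eE opprK.
    by rewrite mxE normfV invf_le1 // (lt_le_trans ltr01 h4).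
  - by move=> y z _ _; exact: (can_inj (@inv_colK n.+1)).
  - move=> z [h3 h4]; exists (inv_col z); last exact: inv_colK.
    split; first exact: residue_sol_inv.
    rewrite mxE normfV invf_ge1 // normr_gt0; have [tz _] := h3; exact: tz.
apply: eq_has_card (has_cardU _ H1 H3).
  move=> y; split=> [[[]|[]]//|h].
  have [le|lt] := real_leP (normr_real (y ord0 0)) (real1 C); first by right.
  by left.
by move=> y [_ lt] [_ le]; have := lt_le_trans lt le; rewrite ltxx.
Qed.

(** There are finitely many coefficient functions [eps], and each one that is nonzero at the new
    weight excludes a single value of [s]. *)
Lemma generic_ord_cons_finite n (b : C) (r : 'I_n -> C) :
  generic_weights k (weights b r) ->
  exists l : seq C, forall s, s \notin l -> generic_weights k (weights b (ord_cons s r)).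
Proof.
move=> gr; have [Z [_ _ ZP]] := rC k_gt0 (oner_neq0 C).
pose W := 0 :: Z.
pose ev (f : {ffun option 'I_n.+1 -> 'I_(size W)}) o := nth 0 W (f o).
pose S (eps : option 'I_n.+1 -> C) :=
  b * eps None + \sum_(j < n) r j * eps (Some (lift ord0 j)).
exists [seq - S (ev f) / ev f (Some ord0) | f : {ffun option 'I_n.+1 -> 'I_(size W)}].
move=> s sl eps Heps [o eo]; apply/eqP.
rewrite big_option big_ord_recl /= ord_cons0.
under eq_bigr => j _ do rewrite ord_consS.
rewrite addrCA -/(S eps) => /eqP; rewrite addr_eq0 => /eqP E.
have [e0|e0] := eqVneq (eps (Some ord0)) 0.
  have /negP[] : \sum_o weights b r o * oapp (fun j => eps (Some (lift ord0 j))) (eps None) o != 0.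
    apply: gr; first by case=> [j|] /=; exact: Heps.
    case: o eo => [j|] eo; last by exists None.
    have [i ji|j0] := unliftP ord0 j; last by rewrite j0 e0 eqxx in eo.
    by exists (Some i); rewrite /= -ji.
  by rewrite big_option /= -/(S eps) -oppr_eq0 -E e0 mulr0.
case/negP: sl.
have evP : forall o, exists i : 'I_(size W), nth 0 W i = eps o.
  move=> o'; have Wo : eps o' \in W.
    rewrite inE; case: (Heps o') => [->|/ZP ->]; by rewrite ?eqxx ?orbT.
  by exists (Ordinal (etrans (index_mem _ _) Wo)); rewrite /= nth_index.
have /choice[g gP] := evP.
have Ev : ev (finfun g) =1 eps by move=> o'; rewrite /ev ffunE gP.
apply/fintype.imageP; exists (finfun g) => //.
have -> : S (ev (finfun g)) = S eps.
  by rewrite /S Ev; congr (_ + _); apply: eq_bigr => j _; rewrite Ev.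
by rewrite Ev -E mulfK.
Qed.

Lemma generic_tail n (b s : C) (r : 'I_n -> C) :
  generic_weights k (weights b (ord_cons s r)) -> generic_weights k (weights b r).
Proof.
move=> gr eps Heps [o eo].
pose eps' (o : option 'I_n.+1) : C :=
  if o is Some j then oapp (fun i => eps (Some i)) 0 (unlift ord0 j) else eps None.
have := gr eps'; rewrite big_option [X in _ + X]big_ord_recl /= unlift_none /= mulr0 add0r.
rewrite big_option /=; under eq_bigr => j _ do rewrite ord_consS liftK /=.
apply.
  case=> [j|] /=; last exact: Heps.
  by case: (unlift ord0 j) => [i|] /=; [exact: Heps | left].
case: o eo => [i|] eo; last by exists None.
by exists (Some (lift ord0 i)); rewrite /= liftK.
Qed.

(* Completeness of the real line inside [C], by an ultrafilter refining the final
   segments of the set of parameters where [Q] holds. *)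
Lemma unit_segment_induction (Q : C -> Prop) :
  (forall t0, 0 < t0 <= 1 -> exists2 delta : C, 0 < delta &
     forall t, 0 < t <= 1 -> `|t - t0| < delta -> Q t -> Q t0) ->
  (forall t0, 0 < t0 <= 1 -> Q t0 -> exists2 delta : C, 0 < delta &
     forall t, 0 < t <= 1 -> `|t - t0| < delta -> Q t) ->
  (exists2 t, 0 < t <= 1 & Q t) -> Q 1.
Proof.
move=> Qclosed Qopen [a0 a01 Qa0].
pose A : set C := [set t | 0 < t <= 1 /\ Q t].
pose G := filter_from A (fun a => [set t | A t /\ a <= t]).
have Areal t : A t -> t \is Num.real by move=> [/andP[/gtr0_real]].
have FG : ProperFilter G.
  apply: filter_from_proper; first apply: filter_from_filter.
  - by exists a0.
  - move=> x y Ax Ay; have /orP[xy|yx] := real_leVge (Areal x Ax) (Areal y Ay).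
      by exists y => // t [At yt]; split; split=> //; exact: le_trans xy yt.
    by exists x => // t [At xt]; split; split=> //; exact: le_trans yx xt.
  - by move=> x Ax; exists x; split.
have [U [UU GU]] := ultraFilterLemma FG.
have UA : U A by apply: GU; exists a0 => // t [].
have [s sP] : exists s : C, id @ U --> s.
  apply: (bC (M := 1)); apply: filterS UA => t [/andP[t0 t1] _] /=.
  by rewrite ger0_norm // ltW.
have s_ge0 : 0 <= s.
  suff E : s = `|s| by rewrite E normr_ge0.
  apply: (cvg_eq_near sP (_ : (fun t => `|t|) @ U --> `|s|)); first exact: cvg_norm.
  by apply: filterS UA => t [/andP[t0 t1] _] /=; rewrite ger0_norm ?ltW.
have s_real := ger0_real s_ge0.
have as1 a : A a -> a <= s /\ s <= 1.
  move=> Aa; have ar := Areal a Aa; have [/andP[_ a1] _] := Aa.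
  have mr : (1 + a) / 2 \is Num.real by rewrite rpred_div ?rpredD ?rpred1 ?rpred_nat.
  (* The segment from [a] to 1 is written as a ball about its midpoint, because bounds on the
     modulus pass to the limit by [cvg_le_near]. *)
  have : `|s - (1 + a) / 2| <= (1 - a) / 2.
    apply: (@cvg_le_near _ _ U _ (fun t => t - (1 + a) / 2)).
      by apply: cvgB; [exact: sP | exact: cvg_cst].
    apply: GU; exists a => // t [[/andP[t0 t1] _] at_] /=.
    have tr := gtr0_real t0.
    rewrite real_ler_norml ?rpredB //; apply/andP; split.
      rewrite lerBrDr -mulNr -mulrDl opprB addrA subrK.
      by rewrite -mulr2n -[X in X / _]mulr_natr mulfK // pnatr_eq0.
    rewrite lerBlDr -mulrDl addrACA addNr addr0.
    by rewrite -mulr2n divff ?pnatr_eq0.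
  rewrite real_ler_norml ?rpredB // => /andP[].
  rewrite lerBrDr -mulNr -mulrDl opprB addrA subrK => h1.
  rewrite lerBlDr -mulrDl addrACA addNr addr0 => h2; split.
    by move: h1; rewrite -mulr2n -[X in X / _]mulr_natr mulfK // pnatr_eq0.
  by move: h2; rewrite -mulr2n divff ?pnatr_eq0.
have s01 : 0 < s <= 1.
  have [le1 le2] := as1 a0 (conj a01 Qa0); rewrite le2 andbT.
  by case/andP: a01 => lt _; exact: lt_le_trans lt le1.
have Qs : Q s.
  have [delta d0 H] := Qclosed s s01.
  have /cvgrPdist_lt/(_ _ d0) near := sP.
  have [t [/= lt [t01 Qt]]] := filter_ex (filterI near UA).
  by apply: (H t) => //; rewrite distrC.
have [s1|s1] := eqVneq s 1; first by rewrite -s1.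
have [delta d0 H] := Qopen s s01 Qs.
have w0 : 0 < 1 - s.
  by rewrite subr_gt0 lt_neqAle s1; case/andP: s01.
(* Half the harmonic mean of [delta] and [1 - s], hence positive and below both. *)
pose h := delta * (1 - s) / (delta + (1 - s)).
have dw : 0 < delta + (1 - s) by exact: addr_gt0.
have h0 : 0 < h by rewrite divr_gt0 // mulr_gt0.
have hd : h < delta by rewrite /h ltr_pdivrMr // ltr_pM2l // ltrDr.
have hw : h < 1 - s by rewrite /h ltr_pdivrMr // mulrC ltr_pM2l // ltrDl.
have t01 : 0 < s + h <= 1.
  rewrite addr_gt0 //=; last by case/andP: s01.
  by rewrite -lerBrDl ltW.
have Qt : Q (s + h) by apply: H => //; rewrite [s + h]addrC addrK gtr0_norm.
have [+ _] := as1 (s + h) (conj t01 Qt).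
by rewrite gerDl => h0'; have := lt_le_trans h0 h0'; rewrite ltxx.
Qed.

End Count.

Lemma real_imaginary_inj (C : numFieldType) (i t t' u u' : C) : i ^+ 2 = -1 ->
  t \is Num.real -> t' \is Num.real -> u \is Num.real -> u' \is Num.real ->
  t + i * u = t' + i * u' -> t = t' /\ u = u'.
Proof.
move=> i2 tr tr' ur ur' E.
have E1 : t - t' = i * (u' - u).
  by apply/eqP; rewrite subr_eq mulrBr addrAC eq_sym subr_eq eq_sym E addrC.
have /eqP : (t - t') ^+ 2 + (u' - u) ^+ 2 = 0 by rewrite E1 exprMn i2 mulN1r addNr.
rewrite paddr_eq0 ?real_exprn_even_ge0 ?rpredB // !sqrf_eq0 !subr_eq0.
by case/andP => /eqP-> /eqP->.
Qed.

(** * Independence of the count from the weights *)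

Section Main.
Variable C : numFieldType.
Hypothesis bC : bounded_converge C.
Hypothesis rC : has_all_roots C.
Variable k : nat.
Hypothesis k_gt0 : (0 < k)%N.

(** The first weight moves from near 0 to [s2] along an arc on which the weights stay generic; there
    the count is finite and locally constant, hence constant by [unit_segment_induction]. *)
Lemma count_extends n e (b s2 delta : C) (r : 'I_n -> C) (N : nat) :
  (forall i, exponent k e i != 0) ->
  generic_weights k (weights b (ord_cons s2 r)) -> 0 < delta ->
  (forall s, s != 0 -> `|s| < delta -> has_card (residue_sol k e b (ord_cons s r)) N) ->
  has_card (residue_sol k e b (ord_cons s2 r)) N.
Proof.
move=> e0 gr d0 near0.
have gr' := generic_tail gr.
have [l lP] := generic_ord_cons_finite rC k_gt0 gr'.
have s20 : s2 != 0 by have := weights_neq0 gr (Some ord0); rewrite /= ord_cons0.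
have [i i2] : exists i : C, i ^+ 2 = -1.
  have m1 : (-1 : C) != 0 by rewrite oppr_eq0 oner_eq0.
  have [[|x s] [_ ls sP]] := @rC 2 (-1) isT m1; first by [].
  by exists x; apply/sP; rewrite inE eqxx.
(* Arcs from 0 to [s2] with disjoint interiors for distinct [L], since t and L t (1 - t) are the
   real and imaginary coordinates of gam / s2. The finite list [l] therefore misses the interior of
   one of them. *)
pose gam (L : nat) (t : C) := s2 * (t + i * (L%:R * (t * (1 - t)))).
have [L LP] : exists L, forall t : C, 0 < t < 1 -> gam L t \notin l.
  apply: contrapT => nL.
  have /choice[f fP] : forall L, exists c, exists2 t, 0 < t < 1 & c = gam L t /\ c \in l.
    move=> L; apply: contrapT => nc; apply: nL; exists L => t t01; apply/negP => tl.
    by apply: nc; exists (gam L t), t.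
  have finj : injective f.
    move=> L L' E; have [t t01 [Et _]] := fP L; have [t' t01' [Et' _]] := fP L'.
    have tr : t \is Num.real by case/andP: t01 => /gtr0_real.
    have tr' : t' \is Num.real by case/andP: t01' => /gtr0_real.
    have : gam L t = gam L' t' by rewrite -Et -Et' E.
    move=> /(mulfI s20) /(real_imaginary_inj i2) [] //;
      rewrite ?rpredM ?rpred_nat ?rpredB ?rpred1 // => tt.
    rewrite -tt; have t0 : t * (1 - t) != 0.
      case/andP: t01 => tg0 tl1; rewrite mulf_neq0 ?gt_eqF // subr_gt0 //.
    by move/(mulIf t0)/eqP; rewrite eqr_nat => /eqP.
  have us : uniq [seq f x | x <- iota 0 (size l).+1] by rewrite map_inj_uniq ?iota_uniq.
  have /(uniq_leq_size us) : {subset [seq f x | x <- iota 0 (size l).+1] <= l}.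
    by move=> x /mapP[y _ ->]; have [t _ []] := fP y.
  by rewrite size_map size_iota ltnn.
have gen (t : C) : 0 < t <= 1 -> generic_weights k (weights b (ord_cons (gam L t) r)).
  have [->|t1] := eqVneq t 1.
    by rewrite /gam subrr !mulr0 addr0 mulr1.
  by move=> /andP[t0 tl]; apply: lP; apply: LP; rewrite t0 lt_neqAle t1.
(* A Lipschitz constant: the difference quotient is s2 (1 + i L (1 - t - t0)) with |1 - t - t0| <=
   3, and the last 1 makes [K] positive. *)
pose K := `|s2| * (1 + `|i| * (L%:R * 3)) + 1.
have K0 : 0 < K.
  by rewrite ltr_wpDl // mulr_ge0 // addr_ge0 // mulr_ge0 // mulr_ge0 // ler0n.
have lip (t t0 : C) : 0 <= t <= 1 -> 0 <= t0 <= 1 -> `|gam L t - gam L t0| <= K * `|t - t0|.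
  move=> /andP[tg tl] /andP[tg0 tl0].
  have -> : gam L t - gam L t0 = s2 * (1 + i * (L%:R * (1 - t - t0))) * (t - t0).
    by rewrite /gam; ring.
  rewrite normrM ler_wpM2r // normrM /K ler_wpDr // ler_wpM2l //.
  rewrite (le_trans (ler_normD _ _)) // normr1 lerD2l normrM ler_wpM2l //.
  rewrite normrM normr_nat ler_wpM2l ?ler0n //.
  rewrite (le_trans (ler_normB _ _)) // (natrD _ 2 1) lerD //; last by rewrite ger0_norm.
  rewrite (le_trans (ler_normB _ _)) // (natrD _ 1 1) lerD ?normr1 //; by rewrite ger0_norm.
have w1 (t : C) : 0 < t <= 1 -> 0 <= t <= 1 by move=> /andP[/ltW -> ->].
have nearQ (t0 : C) (P : set C) : 0 < t0 <= 1 -> nbhs (gam L t0) P -> exists2 eta : C, 0 < eta &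
    forall t : C, 0 < t <= 1 -> `|t - t0| < eta -> P (gam L t).
  move=> t01 /nbhs_ballP[eps /= eps0 H]; exists (eps / K); first exact: divr_gt0.
  move=> t t1 tt; apply: H; rewrite /ball /= distrC.
  apply: le_lt_trans (lip _ _ (w1 _ t1) (w1 _ t01)) _.
  by rewrite mulrC -ltr_pdivlMr.
suff : has_card (residue_sol k e b (ord_cons (gam L 1) r)) N.
  by rewrite /gam subrr !mulr0 addr0 mulr1.
apply: (unit_segment_induction bC
  (Q := fun t => has_card (residue_sol k e b (ord_cons (gam L t) r)) N)).
- move=> t0 t01; have [d hd] := residue_sol_finite bC e0 (gen _ t01).
  have [eta eta0 H] := nearQ _ _ t01 (residue_sol_locally_constant bC e0 (gen _ t01) hd).
  exists eta => // t t1 tt ht.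
  by rewrite (has_card_unique ht (H t t1 tt)).
- move=> t0 t01 hd.
  exact: (nearQ _ _ t01 (residue_sol_locally_constant bC e0 (gen _ t01) hd)).
(* Chosen so that K t < delta, which puts this point of the arc in the range of [near0]. *)
- pose t := delta / (K + delta); have Kd : 0 < K + delta by exact: addr_gt0.
  have t01 : 0 < t <= 1 by rewrite divr_gt0 //= ler_pdivrMr // mul1r lerDr ltW.
  exists t => //; apply: near0.
    by have := weights_neq0 (gen _ t01) (Some ord0); rewrite /= ord_cons0.
  have g0 : gam L 0 = 0 by rewrite /gam mul0r !mulr0 addr0 mulr0.
  rewrite -[gam L t]subr0 -g0.
  apply: le_lt_trans (lip _ _ (w1 _ t01) _) _; first by rewrite lexx ler01.
  case/andP: t01 => t0 _; rewrite subr0 gtr0_norm // mulrA ltr_pdivrMr // mulrC.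
  by rewrite ltr_pM2l // ltrDl.
Qed.

Lemma exponent_not_dvd e i : ~~ (k%:Z %| e)%Z -> ~~ (k%:Z %| exponent k e i)%Z.
Proof. by rewrite /exponent PoszM rpredDr // dvdz_mull // dvdzz. Qed.

(** The induction is for all [e] at once, because the recursion also uses -(e + n k).
    Non-divisibility by [k] passes to that value and keeps all exponents nonzero. *)
Theorem residue_sol_card n e (b : C) (r : 'I_n -> C) : ~~ (k%:Z %| e)%Z ->
  generic_weights k (weights b r) ->
  has_card (residue_sol k e b r) (solution_count k e n).
Proof.
elim: n e r => [|n IH] e r ke gr.
  exists [:: 0]; split=> // y; rewrite inE; split=> [_|_].
    by apply/eqP/colP => -[].
  by split=> [[]//|]; apply/colP => -[].
have nz e' : ~~ (k%:Z %| e')%Z -> forall i, exponent k e' i != 0.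
  by move=> ke' i; apply: contraNneq (exponent_not_dvd i ke') => ->; exact: dvdz0.
have rE : ord_cons (r ord0) (fun j => r (lift ord0 j)) = r.
  by apply/funext => j; have [i ->|->] := unliftP ord0 j; rewrite ?ord_consS ?ord_cons0.
have ke' : ~~ (k%:Z %| - exponent k e n)%Z by rewrite rpredN exponent_not_dvd.
rewrite -rE in gr *; have gr' := generic_tail gr.
have [delta d0 H] := punctured_count bC rC k_gt0 (nz _ ke) (nz _ ke') gr' (IH _ _ ke gr')
  (IH _ _ ke' gr').
exact: count_extends (nz _ ke) gr d0 H.
Qed.
End Main.

(** A compact segment gives the ultrafilter a cluster point, and an ultrafilter converges to its
    cluster points. *)
Lemma real_bounded_converge (R : realType) (T : Type) (U : set_system T) (f : T -> R) (M : R) :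
  UltraFilter U -> U [set t | `|f t| <= M] -> exists c : R, f @ U --> c.
Proof.
move=> UU fM; pose A : set R := `[- M, M].
have fA : (f @ U) A.
  by apply: (@filterS _ U _ _ _ _ fM) => t; rewrite /A /= in_itv /= ler_norml.
have [p [_ pc]] := @segment_compact R (- M) M (f @ U) _ fA.
exists p => B Bp; apply: contrapT => nB.
have nB' : (f @ U) (~` B) by have [] := in_ultra_setVsetC (f @^-1` B) UU.
by have [x [nBx Bx]] := pc _ _ nB' Bp.
Qed.

Lemma complex_bounded_converge (R : realType) :
  bounded_converge (R[i] : numClosedFieldType).
Proof.
move=> T U f M UU fM.
have [t0 ft0] := filter_ex fM.
have M0 : 0 <= M by exact: le_trans ft0.
have ME : M = (complex.Re M)%:C%C by rewrite RRe_real // ger0_real.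
have Rb : U [set t | `|complex.Re (f t)| <= complex.Re M].
  apply: filterS fM => t ftM; have := le_trans (normc_ge_Re (f t)) ftM.
  by rewrite ME lecR.
have Ib : U [set t | `|complex.Im (f t)| <= complex.Re M].
  apply: filterS fM => t ftM; have := normc_ge_Re (f t * 'i%C).
  rewrite ReiNIm normrN normrM complexiE normCi mulr1 => le1.
  by have := le_trans le1 ftM; rewrite ME lecR.
have [a aP] := real_bounded_converge UU Rb; have [c cP] := real_bounded_converge UU Ib.
exists (a%:C%C + 'i%C * c%:C%C); apply/cvgrPdist_lt => eps eps0.
have epsE : eps = (complex.Re eps)%:C%C by rewrite RRe_real // gtr0_real.
have e2 : 0 < complex.Re eps / 2 by rewrite divr_gt0 // -ltcR -epsE.
move/cvgrPdist_lt/(_ _ e2): aP => h1; move/cvgrPdist_lt/(_ _ e2): cP => h2.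
apply: filterS (filterI h1 h2) => t [/= l1 l2].
rewrite [f t]complexE opprD addrACA -mulrBr.
apply: le_lt_trans (ler_normD _ _) _.
rewrite normrM complexiE normCi mul1r -!rmorphB /= !normc_def /= expr0n /= !addr0 !sqrtr_sqr.
by rewrite epsE -rmorphD ltcR (splitr (complex.Re eps)) ltrD.
Qed.

Local Close Scope classical_set_scope.

(** * The closed formula *)

(** The Pochhammer k-symbol; for 0 < u < k it is the k-factorial of u + (m - 1) k with the factors
    in reverse order. *)
Definition rising (k u m : nat) : nat := (\prod_(i < m) (u + i * k))%N.

(** Writing e = v - m1 k with u + v = k makes the recursion symmetric: inversion exchanges (u, m1)
    with (v, m2). The factors u + (m1 - 1) k and v + (m2 - 1) k complete the products, and the
    binomials add up by Pascal's rule; [pos_part] removes a term when [m1] or [m2] is 0. *)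
Lemma solution_count_closed (k u v m1 m2 : nat) :
  (0 < u)%N -> (0 < v)%N -> (u + v = k)%N ->
  solution_count k (v%:Z - (m1 * k)%N%:Z) (m1 + m2) =
    ('C(m1 + m2, m1) * rising k u m1 * rising k v m2)%N.
Proof.
have [n En] : exists n, (m1 + m2 = n)%N by exists (m1 + m2)%N.
elim: n m1 m2 u v En => [|n IH] m1 m2 u v En u0 v0 uv.
  have -> : m1 = 0%N by lia.
  have -> : m2 = 0%N by lia.
  by rewrite /= bin0 /rising !big_ord0.
rewrite En /=.
have risingS w m : rising k w m.+1 = (rising k w m * (w + m * k))%N.
  by rewrite /rising big_ord_recr.
have E2 : - exponent k (v%:Z - (m1 * k)%N%:Z) n = u%:Z - (m2 * k)%N%:Z.
  by rewrite /exponent; nia.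
rewrite E2.
have T1 : (solution_count k (v%:Z - (m1 * k)%N%:Z) n *
    pos_part (exponent k (v%:Z - (m1 * k)%N%:Z) n) =
   (if m2 is 0 then 0 else 'C(n, m1)) * rising k u m1 * rising k v m2)%N.
  case: m2 En E2 => [|m2] En E2.
    have : exponent k (v%:Z - (m1 * k)%N%:Z) n < 0 by nia.
    by case: exponent => // m _ /=; rewrite muln0 !mul0n.
  have -> : exponent k (v%:Z - (m1 * k)%N%:Z) n = (v + m2 * k)%N by nia.
  have En' : (m1 + m2 = n)%N by lia.
  by rewrite -En' (IH m1 m2 u v) // risingS /= !mulnA.
have T2 : (solution_count k (u%:Z - (m2 * k)%N%:Z) n * pos_part (- (v%:Z - (m1 * k)%N%:Z)) =
   (if m1 is m.+1 then 'C(n, m) else 0) * rising k u m1 * rising k v m2)%N.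
  case: m1 En E2 T1 => [|m1] En E2 T1.
    have : - (v%:Z - (0 * k)%N%:Z) < 0 by lia.
    by case: (- _) => // m _ /=; rewrite muln0 !mul0n.
  have -> : - (v%:Z - (m1.+1 * k)%N%:Z) = (u + m1 * k)%N by nia.
  have En' : (m2 + m1 = n)%N by lia.
  rewrite -En' (IH m2 m1 v u) //; last by rewrite addnC.
  rewrite risingS /= -['C(m2 + m1, m1)]bin_sub ?leq_addl // addnK.
  by ring.
rewrite T1 T2 -!mulnDl; congr (_ * _ * _)%N.
case: m1 m2 En {E2 T1 T2} => [|m1] [|m2] En.
- lia.
- by rewrite !bin0.
- have -> : n = m1 by lia.
  by rewrite !binn.
- by rewrite binS.
Qed.

(** For m = 0 the argument lies strictly between -k and 0, the floor is -1, and both sides are empty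
    products. *)
Lemma kfactorial_rising (k u m : nat) : (0 < u < k)%N ->
  kfactorial k (u%:Z + (m%:Z - 1) * k%:Z) = (rising k u m)%:Z.
Proof.
move=> /andP[u0 uk]; rewrite /kfactorial.
have k0 : 0 < k%:R :> rat by rewrite ltr0n; lia.
have -> : Num.floor ((u%:Z + (m%:Z - 1) * k%:Z)%:~R / k%:R : rat) = m%:Z - 1.
  apply: floor_def; rewrite ler_pdivlMr // ltr_pdivrMr // !pmulrn -!intrM ler_int ltr_int.
  by rewrite subrK; nia.
case: m => [|m]; first by rewrite /rising big_ord0.
have -> : m.+1%:Z - 1 = m%:Z by lia.
rewrite /rising (big_morph Posz PoszM (erefl _)) (reindex_inj rev_ord_inj) /=.
apply: eq_bigr => i _; have := ltn_ord i; nia.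
Qed.

Lemma ceil_decomposition (k u m : nat) : (0 < u < k)%N ->
  Num.ceil ((u%:Z + (m%:Z - 1) * k%:Z)%:~R / k%:R : rat) = m.
Proof.
move=> /andP[u0 uk].
have k0 : 0 < k%:R :> rat by rewrite ltr0n; lia.
apply: ceil_def; rewrite ler_pdivrMr // ltr_pdivlMr // !pmulrn -!intrM ler_int ltr_int.
nia.
Qed.

(** The bound a > -k makes [m] a natural number; coprimality with k >= 2 makes the remainder [u]
    nonzero. *)
Lemma residue_decomposition (k : nat) (a : int) : (2 <= k)%N -> coprimez a k -> - k%:Z < a ->
  exists u m : nat, (0 < u < k)%N /\ a = u%:Z + (m%:Z - 1) * k%:Z.
Proof.
move=> k2 cop ak.
have k0 : k%:Z != 0 by lia.
have E := divz_eq a k; have r0 := modz_ge0 a k0; have rk := ltz_mod a k0.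
set q := (a %/ k)%Z in E; set r := (a %% k)%Z in E r0 rk.
have rn0 : r != 0.
  apply/eqP => r00; rewrite r00 addr0 in E; move: cop; rewrite E /coprimez gcdzC gcdzMl.
  lia.
have q1 : 0 <= q + 1 by nia.
exists (absz r), (absz (q + 1)); split; first lia.
rewrite E; nia.
Qed.

Lemma solution_count_kfactorial (k p : nat) (a1 a2 : int) :
  (2 <= k)%N -> (1 <= p)%N -> coprimez a1 k -> - k%:Z < a1 -> - k%:Z < a2 ->
  coprimez a2 k -> a1 + a2 - k%:Z * p%:Z = - (2 * k%:Z) ->
  (solution_count k (- a1) (p - 1))%:Z =
    'C(p - 1, `|Num.ceil (a1%:~R / k%:R : rat)|)%:Z * kfactorial k a1 * kfactorial k a2.
Proof.
move=> k2 p1 c1 l1 l2 c2 sum.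
have [u [m1 [uk E1]]] := residue_decomposition k2 c1 l1.
have [v [m2 [vk E2]]] := residue_decomposition k2 c2 l2.
(* As a1 + a2 = (p - 2) k, the sum u + v is a multiple of k, and 0 < u + v < 2 k leaves only k. *)
have [uv mp] : (u + v = k)%N /\ (m1 + m2 = p - 1)%N.
  have H : (u + v)%:Z = (p%:Z - m1%:Z - m2%:Z) * k%:Z by rewrite PoszD; lia.
  have : p%:Z - m1%:Z - m2%:Z = 1 by nia.
  move=> H1; rewrite H1 in H; split; lia.
rewrite E1 E2 ceil_decomposition // !kfactorial_rising // absz_nat -mp.
have -> : - (u%:Z + (m1%:Z - 1) * k%:Z) = v%:Z - (m1 * k)%N%:Z by nia.
rewrite (@solution_count_closed k u v m1 m2) ?PoszM //; lia.
Qed.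

(** * Genericity is a polynomial condition *)

Section LinearForm.
Variables (C : fieldType) (k p : nat).
Hypothesis k_gt0 : (0 < k)%N.
Notation mp := (mpoly.mpoly p C).
Notation mX j := (mpoly.mpolyX C (mpoly.mnm1 j) : mp).
Notation mC c := (mpoly.mpolyC p c : mp).

(** Genericity concerns the r_j, but the polynomial sought is in the k-residues r_j^k; this
    substitution relates the two. *)
Definition power_subst : mp -> mp := mpoly.comp_mpoly [tuple mX i ^+ k | i < p].
HB.instance Definition _ := GRing.RMorphism.on power_subst.

Lemma power_substX j : power_subst (mX j) = mX j ^+ k.
Proof. by rewrite /power_subst mpoly.comp_mpolyXU -tnth_nth tnth_mktuple. Qed.

Lemma meval_power_subst (r : 'I_p -> C) (P : mp) :
  mpoly.meval r (power_subst P) = mpoly.meval (fun j => r j ^+ k) P.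
Proof.
rewrite mpoly.comp_mpoly_meval; apply: mpoly.meval_eq => i.
by rewrite tnth_mktuple rmorphXn /= mpoly.mevalXU.
Qed.

(* The linear form is integral over the subring of polynomials in the [k]-th powers of
   the variables; the constant coefficient of an integral equation vanishes with it. *)
Lemma linear_form_vanishing (eps : 'I_p -> C) : (exists j, eps j != 0) ->
  exists2 Q : mp, Q != 0 &
    forall r : 'I_p -> C, \sum_j r j * eps j = 0 -> mpoly.meval (fun j => r j ^+ k) Q = 0.
Proof.
move=> [j0 e0].
pose l : mp := \sum_j mX j * mC (eps j).
have lE r : mpoly.meval r l = \sum_j r j * eps j.
  by rewrite rmorph_sum; apply: eq_bigr => j _; rewrite rmorphM /= mpoly.mevalXU mpoly.mevalC.
have l0 : l != 0.
  apply: contra_neq e0 => l0; have := lE (fun j => (j == j0)%:R).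
  rewrite l0 rmorph0 (bigD1 j0) //= eqxx mul1r big1 ?addr0 // => i /negbTE ->.
  by rewrite mul0r.
have intl : integralOver power_subst l.
  rewrite /l; elim/big_rec: _ => [|j x _ IH]; first exact: integral0.
  apply: integral_add => //; apply: integral_mul.
    exists ('X^k - (mX j)%:P); first by rewrite monicXnsubC.
    rewrite rmorphB /= map_polyXn map_polyC /= power_substX /root !hornerE.
    by rewrite subrr.
  exists ('X - (mC (eps j))%:P); first by rewrite monicXsubC.
  rewrite rmorphB /= map_polyX map_polyC /= /root !hornerE.
  by rewrite /power_subst mpoly.comp_mpolyC subrr.
have [P Pmon Proot] := intl; have P0 := monic_neq0 Pmon.
(* As the linear form is nonzero, factors ['X] can be removed from the integral equation until its
   constant coefficient is nonzero. *)
have [q q0 qroot] : exists2 q : {poly mp}, q`_0 != 0 & root (map_poly power_subst q) l.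
  move: {Pmon} (size P) {-2}P (leqnn (size P)) P0 Proot => n; elim: n => [|n IH] f.
    by rewrite leqn0 size_poly_eq0 => /eqP->; rewrite eqxx.
  move=> sf f0 froot; have [f00|] := eqVneq f`_0 0; last by exists f.
  have [g gE] : exists g, f = g * ('X - 0%:P).
    by apply/factor_theorem; rewrite /root horner_coef0 f00.
  have g0 : g != 0 by apply: contra_neq f0 => g0; rewrite gE g0 mul0r.
  have sg : (size g <= n)%N by move: sf; rewrite gE size_Mmonic ?monicXsubC // size_XsubC addn2.
  apply: (IH g sg g0); move: froot; rewrite gE rmorphM rootM => /orP[|].
    by apply.
  by rewrite /= subr0 map_polyX rootX (negbTE l0).
exists q`_0 => // r lr.
have /(congr1 (mpoly.meval r)) := eqP qroot.
rewrite -horner_map /= rmorph0 lE lr horner_coef0 !coef_map /=.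
by rewrite meval_power_subst.
Qed.
End LinearForm.

(** The functions [eps] are finite in number, so the product of the polynomials given by
    [linear_form_vanishing] works; for [eps = 0] any nonzero factor will do. *)
Lemma generic_polynomial (C : numClosedFieldType) (k p : nat) : (0 < k)%N ->
  exists2 P : mpoly.mpoly p C, P != 0 &
    forall r : 'I_p -> C, mpoly.meval (fun j => r j ^+ k) P != 0 -> generic_weights k r.
Proof.
move=> k0.
have [Z [_ _ ZP]] := closed_field_all_roots k0 (oner_neq0 C).
pose W := 0 :: Z.
pose ev (f : {ffun 'I_p -> 'I_(size W)}) o := nth 0 W (f o).
have /choice[Q QP] : forall eps : 'I_p -> C, exists Q : mpoly.mpoly p C, Q != 0 /\
    ((exists j, eps j != 0) -> forall r : 'I_p -> C, \sum_j r j * eps j = 0 ->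
      mpoly.meval (fun j => r j ^+ k) Q = 0).
  move=> eps; have [H|nH] := pselect (exists j, eps j != 0).
    by have [Q Q0 QP] := linear_form_vanishing k0 H; exists Q.
  by exists 1; split; first exact: oner_neq0.
exists (\prod_(f : {ffun 'I_p -> 'I_(size W)}) Q (ev f)).
  by apply/prodf_neq0 => f _; have [] := QP (ev f).
move=> r; rewrite rmorph_prod /= => /prodf_neq0 H eps Heps epsn.
have /choice[g gP] : forall o, exists i : 'I_(size W), nth 0 W i = eps o.
  move=> o'; have Wo : eps o' \in W.
    rewrite inE; case: (Heps o') => [->|/ZP ->]; by rewrite ?eqxx ?orbT.
  by exists (Ordinal (etrans (index_mem _ _) Wo)); rewrite /= nth_index.
have Ev : ev (finfun g) = eps by apply/funext => o'; rewrite /ev ffunE gP.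
have := H (finfun g) isT; apply: contra_neq => S0; rewrite Ev.
by have [_] := QP eps; apply.
Qed.

(** * Rational functions and their leading terms *)

Section Fraction.
Variable C : fieldType.
Implicit Types (P : {poly C}).

HB.instance Definition _ := GRing.isZmodMorphism.Build {poly C} {fraction {poly C}}
  (@ratfun_of_poly C) (@tofrac_is_zmod_morphism {poly C}).
HB.instance Definition _ := GRing.isMonoidMorphism.Build {poly C} {fraction {poly C}}
  (@ratfun_of_poly C) (@tofrac_is_monoid_morphism {poly C}).

Lemma ratfun_of_poly_inj : injective (@ratfun_of_poly C).
Proof. by move=> P Q /eqP; rewrite tofrac_eq => /eqP. Qed.

Lemma ratfun_repr (f : {fraction {poly C}}) :
  f = ratfun_of_poly \n_(repr f) / ratfun_of_poly \d_(repr f).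
Proof.
have d0 : \d_(repr f) != 0 by exact: denom_ratioP.
have D0 : ratfun_of_poly \d_(repr f) != 0 by rewrite tofrac_eq0.
apply: (mulIf D0); rewrite divfK // /ratfun_of_poly -{1}[f]reprK; unlock FracField.tofrac.
rewrite -[LHS]FracField.pi_mul; apply/eqmodP; rewrite /= FracField.equivfE /FracField.mulf.
rewrite !numden_Ratio ?mulr1 ?oner_eq0 //.
by apply/eqP; exact: mulrC.
Qed.
End Fraction.

Section Lead.
Variables (C K : fieldType) (iota : {rmorphism {poly C} -> K}).
Hypothesis iota_inj : injective iota.
Notation "P %:K" := (iota P) (at level 2, format "P %:K").
Implicit Types (f g : K) (P Q u v : {poly C}).

Lemma iota_eq0 P : (P%:K == 0) = (P == 0).
Proof. by rewrite -(inj_eq iota_inj) rmorph0. Qed.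

(** [e] is the order of [f] at 0 and [c] its leading Laurent coefficient. An arbitrary injective
    [iota] into a field keeps the construction of fractions out of these computations. *)
Definition has_lead f (e : int) (c : C) : Prop :=
  exists u v, [/\ u.[0] != 0, v.[0] != 0, f = ('X%:K) ^ e * (u%:K / v%:K) & c = u.[0] / v.[0]].

Lemma ratX_neq0 : ('X : {poly C})%:K != 0.
Proof. by rewrite iota_eq0 polyX_eq0. Qed.

Lemma horner0_neq0 u : u.[0] != 0 -> u%:K != 0.
Proof. by rewrite iota_eq0; apply: contra_neq => ->; rewrite horner0. Qed.

Lemma has_lead_neq0 f e c : has_lead f e c -> f != 0 /\ c != 0.
Proof.
case=> u [v [u0 v0 -> ->]]; split; last by rewrite mulf_neq0 ?invr_eq0.
by rewrite !mulf_neq0 ?invr_eq0 ?expfz_neq0 ?ratX_neq0 ?horner0_neq0.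
Qed.

Lemma has_leadM f g e e' c c' : has_lead f e c -> has_lead g e' c' ->
  has_lead (f * g) (e + e') (c * c').
Proof.
move=> [u [v [u0 v0 -> ->]]] [u' [v' [u0' v0' -> ->]]].
exists (u * u'), (v * v'); rewrite !hornerM; split; rewrite ?mulf_neq0 //.
  by rewrite expfzDr ?ratX_neq0 // !rmorphM /= mulrACA -mulf_div.
by rewrite mulf_div.
Qed.

Lemma has_leadV f e c : has_lead f e c -> has_lead f^-1 (- e) c^-1.
Proof.
move=> [u [v [u0 v0 -> ->]]]; exists v, u; split=> //.
  by rewrite invfM invf_div invr_expz.
by rewrite invf_div.
Qed.

Lemma has_lead1 : has_lead 1 0 1.
Proof. by exists 1, 1; rewrite !hornerC oner_eq0 expr0z !rmorph1 divr1 mulr1 invr1 mulr1. Qed.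

Lemma has_leadXn f e c n : has_lead f e c -> has_lead (f ^+ n) (e * n%:Z) (c ^+ n).
Proof.
move=> fe; elim: n => [|n IH]; first by rewrite mulr0 !expr0; exact: has_lead1.
rewrite !exprS -[n.+1]add1n PoszD mulrDr mulr1; exact: has_leadM.
Qed.

Lemma has_leadXz f e c (n : int) : has_lead f e c -> has_lead (f ^ n) (e * n) (c ^ n).
Proof.
move=> fe; case: n => n; first exact: has_leadXn.
by rewrite NegzE mulrN -!exprnN; apply: has_leadV; exact: has_leadXn.
Qed.

Lemma has_lead_prod (I : Type) (s : seq I) (F : I -> K) (e : I -> int) (c : I -> C) :
  (forall i, has_lead (F i) (e i) (c i)) ->
  has_lead (\prod_(i <- s) F i) (\sum_(i <- s) e i) (\prod_(i <- s) c i).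
Proof.
move=> H; elim: s => [|i s IH]; first by rewrite !big_nil; exact: has_lead1.
by rewrite !big_cons; exact: has_leadM.
Qed.

Lemma has_leadX : has_lead ('X%:K) 1 1.
Proof. by exists 1, 1; rewrite !hornerC oner_eq0 expr1z !rmorph1 divr1 mulr1 invr1 mulr1. Qed.

Lemma has_lead_poly u : u.[0] != 0 -> has_lead u%:K 0 u.[0].
Proof.
by move=> u0; exists u, 1; rewrite !hornerC oner_eq0 expr0z rmorph1 mul1r !divr1.
Qed.

Lemma has_lead_unique f e e' c c' : has_lead f e c -> has_lead f e' c' -> e = e' /\ c = c'.
Proof.
suff H : forall (m : nat) u v u' v', u.[0] != 0 -> v.[0] != 0 -> u'.[0] != 0 -> v'.[0] != 0 ->
    'X%:K ^+ m * (u%:K / v%:K) = u'%:K / v'%:K ->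
    m = 0%N /\ u.[0] / v.[0] = u'.[0] / v'.[0].
  have W e1 e2 u v u' v' : u.[0] != 0 -> v.[0] != 0 -> u'.[0] != 0 -> v'.[0] != 0 ->
      e2 <= e1 -> 'X%:K ^ e1 * (u%:K / v%:K) = 'X%:K ^ e2 * (u'%:K / v'%:K) ->
      e1 = e2 /\ u.[0] / v.[0] = u'.[0] / v'.[0].
    move=> u0 v0 u0' v0' le E.
    have [m Em] : exists m : nat, e1 = e2 + m%:Z.
      by exists (absz (e1 - e2)); rewrite gez0_abs ?subr_ge0 // subrKC.
    have [] := H m u v u' v' u0 v0 u0' v0'.
      apply: (mulfI (_ : 'X%:K ^ e2 != 0)); first by rewrite expfz_neq0 ?ratX_neq0.
      rewrite -E Em expfzDr ?ratX_neq0 //. by rewrite -exprnP -mulrA.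
    by move=> m0 ->; rewrite Em m0 addr0.
  move=> [u [v [u0 v0 -> ->]]] [u' [v' [u0' v0' E ->]]].
  have /orP[le|le] := le_total e e'; last exact: W.
  by have [-> ->] := W _ _ _ _ _ _ u0' v0' u0 v0 le (esym E).
move=> m u v u' v' u0 v0 u0' v0' E.
have /eqP E1 : 'X^m * u * v' == u' * v.
  rewrite -(inj_eq iota_inj) !rmorphM rmorphXn /=.
  by rewrite -eqr_div ?horner0_neq0 // -mulrA E.
have := congr1 (fun P => P.[0]) E1; rewrite !hornerM hornerXn.
case: m E E1 => [|m] E E1; last first.
  rewrite expr0n !mul0r => /esym/eqP; rewrite mulf_eq0.
  by rewrite (negbTE u0') (negbTE v0).
rewrite expr0 mul1r => E2; split=> //; apply/eqP.
by rewrite eqr_div // E2.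
Qed.
End Lead.

Lemma mup_factor (C : fieldType) (x : C) (P : {poly C}) : P != 0 ->
  exists2 q : {poly C}, q.[x] != 0 & P = ('X - x%:P) ^+ (mup x P) * q.
Proof.
move=> P0; have : ('X - x%:P) ^+ (mup x P) %| P by rewrite -mup_geq.
have : ~~ (('X - x%:P) ^+ (mup x P).+1 %| P) by rewrite -mup_leq.
move: (mup x P) => m nd /dvdpP[q qE]; exists q; last by rewrite mulrC.
apply/negP => q0; have : root q x by [].
move=> /factor_theorem[q' q'E]; case/negP: nd.
by rewrite qE q'E exprS -mulrA dvdp_mull.
Qed.

Section Comp.
Variables (C K : fieldType) (iota : {rmorphism {poly C} -> K}).
Hypothesis iota_inj : injective iota.
Hypothesis iota_ratio : forall f : K, exists P Q, Q != 0 /\ f = iota P / iota Q.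
Notation "P %:K" := (iota P) (at level 2, format "P %:K").
Notation has_lead := (has_lead iota).
Implicit Types (f g phi psi : K) (P Q u v : {poly C}).

Lemma has_lead_mup P : P != 0 -> exists c, has_lead P%:K (mup 0 P)%:Z c.
Proof.
move=> /(mup_factor 0)[q q0 qE]; exists q.[0].
have := has_leadM iota_inj (has_leadXn iota_inj (mup 0 P) (has_leadX iota)) (has_lead_poly iota q0).
by rewrite expr1n !mul1r addr0 -rmorphXn -rmorphM /= -['X]subr0 -qE.
Qed.

Lemma has_lead_exists f : f != 0 -> exists e c, has_lead f e c.
Proof.
move=> f0; have [P [Q [Q0 fE]]] := iota_ratio f.
have P0 : P != 0 by apply: contra_neq f0 => P0; rewrite fE P0 rmorph0 mul0r.
have [c cP] := has_lead_mup P0; have [c' cP'] := has_lead_mup Q0.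
exists ((mup 0 P)%:Z - (mup 0 Q)%:Z), (c * c'^-1); rewrite fE.
by exact: (has_leadM iota_inj cP (has_leadV cP')).

Qed.

(** Unlike [has_lead], this allows the value 0 and is stable under sums, so polynomials can be
    evaluated. *)
Definition has_value f (c : C) : Prop :=
  exists u v, [/\ v.[0] != 0, f = u%:K / v%:K & c = u.[0] / v.[0]].

Lemma has_value_lead f c : has_value f c -> c != 0 -> has_lead f 0 c.
Proof.
move=> [u [v [v0 -> ->]]] c0; exists u, v; split=> //; last by rewrite expr0z mul1r.
by apply: contra_neq c0 => ->; rewrite mul0r.
Qed.

Lemma has_valueC c : has_value (c%:P)%:K c.
Proof. by exists c%:P, 1; rewrite !hornerC oner_eq0 rmorph1 !divr1. Qed.

Lemma has_valueM f g c c' : has_value f c -> has_value g c' -> has_value (f * g) (c * c').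
Proof.
move=> [u [v [v0 -> ->]]] [u' [v' [v0' -> ->]]]; exists (u * u'), (v * v').
by rewrite !hornerM mulf_neq0 // !rmorphM !mulf_div.
Qed.

Lemma has_valueD f g c c' : has_value f c -> has_value g c' -> has_value (f + g) (c + c').
Proof.
move=> [u [v [v0 -> ->]]] [u' [v' [v0' -> ->]]]; exists (u * v' + u' * v), (v * v').
split; first by rewrite hornerM mulf_neq0.
  by rewrite rmorphD !rmorphM /= addf_div // (horner0_neq0 iota_inj).
by rewrite hornerD !hornerM addf_div.
Qed.

Definition poly_at phi P : K := (map_poly (fun c => (c%:P)%:K) P).[phi].

Lemma poly_atE phi P : poly_at phi P = (map_poly (iota \o polyC) P).[phi].
Proof. by []. Qed.

Lemma poly_at_is_zmod_morphism phi : zmod_morphism (poly_at phi).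
Proof. by move=> P Q; rewrite !poly_atE rmorphB hornerD hornerN. Qed.
Lemma poly_at_is_monoid_morphism phi : monoid_morphism (poly_at phi).
Proof. by split=> [|P Q]; rewrite !poly_atE ?rmorph1 ?hornerC // rmorphM hornerM. Qed.
HB.instance Definition _ phi :=
  GRing.isZmodMorphism.Build {poly C} K (poly_at phi) (poly_at_is_zmod_morphism phi).
HB.instance Definition _ phi :=
  GRing.isMonoidMorphism.Build {poly C} K (poly_at phi) (poly_at_is_monoid_morphism phi).

Lemma poly_atX phi : poly_at phi 'X = phi.
Proof. by rewrite poly_atE map_polyX hornerX. Qed.

Lemma poly_atC phi c : poly_at phi c%:P = (c%:P)%:K.
Proof. by rewrite poly_atE map_polyC hornerC. Qed.

Lemma has_value_poly_at phi a P : has_value phi a -> has_value (poly_at phi P) P.[a].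
Proof.
move=> pa; elim/poly_ind: P => [|P c IH].
  by rewrite rmorph0 horner0 -(rmorph0 iota); exact: has_valueC.
rewrite rmorphD rmorphM /= poly_atX poly_atC hornerMXaddC.
by apply: has_valueD (has_valueC _); exact: has_valueM.
Qed.

(** This keeps denominators nonzero after composition with [phi]. *)
Definition transcendental phi : Prop := forall P, P != 0 -> poly_at phi P != 0.

(* [ratfun_comp] depends on the arbitrary fraction chosen by [repr]; this is all that is
   used of it. *)
Variable comp_with : K -> K -> K.
Hypothesis comp_withE : forall phi P Q, transcendental phi -> Q != 0 ->
  comp_with (P%:K / Q%:K) phi = poly_at phi P / poly_at phi Q.

Section CompBy.
Variable phi : K.
Hypothesis tphi : transcendental phi.
Notation comp f := (comp_with f phi).

Lemma ratfun_compE P Q : Q != 0 -> comp (P%:K / Q%:K) = poly_at phi P / poly_at phi Q.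
Proof. exact: comp_withE. Qed.

Lemma ratfun_comp_poly P : comp P%:K = poly_at phi P.
Proof.
have := ratfun_compE P (oner_neq0 _).
by rewrite !rmorph1 !divr1.
Qed.

Lemma ratfun_compM f g : comp (f * g) = comp f * comp g.
Proof.
have [P [Q [Q0 ->]]] := iota_ratio f; have [P' [Q' [Q0' ->]]] := iota_ratio g.
rewrite mulf_div -!rmorphM !ratfun_compE ?mulf_neq0 //.
by rewrite !rmorphM /= -mulf_div.
Qed.

Lemma ratfun_compD f g : comp (f + g) = comp f + comp g.
Proof.
have [P [Q [Q0 ->]]] := iota_ratio f; have [P' [Q' [Q0' ->]]] := iota_ratio g.
rewrite addf_div ?iota_eq0 // -!rmorphM -rmorphD !ratfun_compE ?mulf_neq0 //.
by rewrite rmorphD !rmorphM /= -addf_div //; exact: tphi.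
Qed.

Lemma ratfun_comp1 : comp 1 = 1.
Proof. by rewrite -(rmorph1 iota) ratfun_comp_poly !rmorph1. Qed.

Lemma ratfun_comp0 : comp 0 = 0.
Proof. by rewrite -(rmorph0 iota) ratfun_comp_poly !rmorph0. Qed.

Lemma ratfun_comp_neq0 f : f != 0 -> comp f != 0.
Proof.
move=> f0; apply/eqP => c0; have := ratfun_compM f f^-1.
by rewrite mulfV // ratfun_comp1 c0 mul0r => /eqP; rewrite oner_eq0.
Qed.

Lemma ratfun_compV f : comp f^-1 = (comp f)^-1.
Proof.
have [->|f0] := eqVneq f 0; first by rewrite !invr0 ratfun_comp0 invr0.
by apply: (mulfI (ratfun_comp_neq0 f0)); rewrite -ratfun_compM !mulfV
  ?ratfun_comp1 ?ratfun_comp_neq0.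
Qed.

Lemma ratfun_compX f n : comp (f ^+ n) = comp f ^+ n.
Proof. by elim: n => [|n IH]; rewrite ?expr0 ?ratfun_comp1 // !exprS ratfun_compM IH. Qed.

Lemma ratfun_compXz f (n : int) : comp (f ^ n) = comp f ^ n.
Proof.
case: n => n; first exact: ratfun_compX.
by rewrite NegzE -!exprnN ratfun_compV ratfun_compX.
Qed.

Lemma ratfun_comp_prod (I : Type) (s : seq I) (F : I -> K) :
  comp (\prod_(i <- s) F i) = \prod_(i <- s) comp (F i).
Proof. by elim/big_rec2: _ => [|i x y _ <-]; rewrite ?ratfun_comp1 ?ratfun_compM. Qed.

Lemma ratfun_comp_poly_at psi P : comp (poly_at psi P) = poly_at (comp psi) P.
Proof.
elim/poly_ind: P => [|P c IH]; first by rewrite !rmorph0 ratfun_comp0.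
rewrite !rmorphD !rmorphM /= !poly_atX !poly_atC ratfun_compD ratfun_compM
  IH ratfun_comp_poly poly_atC.
by [].
Qed.

Lemma transcendental_comp psi : transcendental psi -> transcendental (comp psi).
Proof. by move=> tpsi P P0; rewrite -ratfun_comp_poly_at; apply: ratfun_comp_neq0; exact: tpsi. Qed.

End CompBy.

Lemma ratfun_comp_comp phi f psi : transcendental phi -> transcendental psi ->
  comp_with (comp_with f psi) phi = comp_with f (comp_with psi phi).
Proof.
move=> tphi tpsi; have [P [Q [Q0 ->]]] := iota_ratio f.
have tc := transcendental_comp tphi tpsi.
by rewrite !comp_withE // ratfun_compM // ratfun_compV // !ratfun_comp_poly_at.
Qed.

(** [phi] vanishes to first order with derivative [w]: the power of X contributes w^e, and the unit
    part keeps its value at 0. *)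
Lemma ratfun_comp_lead phi w f e c : transcendental phi -> has_lead phi 1 w ->
  has_lead f e c -> has_lead (comp_with f phi) e (c * w ^ e).
Proof.
move=> tphi pl [u [v [u0 v0 -> ->]]].
have pv : has_value phi 0.
  case: pl => [u' [v' [u0' v0' -> _]]]; rewrite expr1z.
  exists ('X * u'), v'; split=> //; first by rewrite rmorphM mulrA.
  by rewrite hornerM hornerX !mul0r.
have v1 : v != 0 by apply: contra_neq v0 => ->; rewrite horner0.
rewrite ratfun_compM // ratfun_compXz // ratfun_comp_poly // poly_atX ratfun_compE //.
have hu : has_lead (poly_at phi u) 0 u.[0] by apply: has_value_lead => //; exact: has_value_poly_at.
have hv : has_lead (poly_at phi v) 0 v.[0] by apply: has_value_lead => //; exact: has_value_poly_at.
have := has_leadM iota_inj (has_leadXz iota_inj e pl) (has_leadM iota_inj hu (has_leadV hv)).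
by rewrite mul1r subr0 mulrC [X in has_lead _ _ X]mulrC.
Qed.
End Comp.

(** * Homographies and pullback *)

Section Homography.
Variable C : fieldType.
Implicit Types (M N : 'M[C]_2) (q : option C).

Lemma mulmx2E m n (A : 'M[C]_(m, 2)) (B : 'M[C]_(2, n)) i j :
  (A *m B) i j = A i 0 * B 0 j + A i 1 * B 1 j.
Proof.
rewrite mxE !big_ord_recl big_ord0 addr0.
by have -> : lift ord0 ord0 = 1 :> 'I_2 by exact: val_inj.
Qed.

Lemma ord2_cases (P : 'I_2 -> Prop) : P 0 -> P 1 -> forall i, P i.
Proof.
move=> P0 P1 [[|[|//]] h].
  by have -> : Ordinal h = 0 by exact: val_inj.
by have -> : Ordinal h = 1 by exact: val_inj.
Qed.

Lemma det2E M : \det M = M 0 0 * M 1 1 - M 0 1 * M 1 0.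
Proof.
rewrite (expand_det_row _ ord0) !big_ord_recl big_ord0 addr0 /cofactor !det_mx11 !mxE /=.
rewrite expr0 mul1r expr1 mulN1r mulrN.
by congr (M _ _ * M _ _ - M _ _ * M _ _); exact: val_inj.
Qed.

Lemma unitmx2 M : (M \in unitmx) = (M 0 0 * M 1 1 - M 0 1 * M 1 0 != 0).
Proof. by rewrite unitmxE unitfE det2E. Qed.

(** Homogeneous coordinates: (x, 1) for a finite point, (1, 0) for infinity. In them a homography is
    the action of its matrix up to a scalar, which avoids the case distinctions of [homography]. *)
Definition point q : 'cV[C]_2 := \col_i (if i == 0 then odflt 1 q else (q != None)%:R).

Lemma point_eq q q' l : l != 0 -> point q = l *: point q' -> q = q'.
Proof.
move=> l0 /colP E; have := E 0; have := E 1; rewrite !mxE /=.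
case: q {E} => [x|]; case: q' => [y|] //=; rewrite ?mulr1 ?mulr0.
- by move=> <-; rewrite mul1r => ->.
- by move/eqP; rewrite oner_eq0.
- by move/esym/eqP; rewrite (negbTE l0).
Qed.

Lemma homography_point M q : M \in unitmx ->
  exists2 l, l != 0 & M *m point q = l *: point (homography M q).
Proof.
rewrite unitmx2 => dM; case: q => [x|] /=.
  case: ifPn => [/eqP d0|d0].
    exists (M 0 0 * x + M 0 1).
      apply: contra_neq dM => n0.
      have -> : M 0 0 * M 1 1 - M 0 1 * M 1 0 =
         M 0 0 * (M 1 0 * x + M 1 1) - M 1 0 * (M 0 0 * x + M 0 1) by ring.
      by rewrite d0 n0 !mulr0 subr0.
    apply/colP; apply: ord2_cases; rewrite mulmx2E !mxE /= !mulr1 //.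
    by rewrite d0 mulr0.
  exists (M 1 0 * x + M 1 1) => //.
  apply/colP; apply: ord2_cases; rewrite mulmx2E !mxE /= !mulr1 //.
  by rewrite [RHS]mulrC divfK.
case: ifPn => [/eqP d0|d0].
  exists (M 0 0).
    by apply: contra_neq dM => n0; rewrite n0 d0 mul0r mulr0 subrr.
  apply/colP; apply: ord2_cases; rewrite mulmx2E !mxE /= !mulr1 !mulr0 addr0 //.
exists (M 1 0) => //.
apply/colP; apply: ord2_cases; rewrite mulmx2E !mxE /= !mulr1 !mulr0 addr0 //.
by rewrite [RHS]mulrC divfK.
Qed.

Lemma homography_eq M q q' l : M \in unitmx -> l != 0 ->
  M *m point q = l *: point q' -> homography M q = q'.
Proof.
move=> uM l0 E; have [l' l0' E'] := homography_point q uM.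
apply: (@point_eq _ _ (l'^-1 * l)); first by rewrite mulf_neq0 ?invr_neq0.
by rewrite -scalerA -E E' scalerA mulVf // scale1r.
Qed.

Lemma homographyM M N q : M \in unitmx -> N \in unitmx ->
  homography (N *m M) q = homography N (homography M q).
Proof.
move=> uM uN; have [l l0 E] := homography_point q uM.
have [l' l0' E'] := homography_point (homography M q) uN.
apply: (@homography_eq _ _ _ (l * l')); rewrite ?unitmx_mul ?uM ?mulf_neq0 //.
  by rewrite uN.
by rewrite -mulmxA E -scalemxAr E' scalerA.
Qed.

Lemma homography1 q : homography 1%:M q = q.
Proof.
by apply: (@homography_eq _ _ _ 1); rewrite ?unitmx1 ?oner_neq0 // mul1mx scale1r.
Qed.

Lemma homographyK M : M \in unitmx -> cancel (homography M) (homography (invmx M)).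
Proof. by move=> uM q; rewrite -homographyM ?unitmx_inv // mulVmx // homography1. Qed.

Lemma homographyVK M : M \in unitmx -> cancel (homography (invmx M)) (homography M).
Proof. by move=> uM q; rewrite -homographyM ?unitmx_inv // mulmxV // homography1. Qed.

Lemma chart_unit q : chart q \in unitmx.
Proof.
rewrite unitmx2; case: q => [x|] /=; rewrite !mxE /= ?(mulr1, mulr0, addr0, subr0, add0r, mul0r).
  by rewrite oner_eq0.
by rewrite oppr_eq0 oner_eq0.
Qed.

Lemma chart_point q : col 1 (chart q) = point q.
Proof.
apply/colP; apply: ord2_cases; case: q => [x|]; rewrite !mxE /=;
  by rewrite ?(mulr1, mulr0, addr0, add0r).
Qed.

(** [N] is [M] read in the charts at [q] and at its image; it fixes 0, which is what [N 0 1 = 0]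
    says. *)
Lemma chart_transition M q : M \in unitmx ->
  let N := invmx (chart (homography M q)) *m M *m chart q in
  [/\ N \in unitmx, N 0 1 = 0 & M *m chart q = chart (homography M q) *m N].
Proof.
move=> uM N; have uq := chart_unit q; have uq' := chart_unit (homography M q).
split.
- by rewrite !unitmx_mul unitmx_inv uq' uM uq.
- have [l l0 E] := homography_point q uM.
  have : col 1 N = l *: (delta_mx 1 0 : 'cV[C]_2).
    rewrite colE /N -!mulmxA -colE chart_point E -chart_point colE -scalemxAr.
    by rewrite mulKmx.
  by move=> /colP/(_ 0); rewrite !mxE mulr0.
- by rewrite /N !mulmxA mulmxV // mul1mx.
Qed.

Lemma three_points (q0 qoo q1 : option C) : uniq [:: q0; qoo; q1] ->
  exists2 M, M \in unitmx & [/\ homography M (Some 0) = q0, homography M None = qoo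
    & homography M (Some 1) = q1].
Proof.
pose d q q' := point q 0 0 * point q' 1 0 - point q 1 0 * point q' 0 0.
have dP q q' : q != q' -> d q q' != 0.
  rewrite /d !mxE /=; case: q => [x|]; case: q' => [y|] //= xy;
    rewrite ?(mulr1, mulr0, mul1r, mul0r, subr0, sub0r) ?oppr_eq0 ?oner_eq0 //.
  by rewrite subr_eq0; apply: contra_neq xy => ->.
rewrite /=; rewrite !inE negb_or andbT => /andP[/andP[n0oo n01] noo1].
have d1 : d qoo q0 != 0 by apply: dP; rewrite eq_sym.
have d2 : d q1 q0 != 0 by apply: dP; rewrite eq_sym.
have d3 : d qoo q1 != 0 by exact: dP.
(* Cramer's rule for al point(qoo) + be point(q0) = point(q1); these two columns then send infinity,
   0 and 1 as required. *)
pose al := d q1 q0 / d qoo q0; pose be := d qoo q1 / d qoo q0.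
have al0 : al != 0 by rewrite mulf_neq0 ?invr_neq0.
have be0 : be != 0 by rewrite mulf_neq0 ?invr_neq0.
pose M : 'M[C]_2 := \matrix_(i, j) (if j == 0 then al * point qoo i 0 else be * point q0 i 0).
have M0 i : M i 0 = al * point qoo i 0 by rewrite mxE.
have M1 i : M i 1 = be * point q0 i 0 by rewrite mxE.
have uM : M \in unitmx.
  rewrite unitmx2 !M0 !M1.
  have -> : al * point qoo 0 0 * (be * point q0 1 0) - be * point q0 0 0 * (al * point qoo 1 0) =
     al * be * d qoo q0 by rewrite /d; ring.
  by rewrite mulf_neq0 // mulf_neq0.
exists M => //; split.
- apply: (@homography_eq M (Some 0) q0 be uM be0); apply/colP => i.
  by rewrite mulmx2E M0 M1 [LHS]/= !mxE /= mulr0 mulr1 add0r.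
- apply: (@homography_eq M None qoo al uM al0); apply/colP => i.
  by rewrite mulmx2E M0 M1 !mxE /= mulr0 mulr1 addr0.
- apply: (@homography_eq M (Some 1) q1 1 uM (oner_neq0 _)); apply/colP => i.
  rewrite mulmx2E M0 M1 scale1r [X in _ * X + _]mxE [X in _ + _ * X]mxE /= !mulr1.
  apply: (mulIf d1); rewrite mulrDl mulrAC [be * _ * _]mulrAC /al /be !divfK //.
  by move: i; apply: ord2_cases; rewrite /d; ring.
Qed.
End Homography.

Section Pullback.
Variables (C : closedFieldType) (K : fieldType) (iota : {rmorphism {poly C} -> K}).
Hypothesis iota_inj : injective iota.
Hypothesis iota_ratio : forall f : K, exists P Q, Q != 0 /\ f = iota P / iota Q.
Variable comp_with : K -> K -> K.
Hypothesis comp_withE : forall phi P Q, transcendental iota phi -> Q != 0 ->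
  comp_with (iota P / iota Q) phi = poly_at iota phi P / poly_at iota phi Q.
Notation has_lead := (has_lead iota).
Notation poly_at := (poly_at iota).
Implicit Types (f g : K) (M N : 'M[C]_2) (a b c : C).

Definition affine a b : K := iota (a *: 'X + b%:P).

Lemma affine_neq0 a b : (a != 0) || (b != 0) -> affine a b != 0.
Proof.
rewrite /affine iota_eq0 // => ab; apply/eqP => E.
have E1 := congr1 (fun P : {poly C} => P.[0]) E.
have E2 := congr1 (fun P : {poly C} => P.[1]) E.
move: E1 E2; rewrite !(hornerD, hornerZ, hornerX, hornerC, horner0) mulr0 add0r => b0.
by rewrite b0 addr0 mulr1 => a0; move: ab; rewrite a0 b0 eqxx.
Qed.

Definition mobius M : K := affine (M 0 0) (M 0 1) / affine (M 1 0) (M 1 1).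

Lemma den_neq0 M : M \in unitmx -> affine (M 1 0) (M 1 1) != 0.
Proof.
rewrite unitmx2 => dM; apply: affine_neq0; rewrite -negb_and; apply: contraNN dM.
by move=> /andP[/eqP-> /eqP->]; rewrite !mulr0 subrr.
Qed.

Lemma poly_at_mobius M a b : M \in unitmx ->
  poly_at (mobius M) (a *: 'X + b%:P) =
  affine (a * M 0 0 + b * M 1 0) (a * M 0 1 + b * M 1 1) / affine (M 1 0) (M 1 1).
Proof.
move=> uM; have d0 := den_neq0 uM.
rewrite rmorphD /= -mul_polyC rmorphM /= poly_atX !poly_atC /mobius.
apply: (mulIf d0); rewrite divfK // mulrDl -mulrA divfK // /affine -!rmorphM -rmorphD /=.
by congr (iota _); rewrite -!mul_polyC !polyCD !polyCM; ring.
Qed.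

(** Over a closed field it suffices to treat linear factors, which become quotients of nonzero
    affine functions. *)
Lemma mobius_transcendental M : M \in unitmx -> transcendental iota (mobius M).
Proof.
move=> uM P P0; have [s ->] := closed_field_poly_normal P.
rewrite -mul_polyC rmorphM /= poly_atC mulf_neq0 //.
  by rewrite iota_eq0 // polyC_eq0 lead_coef_eq0.
rewrite rmorph_prod prodf_seq_neq0; apply/allP => x _ /=.
rewrite -['X]scale1r -polyCN poly_at_mobius // mulf_neq0 ?invr_neq0 ?den_neq0 //.
apply: affine_neq0; rewrite -negb_and; move: uM; rewrite unitmx2; apply: contraNN.
rewrite !mul1r !mulNr !subr_eq0 => /andP[/eqP -> /eqP ->].
by apply/eqP; ring.
Qed.

Definition pullback_with (k : nat) M f : K :=
  comp_with f (mobius M) * (iota (\det M)%:P / affine (M 1 0) (M 1 1) ^+ 2) ^+ k.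

Lemma mobius_comp M N : M \in unitmx -> N \in unitmx ->
  comp_with (mobius N) (mobius M) = mobius (N *m M).
Proof.
move=> uM uN; have tM := mobius_transcendental uM.
rewrite /mobius /affine comp_withE //; last first.
  by rewrite -(iota_eq0 iota_inj); exact: den_neq0.
rewrite -!/(affine _ _) -/(mobius M) !poly_at_mobius // !mulmx2E.
by rewrite invf_div mulrA divfK // den_neq0.
Qed.

(** This is the chain rule: the determinants multiply, and the denominators of [M] cancel. *)
Lemma pullback_with_comp k M N f : M \in unitmx -> N \in unitmx ->
  pullback_with k M (pullback_with k N f) = pullback_with k (N *m M) f.
Proof.
move=> uM uN; have tM := mobius_transcendental uM; have tN := mobius_transcendental uN.
have cM := ratfun_compM iota_ratio comp_withE tM.
have cX := ratfun_compX iota_ratio comp_withE tM.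
have cV := ratfun_compV iota_ratio comp_withE tM.
have cP := ratfun_comp_poly comp_withE tM.
rewrite /pullback_with cM (ratfun_comp_comp iota_inj iota_ratio comp_withE) // mobius_comp //.
rewrite -mulrA cX -exprMn cM cV cX !cP poly_atC poly_at_mobius //.
rewrite det_mulmx polyCM rmorphM /= !mulmx2E.
have d1 := den_neq0 uM.
have d2 : affine (N 1 0 * M 0 0 + N 1 1 * M 1 0) (N 1 0 * M 0 1 + N 1 1 * M 1 1) != 0.
  by have := @den_neq0 (N *m M); rewrite !mulmx2E unitmx_mul uN uM; apply.
congr (_ * _ ^+ k); move: d1 d2.
move: (affine (M 1 0) _) (affine (N 1 0 * _ + _) _) (iota (\det N)%:P) (iota (\det M)%:P).
by move=> d D A B d0 D0; field; rewrite d0 D0.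
Qed.

Lemma pullback_with1 k f : pullback_with k 1%:M f = f.
Proof.
have u1 : (1%:M : 'M[C]_2) \in unitmx by rewrite unitmx1.
have tM := mobius_transcendental u1.
have E : mobius 1%:M = iota 'X.
  by rewrite /mobius /affine !mxE /= scale1r scale0r addr0 add0r rmorph1 divr1.
have rI P : poly_at (iota 'X) P = iota P.
  elim/poly_ind: P => [|P c IH]; first by rewrite !rmorph0.
  by rewrite !rmorphD !rmorphM /= poly_atX poly_atC IH.
have [P [Q [Q0 ->]]] := iota_ratio f.
rewrite /pullback_with comp_withE // E !rI det1 /affine !mxE /= scale0r add0r !rmorph1 expr1n divr1.
by rewrite expr1n mulr1.
Qed.

Lemma pullback_with_neq0 k M f : M \in unitmx -> f != 0 -> pullback_with k M f != 0.
Proof.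
move=> uM f0; rewrite mulf_neq0 //.
  exact: (ratfun_comp_neq0 iota_ratio comp_withE (mobius_transcendental uM)).
rewrite expf_neq0 // mulf_neq0 ?invr_neq0 ?expf_neq0 ?den_neq0 //.
by rewrite iota_eq0 // polyC_eq0 -unitfE -unitmxE.
Qed.

Lemma affine_value a b : has_value iota (affine a b) b.
Proof.
exists (a *: 'X + b%:P), 1; rewrite !hornerE oner_eq0 rmorph1 !divr1; split=> //.
Qed.

(** [M] fixes 0 with derivative w = M 0 0 / M 1 1; the composition contributes w^e and the k-th
    power of the derivative contributes w^k. *)
Lemma pullback_with_lead k M f e c : M \in unitmx -> M 0 1 = 0 -> has_lead f e c ->
  has_lead (pullback_with k M f) e (c * (M 0 0 / M 1 1) ^ (e + k%:Z)).
Proof.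
move=> uM M01 fe; have tM := mobius_transcendental uM.
have := uM; rewrite unitmx2 M01 mul0r subr0 mulf_eq0 negb_or => /andP[M00 M11].
have hd : has_lead (affine (M 1 0) (M 1 1)) 0 (M 1 1).
  by apply: has_value_lead => //; exact: affine_value.
have hc a : a != 0 -> has_lead (iota a%:P) 0 a.
  by move=> a0; apply: has_value_lead => //; exact: has_valueC.
have hm : has_lead (mobius M) 1 (M 0 0 / M 1 1).
  have hn : has_lead (affine (M 0 0) (M 0 1)) 1 (M 0 0).
    have := has_leadM iota_inj (hc _ M00) (has_leadX iota).
    by rewrite -rmorphM /= mul_polyC /affine M01 polyC0 addr0 add0r mulr1.
  by have := has_leadM iota_inj hn (has_leadV hd); rewrite oppr0 addr0.
have hj : has_lead (iota (\det M)%:P / affine (M 1 0) (M 1 1) ^+ 2) 0 (M 0 0 / M 1 1).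
  have dM : \det M = M 0 0 * M 1 1 by rewrite det2E M01 mul0r subr0.
  have := has_leadM iota_inj (hc (M 0 0 * M 1 1) _) (has_leadV (has_leadXn iota_inj 2 hd)).
  rewrite mul0r oppr0 addr0 dM expr2 -mulf_div mulfV // mulr1; apply.
  by rewrite mulf_neq0.
have := has_leadM iota_inj (ratfun_comp_lead iota_inj iota_ratio comp_withE tM hm fe)
  (has_leadXn iota_inj k hj).
by rewrite mul0r addr0 -mulrA [(M 0 0 / M 1 1) ^+ k]exprnP -expfzDr // mulf_neq0 ?invr_neq0.
Qed.

Definition local_with k f q : K := pullback_with k (chart q) f.

(* Leading exponents are invariant under pullback, and so is the leading
   coefficient at a pole of order [k]. *)
Lemma local_with_lead k M f q e c : M \in unitmx ->
  has_lead (local_with k f (homography M q)) e c ->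
  exists2 w, w != 0 & has_lead (local_with k (pullback_with k M f) q) e (c * w ^ (e + k%:Z)).
Proof.
move=> uM; have [uN N01 E] := chart_transition q uM.
set N := invmx _ *m M *m chart q in uN N01 E *.
move=> /(pullback_with_lead k uN N01); rewrite /local_with.
rewrite pullback_with_comp ?chart_unit // -E -pullback_with_comp ?chart_unit //.
have := uN; rewrite unitmx2 N01 mul0r subr0 mulf_eq0 negb_or => /andP[N00 N11].
move=> H; exists (N 0 0 / N 1 1); [by rewrite mulf_neq0 ?invr_neq0 | exact: H].
Qed.
End Pullback.

Lemma same_mup (C : closedFieldType) (P Q : {poly C}) : P != 0 -> Q != 0 ->
  (forall z, mup z P = mup z Q) -> exists2 c, c != 0 & P = c *: Q.
Proof.
move=> P0 Q0 H; have [s sP] := closed_field_poly_normal P.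
have [t tQ] := closed_field_poly_normal Q.
have lP0 : lead_coef P != 0 by rewrite lead_coef_eq0.
have lQ0 : lead_coef Q != 0 by rewrite lead_coef_eq0.
have mupZ (l : C) (u : seq C) z : l != 0 -> mup z (l *: \prod_(y <- u) ('X - y%:P)) = count_mem z u.
  move=> l0; rewrite -mul_polyC mupMr ?mu_prod_XsubC //.
  by rewrite /root hornerC.
have st : perm_eq s t.
  by apply/allP => z _ /=; have := H z; rewrite {1}sP tQ !mupZ // => ->.
exists (lead_coef P / lead_coef Q); first by rewrite mulf_neq0 ?invr_neq0.
by rewrite {1}sP {2}tQ scalerA divfK // (perm_big _ st).
Qed.

(** * Orders of the normalised differential *)

Section Standard.
Variables (C : closedFieldType) (K : fieldType) (iota : {rmorphism {poly C} -> K}).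
Hypothesis iota_inj : injective iota.
Hypothesis iota_ratio : forall f : K, exists P Q, Q != 0 /\ f = iota P / iota Q.
Variable comp_with : K -> K -> K.
Hypothesis comp_withE : forall phi P Q, transcendental iota phi -> Q != 0 ->
  comp_with (iota P / iota Q) phi = poly_at iota phi P / poly_at iota phi Q.
Notation has_lead := (has_lead iota).
Notation poly_at := (poly_at iota).
Notation local := (local_with iota comp_with).
Implicit Types (f g : K) (c : C).

Lemma mobius_chart_some z : mobius iota (chart (Some z)) = iota ('X + z%:P).
Proof.
rewrite /mobius /affine !mxE /= !(mulr1, mulr0, addr0, add0r) scale1r scale0r add0r.
by rewrite rmorph1 divr1.
Qed.

Lemma transcendental_shift z : transcendental iota (iota ('X + z%:P)).
Proof. by rewrite -mobius_chart_some; apply: mobius_transcendental => //; exact: chart_unit. Qed.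

Lemma local_some k f z : local k f (Some z) = comp_with f (iota ('X + z%:P)).
Proof.
rewrite /local_with /pullback_with mobius_chart_some det2E /affine !mxE /=.
rewrite !(mulr1, mulr0, addr0, add0r) scale0r subr0 add0r !rmorph1 expr1n divr1 expr1n mulr1.
by [].
Qed.

(** Leading coefficient at 0 of X + (z - x), whose order is 1 if z = x and 0 otherwise. *)
Definition diff_or1 (z x : C) : C := if z == x then 1 else z - x.

Lemma has_leadC c : c != 0 -> has_lead (iota c%:P) 0 c.
Proof. by move=> c0; apply: has_value_lead => //; exact: has_valueC. Qed.

Lemma shift_lead z x :
  has_lead (poly_at (iota ('X + z%:P)) ('X - x%:P)) (z == x)%:Z (diff_or1 z x).
Proof.
rewrite rmorphB /= poly_atX poly_atC -rmorphB /= -addrA -polyCB /diff_or1.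
have [->|zx] := eqVneq; first by rewrite subrr polyC0 addr0; exact: has_leadX.
have := @has_lead_poly C K iota ('X + (z - x)%:P).
by rewrite !hornerE subr_eq0; apply.
Qed.

Definition standard (k : nat) (a : int) (J : finType) (c : C) (x : J -> C) : K :=
  iota c%:P * (iota 'X) ^ a / \prod_j (iota ('X - (x j)%:P)) ^+ k.

Lemma standard_lead_some k (a : int) (J : finType) c (x : J -> C) z : c != 0 ->
  has_lead (local k (standard k a c x) (Some z))
    ((z == 0)%:Z * a - \sum_j (z == x j)%:Z * k%:Z)
    (c * diff_or1 z 0 ^ a / \prod_j diff_or1 z (x j) ^+ k).
Proof.
move=> c0; have tz := @transcendental_shift z.
rewrite local_some /standard.
rewrite !(ratfun_compM iota_ratio comp_withE tz) (ratfun_compV iota_ratio comp_withE tz).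
rewrite (ratfun_comp_prod iota_ratio comp_withE tz) (ratfun_compXz iota_ratio comp_withE tz).
rewrite !(ratfun_comp_poly comp_withE tz) poly_atC.
have hX : has_lead (poly_at (iota ('X + z%:P)) 'X) (z == 0)%:Z (diff_or1 z 0).
  by have := shift_lead z 0; rewrite subr0.
have hP := @has_lead_prod _ _ _ iota_inj _ (index_enum J) _ _ _
  (fun j => has_leadXn iota_inj k (shift_lead z (x j))).
have := has_leadM iota_inj (has_leadM iota_inj (has_leadC c0) (has_leadXz iota_inj a hX))
  (has_leadV hP).
rewrite add0r; congr (has_lead (_ / _)).
apply: eq_bigr => j _.
by rewrite (ratfun_compX iota_ratio comp_withE tz) (ratfun_comp_poly comp_withE tz).
Qed.

Lemma mobius_chart_none : mobius iota (chart (None : option C)) = (iota 'X)^-1.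
Proof.
rewrite /mobius /affine !mxE /= !(addr0, add0r) scale1r scale0r add0r.
by rewrite rmorph1 div1r.
Qed.

(** The term - 2 k is the order of (dz)^k at infinity. *)
Lemma standard_lead_none k (a : int) (J : finType) c (x : J -> C) : c != 0 ->
  exists d, has_lead (local k (standard k a c x) None)
    (- a + (#|J| * k)%N%:Z - (2 * k)%N%:Z) d.
Proof.
move=> c0; have tz : transcendental iota (iota 'X)^-1.
  by rewrite -mobius_chart_none; apply: mobius_transcendental => //; exact: chart_unit.
rewrite /local_with /pullback_with mobius_chart_none /standard.
rewrite !(ratfun_compM iota_ratio comp_withE tz) (ratfun_compV iota_ratio comp_withE tz).
rewrite (ratfun_comp_prod iota_ratio comp_withE tz) (ratfun_compXz iota_ratio comp_withE tz).
rewrite !(ratfun_comp_poly comp_withE tz) poly_atC poly_atX.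
have hX := has_leadX iota; have hXV := has_leadV hX.
have hF j : has_lead (comp_with (iota ('X - (x j)%:P) ^+ k) (iota 'X)^-1) (- k%:Z) 1.
  rewrite (ratfun_compX iota_ratio comp_withE tz) (ratfun_comp_poly comp_withE tz).
  rewrite rmorphB /= poly_atX poly_atC.
  have -> : (iota 'X)^-1 - iota (x j)%:P = (iota 'X)^-1 * iota (1 - (x j)%:P * 'X).
    rewrite rmorphB rmorphM rmorph1 mulrBr mulr1; congr (_ - _).
    by rewrite mulrCA mulVf ?mulr1 // ratX_neq0.
  have h1 : has_lead (iota (1 - (x j)%:P * 'X)) 0 1.
    have := @has_lead_poly C K iota (1 - (x j)%:P * 'X).
    by rewrite !(hornerD, hornerN, hornerM, hornerX, hornerC) mulr0 subr0 oner_eq0; apply.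
  have := has_leadXn iota_inj k (has_leadM iota_inj hXV h1).
  by rewrite addr0 mulN1r invr1 mulr1 expr1n.
have hP := @has_lead_prod _ _ _ iota_inj _ (index_enum J) _ _ _ hF.
have hd : has_lead (affine iota (chart (None : option C) 1 0) (chart (None : option C) 1 1)) 1 1.
  by rewrite /affine !mxE /= !(addr0, add0r) scale1r.
have dn : \det (chart (None : option C)) = -1.
  by rewrite det2E !mxE /= !(addr0, add0r) mulr0 sub0r mulr1.
have hJ := has_leadXn iota_inj k (has_leadM iota_inj (has_leadC (_ : -1 != 0))
  (has_leadV (has_leadXn iota_inj 2 hd))).
have H := has_leadM iota_inj (has_leadM iota_inj (has_leadM iota_inj (has_leadC c0)
   (has_leadXz iota_inj a hXV)) (has_leadV hP)) (hJ _).
eexists; rewrite dn; move: H; rewrite oppr_eq0 oner_eq0 => /(_ isT).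
have -> : 0 + -1 * a + - (\sum_(j : J) - k%:Z) + (0 + - (1 * 2%:Z)) * k%:Z =
  - a + (#|J| * k)%N%:Z - (2 * k)%N%:Z.
  have -> : \sum_(j : J) - k%:Z = - k%:Z * #|J|%:Z.
    by rewrite (eq_bigl (mem J)) // sumr_const -mulr_natr natz.
  by rewrite !PoszM; ring.
exact.
Qed.

Lemma standard_neq0 k (a : int) (J : finType) c (x : J -> C) : c != 0 -> standard k a c x != 0.
Proof.
move=> c0; rewrite /standard !mulf_neq0 ?invr_neq0 //.
- by rewrite iota_eq0 // polyC_eq0.
- by rewrite expfz_neq0 // ratX_neq0.
- by apply/prodf_neq0 => j _; rewrite expf_neq0 // iota_eq0 // polyXsubC_eq0.
Qed.

Lemma shift_lead_ratio P Q z : P != 0 -> Q != 0 ->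
  exists c, has_lead (comp_with (iota P / iota Q) (iota ('X + z%:P)))
    ((mup z P)%:Z - (mup z Q)%:Z) c.
Proof.
move=> P0 Q0; have tz := @transcendental_shift z.
have H (R : {poly C}) : R != 0 -> exists c, has_lead (poly_at (iota ('X + z%:P)) R) (mup z R)%:Z c.
  move=> R0; have [q q0 qE] := mup_factor z R0.
  have hq : has_lead (poly_at (iota ('X + z%:P)) q) 0 q.[z].
    apply: has_value_lead => //; apply: has_value_poly_at => //.
    by exists ('X + z%:P), 1; rewrite !hornerE oner_eq0 rmorph1 !divr1.
  have hz := shift_lead z z; rewrite /diff_or1 eqxx in hz.
  have := has_leadM iota_inj (has_leadXn iota_inj (mup z R) hz) hq.
  rewrite mul1r addr0 -rmorphXn -rmorphM /= -qE => h.
  by exists (1 ^+ mup z R * q.[z]).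
have [c hc] := H P P0; have [d hd] := H Q Q0.
by exists (c / d); rewrite comp_withE //; exact: (has_leadM iota_inj hc (has_leadV hd)).
Qed.

(** The quotient f / g has order 0 at every finite point, so its numerator and denominator have the
    same roots with multiplicity and are proportional. *)
Lemma same_orders k f g : f != 0 -> g != 0 ->
  (forall z, exists e c d,
    has_lead (local k f (Some z)) e c /\ has_lead (local k g (Some z)) e d) ->
  exists2 c, c != 0 & f = iota c%:P * g.
Proof.
move=> f0 g0 H; have [P [Q [Q0 E]]] := iota_ratio (f / g).
have fE : f = (iota P / iota Q) * g by rewrite -E divfK.
have P0 : P != 0.
  by apply: contra_neq f0 => P0; rewrite fE P0 rmorph0 !mul0r.
have [z|c c0 PE] := same_mup P0 Q0.
  have [e [c [d [h1 h2]]]] := H z; have [c' h3] := shift_lead_ratio z P0 Q0.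
  move: h1; rewrite local_some fE (ratfun_compM iota_ratio comp_withE (@transcendental_shift z)).
  rewrite local_some in h2.
  move=> h1; have [E1 _] := has_lead_unique iota_inj h1 (has_leadM iota_inj h3 h2).
  move/eqP: E1; rewrite -subr_eq0 opprD addrCA subrr addr0 oppr_eq0 subr_eq0.
  by move=> /eqP [].
exists c => //; rewrite fE PE -mul_polyC rmorphM /= mulfK // iota_eq0 //.
Qed.
End Standard.

(** * Normal form at a pole of order [k] *)

Section PowerSeries.
Variable C : numFieldType.
Implicit Types (A B P Q W N D : {poly C}).

Lemma poly_split P : exists Q, P = P.[0]%:P + 'X * Q.
Proof.
have : root (P - P.[0]%:P) 0 by rewrite /root !hornerE subrr.
move=> /factor_theorem[Q]; rewrite subr0 => E; exists Q.
by rewrite mulrC -E addrC subrK.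
Qed.

Lemma expr_add_mod (m k : nat) A (a : C) :
  exists Q, (A + a%:P * 'X ^+ m.+1) ^+ k =
    A ^+ k + (a * k%:R * A.[0] ^+ k.-1)%:P * 'X ^+ m.+1 + 'X ^+ m.+2 * Q.
Proof.
elim: k => [|k [Q IH]].
  by exists 0; rewrite !expr0 mulr0 mul0r polyC0 mul0r mulr0 !addr0.
have [A' EA] := poly_split A; have [B EB] := poly_split (A ^+ k).
have EA2 : A.[0]%:P = A - 'X * A' by rewrite {2}EA addrK.
have EB2 : ((A ^+ k).[0])%:P = A ^+ k - 'X * B by rewrite {2}EB addrK.
have [c cE'] : exists c, a * k%:R * A.[0] ^+ k.-1 = c by eexists.
have cE : (a * k.+1%:R * A.[0] ^+ k) = c * A.[0] + a * (A ^+ k).[0].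
  rewrite -cE' horner_exp; case: k {IH EB EB2 cE'} => [|k] /=.
    by rewrite !expr0 !mulr1 mulr0 mul0r add0r.
  by rewrite exprSr -[k.+2%:R]natr1; move: (A.[0] ^+ k) => Z; ring.
exists ((A + a%:P * 'X ^+ m.+1) * Q + c%:P * A' + a%:P * B + a%:P * c%:P * 'X ^+ m).
rewrite exprS IH cE' cE polyCD !polyCM [A ^+ k.+1]exprS EA2 EB2.
rewrite !exprS; move: ('X ^+ m) (A ^+ k) => Y Z.
by ring.
Qed.

Section Solve.
Variables (k : nat) (rho : C) (N0 D0 : {poly C}).
Hypothesis k_gt0 : (0 < k)%N.
Hypothesis N00 : N0.[0] != 0.
Hypothesis lead_eq : N0.[0] = rho * D0.[0].

(* With [t = z W], the equation of the normal form of [z^-k N0 / D0] is [defect W = 0]. *)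
Definition defect W : {poly C} := N0 * W ^+ k - rho%:P * (W + 'X * W^`()) ^+ k * D0.

(** Modulo X^(m + 2) the next coefficient [a] enters linearly: by [lead_eq] it contributes a k N0(0)
    (1 - (m + 2)), which cancels Q(0) for a = Q(0) / (k (m + 1) N0(0)). *)
Lemma defect_step m W : W.[0] = 1 -> (exists Q, defect W = 'X ^+ m.+1 * Q) ->
  exists a, exists Q, defect (W + a%:P * 'X ^+ m.+1) = 'X ^+ m.+2 * Q.
Proof.
move=> W0 [Q EQ]; pose U := W + 'X * W^`().
have U0 : U.[0] = 1 by rewrite /U hornerD hornerM hornerX mul0r addr0.
have [N' EN] := poly_split N0; have [D' ED] := poly_split D0; have [Q' EQ'] := poly_split Q.
pose a := Q.[0] / (k%:R * m.+1%:R * N0.[0]).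
have d0 : k%:R * m.+1%:R * N0.[0] != 0.
  by rewrite !mulf_neq0 // pnatr_eq0 // -lt0n.
have aE : a * k%:R * m.+1%:R * N0.[0] = Q.[0].
  have -> : a * k%:R * m.+1%:R * N0.[0] = a * (k%:R * m.+1%:R * N0.[0]) by ring.
  by rewrite /a divfK.
have [Q1 E1] := expr_add_mod m k W a.
have [Q2 E2] := expr_add_mod m k U (a * m.+2%:R).
rewrite W0 expr1n mulr1 in E1; rewrite U0 expr1n mulr1 in E2.
have UE : W + a%:P * 'X ^+ m.+1 + 'X * (W + a%:P * 'X ^+ m.+1)^`() =
    U + (a * m.+2%:R)%:P * 'X ^+ m.+1.
  rewrite derivD derivM derivC mul0r add0r derivXn /= polyCM -mulr_natl polyC_natr.
  rewrite -[m.+2%:R]natr1 exprS /U; move: ('X ^+ m) => Y.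
  by ring.
exists a.
exists (Q' + N0 * Q1 - rho%:P * Q2 * D0 +
  (a * k%:R)%:P * N' - rho%:P * (a * m.+2%:R * k%:R)%:P * D').
rewrite /defect UE E1 E2.
have -> : N0 * (W ^+ k + (a * k%:R)%:P * 'X ^+ m.+1 + 'X ^+ m.+2 * Q1) -
   rho%:P * (U ^+ k + (a * m.+2%:R * k%:R)%:P * 'X ^+ m.+1 + 'X ^+ m.+2 * Q2) * D0 =
   defect W + ((a * k%:R)%:P * N0 - rho%:P * (a * m.+2%:R * k%:R)%:P * D0) * 'X ^+ m.+1
   + 'X ^+ m.+2 * (N0 * Q1 - rho%:P * Q2 * D0).
  by rewrite /defect -/U; move: ('X ^+ m.+1) ('X ^+ m.+2) (U ^+ k) (W ^+ k) => *; ring.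
have E3 : Q.[0]%:P + (a * k%:R)%:P * N0.[0]%:P - rho%:P * (a * m.+2%:R * k%:R)%:P * D0.[0]%:P = 0.
  rewrite -!polyCM -polyCD -polyCB; congr (_%:P : {poly C}).
  have -> : rho * (a * m.+2%:R * k%:R) * D0.[0] = a * m.+2%:R * k%:R * N0.[0].
    by rewrite lead_eq; ring.
  by rewrite -aE -[m.+2%:R]natr1; ring.
rewrite EQ {1}EQ' {1}EN {1}ED ['X ^+ m.+2]exprS.
have -> : 'X ^+ m.+1 * (Q.[0]%:P + 'X * Q') + ((a * k%:R)%:P * (N0.[0]%:P + 'X * N') -
   rho%:P * (a * m.+2%:R * k%:R)%:P * (D0.[0]%:P + 'X * D')) * 'X ^+ m.+1 =
   (Q.[0]%:P + (a * k%:R)%:P * N0.[0]%:P -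
    rho%:P * (a * m.+2%:R * k%:R)%:P * D0.[0]%:P) * 'X ^+ m.+1
   + 'X * 'X ^+ m.+1 * (Q' + (a * k%:R)%:P * N' - rho%:P * (a * m.+2%:R * k%:R)%:P * D').
  by move: ('X ^+ m.+1) => Y; ring.
by rewrite E3 mul0r add0r; move: ('X ^+ m.+1) => Y; ring.
Qed.
End Solve.

(** Coefficients are found one after the other by [defect_step], starting from W = 1, and t = z W.
    The common power X^i is there because the chosen representative of a fraction may not be
    reduced. *)
Lemma normal_form_exists k (rho : C) (N0 D0 : {poly C}) i : (0 < k)%N -> N0.[0] != 0 ->
  N0.[0] = rho * D0.[0] ->
  exists t : nat -> C, [/\ t 0%N = 0, t 1%N != 0 & forall n,
    let T := \poly_(i < n.+1) t i in
    'X^n %| 'X^i * N0 * T ^+ k - rho *: (T^`() ^+ k * ('X^(i + k) * D0))].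
Proof.
move=> k0 N00 lead_eq.
have /choice[al alP] : forall mW : nat * {poly C}, exists a, mW.2.[0] = 1 ->
    (exists Q, defect k rho N0 D0 mW.2 = 'X ^+ mW.1.+1 * Q) ->
    exists Q, defect k rho N0 D0 (mW.2 + a%:P * 'X ^+ mW.1.+1) = 'X ^+ mW.1.+2 * Q.
  move=> [m W] /=; have [[h1 h2]|nh] := pselect (W.[0] = 1 /\
    exists Q, defect k rho N0 D0 W = 'X ^+ m.+1 * Q).
    have [a [Q aP]] := defect_step k0 N00 lead_eq h1 h2.
    by exists a => _ _; exists Q; exact: aP.
  by exists 0 => h1 h2; case: nh.
pose Wn := fix Wn m : {poly C} :=
  if m is m'.+1 then Wn m' + (al (m', Wn m'))%:P * 'X ^+ m'.+1 else 1.
pose s m := if m is m'.+1 then al (m', Wn m') else 1.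
pose t m := if m is m'.+1 then s m' else 0.
have WnP m : (Wn m).[0] = 1 /\ exists Q, defect k rho N0 D0 (Wn m) = 'X ^+ m.+1 * Q.
  elim: m => [|m [IH1 IH2]].
    split; first by rewrite hornerC.
    rewrite /defect /= -polyC1 derivC mulr0 addr0 polyC1 !expr1n !mulr1 expr1.
    have : root (N0 - rho%:P * D0) 0.
      by rewrite /root hornerD hornerN hornerM hornerC -lead_eq subrr.
    by move=> /factor_theorem[Q]; rewrite subr0 => ->; exists Q; exact: mulrC.
  split; last exact: (alP (m, Wn m)).
  by rewrite /= hornerD hornerM hornerXn expr0n mulr0 addr0.
have WnE m : Wn m = \poly_(i < m.+1) s i.
  elim: m => [|m IH]; first by rewrite poly_def big_ord1 expr0 scale1r.
  by rewrite poly_def big_ord_recr -poly_def -IH /= mul_polyC.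
exists t; split=> //=; first exact: oner_neq0.
case=> [|m]; first by rewrite expr0 dvd1p.
have -> : \poly_(i < m.+2) t i = 'X * Wn m.
  apply/polyP => j; rewrite coefXM coef_poly WnE coef_poly.
  by case: j => [|j] //=; rewrite ltnS.
have [_ [Q QE]] := WnP m.
have -> : 'X^i * N0 * ('X * Wn m) ^+ k - rho *: (('X * Wn m)^`() ^+ k * ('X^(i + k) * D0)) =
   'X^(i + k) * defect k rho N0 D0 (Wn m).
  rewrite /defect derivM derivX mul1r -mul_polyC !exprD !exprMn.
  by move: (_ ^+ k) (_ ^+ k) ('X^i) ('X^k) => *; ring.
by rewrite QE mulrCA dvdp_mulr.
Qed.

(** Compare the coefficients of X^(i + k), the lowest that occur: N0(0) t_1^k = r^k t_1^k D0(0). *)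
Lemma normal_form_unique k (r : C) (N0 D0 : {poly C}) i (t : nat -> C) :
  D0.[0] != 0 -> t 0%N = 0 -> t 1%N != 0 ->
  (forall n, let T := \poly_(i < n.+1) t i in
    'X^n %| 'X^i * N0 * T ^+ k - r ^+ k *: (T^`() ^+ k * ('X^(i + k) * D0))) ->
  r ^+ k = N0.[0] / D0.[0].
Proof.
move=> D00 t0 t1 /(_ (i + k).+1) /=.
set T := \poly_(_ < _) _ => H.
pose V := \poly_(j < (i + k).+1) t j.+1.
have TE : T = 'X * V.
  by apply/polyP => j; rewrite coefXM !coef_poly; case: j => [|j] //=.
have V0 : V.[0] = t 1%N by rewrite horner_coef0 coef_poly.
have T'0 : (T^`()).[0] = t 1%N.
  by rewrite TE derivM derivX mul1r hornerD hornerM hornerX mul0r addr0.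
have E : 'X^i * N0 * T ^+ k - r ^+ k *: (T^`() ^+ k * ('X^(i + k) * D0)) =
  'X^(i + k) * (N0 * V ^+ k - (r ^+ k)%:P * T^`() ^+ k * D0).
  rewrite {1}TE exprMn -mul_polyC !exprD.
  by move: (r ^+ k)%:P (_ ^+ k) (_ ^+ k) ('X^i) ('X^k) => *; ring.
move: H; rewrite E exprSr dvdp_mul2l ?expf_neq0 ?polyX_eq0 //.
rewrite -['X]subr0 dvdp_XsubCl /root hornerD hornerN !hornerM !horner_exp hornerC V0 T'0.
rewrite subr_eq0 mulrAC => /eqP E2; apply: (mulIf D00); rewrite divfK //.
by apply: (mulIf (_ : t 1%N ^+ k != 0)); rewrite ?expf_neq0.
Qed.
End PowerSeries.

Lemma ratio_comp_eq (C K : fieldType) (iota : {rmorphism {poly C} -> K}) (phi : K)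
    (P Q n d : {poly C}) : injective iota -> transcendental iota phi -> Q != 0 -> d != 0 ->
  iota P / iota Q = iota n / iota d ->
  poly_at iota phi n / poly_at iota phi d = poly_at iota phi P / poly_at iota phi Q.
Proof.
move=> iinj tphi Q0 d0 /eqP; rewrite eqr_div ?iota_eq0 // -!rmorphM (inj_eq iinj) => /eqP E.
by apply/eqP; rewrite eqr_div ?tphi // -!rmorphM /= E.
Qed.

Lemma mup_ratio_lead (C K : fieldType) (iota : {rmorphism {poly C} -> K}) (n d : {poly C})
    (e : int) (c : C) : injective iota -> n != 0 -> d != 0 ->
  has_lead iota (iota n / iota d) e c -> (mup 0 n)%:Z - (mup 0 d)%:Z = e.
Proof.
move=> iinj n0 d0 h; have [c1 h1] := has_lead_mup iinj n0; have [c2 h2] := has_lead_mup iinj d0.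
by have [] := has_lead_unique iinj (has_leadM iinj h1 (has_leadV h2)) h.
Qed.

(** At a pole of order k the k-residue is the leading coefficient; any k-th root of it, here
    [k.-root c], can serve as [r]. *)
Lemma kresidue_ratio (C : numClosedFieldType) (K : fieldType) (iota : {rmorphism {poly C} -> K})
    (k : nat) (n d : {poly C}) (c rho : C) : injective iota -> (0 < k)%N -> n != 0 -> d != 0 ->
  has_lead iota (iota n / iota d) (- k%:Z) c ->
  (exists r : C, exists t : nat -> C, [/\ r != 0,
     [/\ t 0%N = 0, t 1%N != 0 & forall m : nat, let T := \poly_(i < m.+1) t i in
       'X^m %| n * T ^+ k - r ^+ k *: (T^`() ^+ k * d)] & rho = r ^+ k]) <-> rho = c.
Proof.
move=> iinj k0 n0 d0 h; have [_ c0] := has_lead_neq0 iinj h.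
have [N0 N00 NE] := mup_factor 0 n0; have [D0 D00 DE] := mup_factor 0 d0.
rewrite subr0 in NE DE.
have hXn (m : nat) (P : {poly C}) : P.[0] != 0 -> has_lead iota (iota ('X^m * P)) m P.[0].
  move=> P0; have := has_leadM iinj (has_leadXn iinj m (has_leadX iota)) (has_lead_poly iota P0).
  by rewrite mul1r addr0 expr1n mul1r rmorphM rmorphXn.
have [E1 E2] : (mup 0 n)%:Z - (mup 0 d)%:Z = - k%:Z /\ N0.[0] / D0.[0] = c.
  apply: (has_lead_unique iinj _ h); rewrite {1}NE {1}DE.
  exact: (has_leadM iinj (hXn _ _ N00) (has_leadV (hXn _ _ D00))).
have dk : mup 0 d = (mup 0 n + k)%N.
  by apply/eqP; rewrite -eqz_nat PoszD -[k%:Z]opprK -E1 opprB addrC subrK.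
rewrite dk in DE; move: (mup 0 n) NE DE {dk E1 h hXn n0 d0} => i NE DE.
have lead_eq : N0.[0] = c * D0.[0] by rewrite -E2 divfK.
split=> [[r [t [r0 [t0 t1 H] ->]]]|->].
  rewrite -E2; apply: (normal_form_unique (i := i) D00 t0 t1) => m.
  by have := H m; rewrite NE DE.
have [t [t0 t1 H]] := normal_form_exists i k0 N00 lead_eq.
exists (k.-root c), t; rewrite rootCK //; split=> //.
  by apply: contra_neq c0 => r0; rewrite -(rootCK k0 c) r0 expr0n gtn_eqF.
by split=> // m; rewrite NE DE; exact: H.
Qed.

(** * Marked differentials *)

Section Concrete.
Variable C : numClosedFieldType.
Notation iota := (@ratfun_of_poly C : {rmorphism {poly C} -> {fraction {poly C}}}).
Notation comp := (@ratfun_comp C).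

Lemma frac_inj : injective iota.
Proof. exact: ratfun_of_poly_inj. Qed.

Lemma frac_ratio (f : {fraction {poly C}}) : exists P Q, Q != 0 /\ f = iota P / iota Q.
Proof.
exists \n_(repr f), \d_(repr f); split; first exact: denom_ratioP.
exact: ratfun_repr.
Qed.

Lemma frac_compE (phi : {fraction {poly C}}) (P Q : {poly C}) :
  transcendental iota phi -> Q != 0 ->
  comp (iota P / iota Q) phi = poly_at iota phi P / poly_at iota phi Q.
Proof.
move=> tphi Q0; set f := _ / _.
apply: (ratio_comp_eq (n := \n_(repr f)) (d := \d_(repr f)) frac_inj tphi Q0 (denom_ratioP _)).
exact: ratfun_repr.
Qed.

Lemma pullbackE (k : nat) (M : 'M[C]_2) (zeta : {fraction {poly C}}) :
  @pullback C k M zeta = pullback_with iota comp k M zeta.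
Proof. by []. Qed.

Lemma local_exprE (k : nat) (q : option C) (zeta : {fraction {poly C}}) :
  @local_expr C k zeta q = local_with iota comp k zeta q.
Proof. by []. Qed.

Lemma order_at_lead (k : nat) (zeta : {fraction {poly C}}) q e c :
  has_lead iota (local_with iota comp k zeta q) e c -> @order_at C k zeta q = e.
Proof.
move=> h; have [f0 _] := has_lead_neq0 frac_inj h.
rewrite /order_at local_exprE; set f := local_with _ _ _ _ _ in h f0 *.
apply: (mup_ratio_lead (c := c) frac_inj).
- apply: contra_neq f0 => n0; rewrite [f]ratfun_repr n0.
  by rewrite (rmorph0 iota) mul0r.
- exact: denom_ratioP.
- by move: h; rewrite {1}[f]ratfun_repr.
Qed.

Lemma order_at_exists (k : nat) (zeta : {fraction {poly C}}) q : zeta != 0 ->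
  exists c, has_lead iota (local_with iota comp k zeta q) (@order_at C k zeta q) c.
Proof.
move=> z0; have f0 : local_with iota comp k zeta q != 0.
  exact: (pullback_with_neq0 frac_inj frac_ratio frac_compE k (chart_unit q) z0).
have [e [c h]] := has_lead_exists frac_inj frac_ratio f0.
by exists c; rewrite (order_at_lead h).
Qed.

Lemma is_kresidue_lead (k : nat) (zeta : {fraction {poly C}}) q c rho : (0 < k)%N ->
  has_lead iota (local_with iota comp k zeta q) (- k%:Z) c ->
  @is_kresidue C k zeta q rho <-> rho = c.
Proof.
move=> k0 h; have [f0 _] := has_lead_neq0 frac_inj h.
rewrite /is_kresidue /normal_form local_exprE; set f := local_with _ _ _ _ _ in h f0 *.
apply: (@kresidue_ratio C _ iota) => //.
- exact: frac_inj.
- apply: contra_neq f0 => n0; rewrite [f]ratfun_repr n0.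
  by rewrite (rmorph0 iota) mul0r.
- exact: denom_ratioP.
- by move: h; rewrite {1}[f]ratfun_repr.
Qed.

End Concrete.

Section Marked.
Variable C : numClosedFieldType.
Variable k : nat.
Notation iota := (@ratfun_of_poly C : {rmorphism {poly C} -> {fraction {poly C}}}).
Notation comp := (@ratfun_comp C).
Notation pullback := (@pullback C k).
Notation order_at := (@order_at C k).
Notation is_kresidue := (@is_kresidue C k).
Implicit Types (zeta : {fraction {poly C}}) (M N : 'M[C]_2).

Lemma pullback_comp M N zeta : M \in unitmx -> N \in unitmx ->
  pullback M (pullback N zeta) = pullback (N *m M) zeta.
Proof.
move=> *; rewrite !pullbackE.
by apply: (pullback_with_comp (@frac_inj C) (@frac_ratio C) (@frac_compE C)).
Qed.

Lemma pullback1 zeta : pullback 1%:M zeta = zeta.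
Proof.
by rewrite pullbackE; apply: (pullback_with1 (@frac_inj C) (@frac_ratio C) (@frac_compE C)).
Qed.

Lemma pullback_neq0 M zeta : M \in unitmx -> zeta != 0 -> pullback M zeta != 0.
Proof.
move=> *; rewrite pullbackE.
by apply: (pullback_with_neq0 (@frac_inj C) (@frac_ratio C) (@frac_compE C)).
Qed.

Lemma pullback_lead M zeta q e c : M \in unitmx ->
  has_lead iota (local_with iota comp k zeta (homography M q)) e c ->
  exists2 w, w != 0 &
    has_lead iota (local_with iota comp k (pullback M zeta) q) e (c * w ^ (e + k%:Z)).
Proof.
by rewrite pullbackE; apply: (local_with_lead (@frac_inj C) (@frac_ratio C) (@frac_compE C)).
Qed.

Lemma order_at_pullback M zeta q : M \in unitmx -> zeta != 0 ->
  order_at (pullback M zeta) q = order_at zeta (homography M q).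
Proof.
move=> uM z0; have [c h] := order_at_exists k (homography M q) z0.
by have [w _ h'] := pullback_lead uM h; exact: order_at_lead h'.
Qed.

Variable p : nat.
Implicit Types (X Y Z : marked_kdiff C k p).

Lemma isomorphic_refl X : isomorphic X X.
Proof.
exists 1%:M; first exact: unitmx1.
by rewrite pullback1 !homography1; split=> // j; rewrite homography1.
Qed.

Lemma isomorphic_sym X Y : isomorphic X Y -> isomorphic Y X.
Proof.
move=> [M uM [hd h1 h2 hp]]; exists (invmx M); first by rewrite unitmx_inv.
split.
- by rewrite -hd pullback_comp ?unitmx_inv // mulmxV // pullback1.
- by rewrite -h1 homographyK.
- by rewrite -h2 homographyK.
- by move=> j; rewrite -hp homographyK.
Qed.

Lemma isomorphic_trans X Y Z : isomorphic X Y -> isomorphic Y Z -> isomorphic X Z.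
Proof.
move=> [M uM [hd h1 h2 hp]] [N uN [hd' h1' h2' hp']]; exists (N *m M).
  by rewrite unitmx_mul uN.
split.
- by rewrite -pullback_comp // hd' hd.
- by rewrite homographyM // h1 h1'.
- by rewrite homographyM // h2 h2'.
- by move=> j; rewrite homographyM // hp hp'.
Qed.

Definition iso_class X : set (marked_kdiff C k p) := [set Y | isomorphic X Y]%classic.

Lemma iso_class_eq X Y : isomorphic X Y -> iso_class X = iso_class Y.
Proof.
move=> XY; apply/seteqP; split=> Z; rewrite /iso_class /= => H.
  exact: isomorphic_trans (isomorphic_sym XY) H.
exact: isomorphic_trans XY H.
Qed.

Definition standard_marked (a : int) (c : C) (x : 'I_p -> C) : marked_kdiff C k p :=
  @MarkedKDiff C k p (standard iota k a c x) (Some 0) None (fun j => Some (x j)).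

Section Standard.
Variables (a : int) (c : C) (x : 'I_p -> C).
Hypothesis c0 : c != 0.
Hypothesis x_neq0 : forall j, x j != 0.
Hypothesis x_inj : injective x.

Lemma standard_order_sum z :
  (z == 0)%:Z * a - \sum_j (z == x j)%:Z * k%:Z =
  if z == 0 then a else if z \in codom x then - k%:Z else 0.
Proof.
have [->|z0] := eqVneq z 0.
  by rewrite mul1r big1 ?subr0 // => j _; rewrite eq_sym (negbTE (x_neq0 j)) mul0r.
rewrite mul0r sub0r; case: ifPn => [/codomP[j ->]|zx].
  rewrite (bigD1 j) //= eqxx mul1r big1 ?addr0 // => i ij.
  by rewrite (inj_eq x_inj) eq_sym (negbTE ij) mul0r.
rewrite big1 ?oppr0 // => j _; case: eqP => [zj|]; last by rewrite mul0r.
by rewrite zj codom_f in zx.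
Qed.

Lemma standard_order z : order_at (standard iota k a c x) (Some z) =
  if z == 0 then a else if z \in codom x then - k%:Z else 0.
Proof.
rewrite -standard_order_sum.
have := standard_lead_some (@frac_inj C) (@frac_ratio C) (@frac_compE C) k a x z c0.
exact: order_at_lead.
Qed.

Definition standard_residue (j : 'I_p) : C := c * x j ^ a / \prod_(i | i != j) (x j - x i) ^+ k.

Lemma standard_pole_lead j :
  has_lead iota (local_with iota comp k (standard iota k a c x) (Some (x j))) (- k%:Z)
    (standard_residue j).
Proof.
have := standard_lead_some (@frac_inj C) (@frac_ratio C) (@frac_compE C) k a x (x j) c0.
rewrite standard_order_sum (negbTE (x_neq0 j)) codom_f /diff_or1 (negbTE (x_neq0 j)) subr0.
rewrite (bigD1 j) //= eqxx expr1n mul1r /standard_residue.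
by under eq_bigr => i ij do rewrite (inj_eq x_inj) eq_sym (negbTE ij).
Qed.

Lemma standard_order_infinity : order_at (standard iota k a c x) None =
  - a + (p * k)%N%:Z - (2 * k)%N%:Z.
Proof.
have [d] := standard_lead_none (@frac_inj C) (@frac_ratio C) (@frac_compE C) k a x c0.
by rewrite card_ord => /order_at_lead.
Qed.

(** If the differential were a d-th power, d would divide both k and its order a at 0, hence d =
    1. *)
Lemma standard_primitive : (0 < k)%N -> coprimez a k ->
  @primitive C k (standard iota k a c x).
Proof.
move=> k0 cop l d eta ld lk E.
have s0 : standard iota k a c x != 0 by apply: standard_neq0 => //; exact: frac_inj.
have eta0 : eta != 0 :> {fraction {poly C}}.
  apply: contra_neq s0 => e0; rewrite E e0 expr0n; case: d ld E => // ld.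
  by move: k0; rewrite -ld muln0.
have [b hb] := order_at_exists l (Some 0) eta0.
have := standard_lead_some (@frac_inj C) (@frac_ratio C) (@frac_compE C) k a x 0 c0.
rewrite standard_order_sum eqxx => hs.
have tz := @transcendental_shift C _ iota (@frac_inj C) 0.
have hd := has_leadXn (@frac_inj C) d hb.
rewrite local_some // -(ratfun_compX (@frac_ratio C) (@frac_compE C) tz) in hd.
rewrite local_some // E in hs.
have [Ea _] := has_lead_unique (@frac_inj C) hs hd.
have da : (d%:Z %| a)%Z by rewrite Ea dvdz_mull // dvdzz.
have dk : (d%:Z %| k%:Z)%Z by rewrite -ld PoszM dvdz_mull // dvdzz.
have : (d%:Z %| gcdz a k)%Z by rewrite dvdz_gcd da.
move: cop; rewrite /coprimez => /eqP ->; rewrite dvdz1 /= => /eqP d1.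
by move: lk; rewrite -ld d1 muln1 ltnn.
Qed.

Lemma standard_of_type (a2 : int) : (0 < k)%N -> coprimez a k ->
  a + a2 - k%:Z * p%:Z = - (2 * k%:Z) -> of_type a a2 (standard_marked a c x).
Proof.
move=> k0 cop sum; split => /=.
- by apply/eqP; apply: standard_neq0 => //; exact: frac_inj.
- exact: standard_primitive.
- rewrite /marked_points /= !inE /= andbC; apply/andP; split.
    apply/andP; split; first by apply/codomP => -[j].
    by rewrite map_inj_uniq ?enum_uniq // => i j [] /x_inj.
  by apply/codomP => -[j] /= [] /esym /eqP; rewrite (negbTE (x_neq0 j)).
- by rewrite standard_order eqxx.
- rewrite standard_order_infinity !PoszM.
  have -> : a2 = - (2 * k%:Z) - a + k%:Z * p%:Z by rewrite -sum; ring.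
  by ring.
- by move=> j; rewrite standard_order (negbTE (x_neq0 j)) codom_f.
- move=> [z|]; rewrite !inE //= !negb_or => /andP[z0 zx].
  rewrite standard_order; case: eqP => [zz|_]; first by rewrite zz eqxx in z0.
  case: ifPn => // /codomP[j zj]; case/negP: zx; apply/codomP; exists j.
  by rewrite zj.
Qed.
End Standard.
End Marked.

(** * Every point of the stratum has a normalised representative *)

Section Standardize.
Variable C : numClosedFieldType.
Variables k n : nat.
Notation iota := (@ratfun_of_poly C : {rmorphism {poly C} -> {fraction {poly C}}}).
Notation comp := (@ratfun_comp C).
Notation pullback := (@pullback C k).
Notation order_at := (@order_at C k).
Implicit Types (X : marked_kdiff C k n.+1) (x : 'I_n.+1 -> C).

(** After the homography the differential has the orders of the standard one at every finite point;
    [c] is the factor given by [same_orders]. *)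
Lemma standardize a1 a2 X : of_type a1 a2 X ->
  exists c x, [/\ c != 0, x ord0 = 1, forall j, x j != 0, injective x &
    isomorphic (standard_marked k a1 c x) X].
Proof.
move=> [d0 _ um o1 o2 op oreg].
have d0' : diff X != 0 :> {fraction {poly C}} by apply/eqP.
move: (um); rewrite /marked_points /= !inE negb_or => /and3P[/andP[s12 s1p] s2p up].
have pinj : injective (pole X).
  by apply/injectiveP; rewrite /injectiveb /dinjectiveb -codomE.
have s1pj j : sing1 X != pole X j by apply: contraNneq s1p => ->; exact: codom_f.
have s2pj j : sing2 X != pole X j by apply: contraNneq s2p => ->; exact: codom_f.
have u3 : uniq [:: sing1 X; sing2 X; pole X ord0].
  by rewrite /= !inE negb_or s12 s1pj s2pj.
have [M uM [h0 hoo h1]] := three_points u3.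
have hinj : injective (homography M) by exact: can_inj (homographyK uM).
have /choice[x xP] : forall j, exists x : C, homography M (Some x) = pole X j.
  move=> j; case E : (homography (invmx M) (pole X j)) => [z|].
    by exists z; rewrite -E homographyVK.
  by have := s2pj j; rewrite -hoo -E homographyVK // eqxx.
have x01 : x ord0 = 1 by have [] : Some (x ord0) = Some 1 by apply: hinj; rewrite xP h1.
have x0 j : x j != 0.
  by apply/eqP => xj; have := s1pj j; rewrite -h0 -xj xP eqxx.
have xinj : injective x by move=> i j E; apply: pinj; rewrite -!xP E.
pose f : {fraction {poly C}} := pullback M (diff X).
have f0 : f != 0 by exact: pullback_neq0.
have ford z : order_at f (Some z) = if z == 0 then a1 else if z \in codom x then - k%:Z else 0.
  have -> : order_at f (Some z) = order_at (diff X) (homography M (Some z)).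
    exact: (order_at_pullback k (Some z) uM d0').
  have [->|z0] := eqVneq z 0; first by rewrite h0 o1.
  case: ifPn => [/codomP[j ->]|zx]; first by rewrite xP op.
  apply: oreg; rewrite !inE !negb_or; apply/and3P; split.
  - by rewrite -h0 (inj_eq hinj); apply: contra_neq z0 => -[].
  - by rewrite -hoo (inj_eq hinj).
  - apply: contra zx => /codomP[j]; rewrite -xP => /hinj [->]; exact: codom_f.
have one0 : (1 : C) != 0 by exact: oner_neq0.
have s0 : standard iota k a1 1 x != 0 by apply: standard_neq0 => //; exact: frac_inj.
have [|c c0 fE] := same_orders (@frac_inj C) (@frac_ratio C) (@frac_compE C) (k := k) f0 s0.
  move=> z; have [c h] := order_at_exists k (Some z) f0.
  have [d h'] := order_at_exists k (Some z) s0.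
  exists (order_at f (Some z)), c, d; split=> //.
  by have -> : order_at f (Some z) = order_at (standard iota k a1 1 x) (Some z);
    rewrite // standard_order // ford.
exists c, x; split=> //; exists M => //=; split=> //.
by rewrite -/f fE /standard rmorph1 mul1r mulrA.
Qed.

(** Pullback multiplies the leading coefficient by w^(e + k), which is 1 at a pole of order k. *)
Lemma standard_iso_residue a c x X j rho : (0 < k)%N -> c != 0 -> (forall j, x j != 0) ->
  injective x -> isomorphic (standard_marked k a c x) X ->
  is_kresidue (diff X) (pole X j) rho <-> rho = standard_residue k a c x j.
Proof.
move=> k0 c0 x0 xinj [M uM [hd _ _ hp']].
have hp : homography M (Some (x j)) = pole X j := hp' j.
have {}hd : pullback M (diff X) = standard iota k a c x := hd.
have X0 : diff X != 0 :> {fraction {poly C}}.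
  apply/eqP => X0.
  have /eqP[] : standard iota k a c x != 0 by apply: standard_neq0 => //; exact: frac_inj.
  rewrite -hd X0 pullbackE /pullback_with.
  by rewrite (ratfun_comp0 (@frac_compE C) (mobius_transcendental (@frac_inj C) uM)) mul0r.
have [d h] := order_at_exists k (pole X j) X0.
rewrite -hp in h; have [w w0 h'] := pullback_lead uM h.
rewrite hd hp in h'.
have [E1 E2] := has_lead_unique (@frac_inj C) h' (standard_pole_lead k a c0 x0 xinj j).
rewrite hp E1 in h; rewrite E1 addNr expr0z mulr1 in E2.
by rewrite -E2; apply: is_kresidue_lead.
Qed.

(** A homography fixing 0 and infinity is linear, and it is the identity if it also fixes 1. *)
Lemma standard_iso_points a c c' x x' : x ord0 = 1 -> x' ord0 = 1 ->
  isomorphic (standard_marked k a c x) (standard_marked k a c' x') -> x =1 x'.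
Proof.
move=> x1 x1' [M uM [_ /= h0 hoo hp]] j.
move: h0; rewrite mulr0 add0r; case: ifPn => // M11 [] /eqP.
rewrite mulr0 add0r mulf_eq0 invr_eq0 (negbTE M11) orbF => /eqP M01.
move: hoo; case: ifPn => // /eqP M10 _.
have H i : M 0 0 * x i = x' i * M 1 1.
  have := hp i; rewrite M10 mul0r add0r (negbTE M11) M01 addr0 => -[<-].
  by rewrite divfK.
have := H ord0; rewrite x1 x1' mulr1 mul1r => M00.
by have := H j; rewrite M00 mulrC => /(mulIf M11).
Qed.
End Standardize.

(** * From differentials to the system *)

Section Lagrange.
Variables (F : fieldType) (J : finType) (x : J -> F).
Hypothesis x_inj : injective x.

(** The derivative at x_j of the monic polynomial with roots x_i, as in Lagrange interpolation. *)
Definition node_deriv (j : J) : F := \prod_(i | i != j) (x j - x i).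

Lemma node_deriv_neq0 j : node_deriv j != 0.
Proof. by apply/prodf_neq0 => i ij; rewrite subr_eq0 (inj_eq x_inj) eq_sym. Qed.

Lemma size_prod_nodes (P : pred J) : size (\prod_(i | P i) ('X - (x i)%:P)) = #|P|.+1.
Proof. by rewrite -big_enum size_prod_XsubC -cardE. Qed.

Lemma horner_prod_nodes (P : pred J) z :
  (\prod_(i | P i) ('X - (x i)%:P)).[z] = \prod_(i | P i) (z - x i).
Proof. by rewrite horner_prod; apply: eq_bigr => i _; rewrite hornerXsubC. Qed.

(** The kernel is a line: the polynomial of degree #|J| - 2 that vanishes at all nodes except [j]
    and [j'] yields a relation between these two entries. *)
Lemma vandermonde_kernel (v : J -> F) :
  (forall i, (i.+1 < #|J|)%N -> \sum_j v j * x j ^+ i = 0) ->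
  forall j j', v j * node_deriv j = v j' * node_deriv j'.
Proof.
move=> H j j'; have [->//|jj'] := eqVneq j j'.
pose P i := (i != j) && (i != j').
pose q := \prod_(i | P i) ('X - (x i)%:P).
have dE h h' : h != h' -> (forall i, P i = (i != h) && (i != h')) ->
    node_deriv h = (x h - x h') * q.[x h].
  move=> hh' E; rewrite /node_deriv (bigD1 h') 1?eq_sym //= /q horner_prod_nodes.
  by congr (_ * _); apply: eq_bigl => i; rewrite E.
rewrite (dE j j') // (dE j' j); [|by rewrite eq_sym|by move=> i; rewrite /P andbC].
have q0 i : ~~ P i -> i = j \/ i = j'.
  by rewrite negb_and !negbK => /orP[] /eqP; [left | right].
have sq : (size q < #|J|)%N.
  rewrite size_prod_nodes -cardsT (cardsD1 j) (cardsD1 j') !inE eq_sym jj' !add1n !ltnS.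
  apply/subset_leq_card/fintype.subsetP => i.
  by rewrite !inE => /andP[-> ->].
have : \sum_i v i * q.[x i] = 0.
  under eq_bigr => i _ do rewrite horner_coef mulr_sumr.
  rewrite exchange_big big1 //= => m _.
  under eq_bigr => i _ do rewrite mulrCA.
  by rewrite -mulr_sumr H ?mulr0 // (leq_ltn_trans _ sq).
rewrite (bigD1 j) // (bigD1 j') 1?eq_sym //= big1 ?addr0 => [/eqP|i /andP[ij ij']].
  by rewrite addr_eq0 => /eqP E; rewrite mulrCA E mulrN -mulNr opprB mulrCA.
by rewrite /q horner_prod_nodes (bigD1 i) /P ?ij ?ij' //= subrr mul0r mulr0.
Qed.

(** X^i equals its Lagrange interpolation, whose coefficient of degree #|J| - 1 is this sum. *)
Lemma vandermonde_kernel_deriv i : (i.+1 < #|J|)%N -> \sum_j x j ^+ i / node_deriv j = 0.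
Proof.
move=> iJ.
pose P := \sum_j (x j ^+ i / node_deriv j) *: \prod_(l | l != j) ('X - (x l)%:P) - 'X^i.
have sp j : size (\prod_(l | l != j) ('X - (x l)%:P)) = #|J|.
  by rewrite size_prod_nodes (cardC1 j) prednK // (leq_trans _ iJ).
have P0 : P = 0.
  apply: (@roots_geq_poly_eq0 _ _ (codom x)).
  - apply/allP => _ /codomP[j ->]; rewrite /root /P hornerD hornerN hornerXn horner_sum.
    rewrite (bigD1 j) //= hornerZ horner_prod_nodes divfK ?node_deriv_neq0 //.
    rewrite big1 ?addr0 ?subrr // => l lj.
    by rewrite hornerZ horner_prod_nodes (bigD1 j) 1?eq_sym //= subrr mul0r mulr0.
  - exact/injectiveP.
  - rewrite size_codom (leq_trans (size_polyD _ _)) // geq_max size_polyN size_polyXn (ltnW iJ).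
    rewrite andbT (leq_trans (size_sum _ _ _)) //; apply/bigmax_leqP => j _.
    by rewrite (leq_trans (size_scale_leq _ _)) // sp.
have := congr1 (fun p : {poly F} => p`_#|J|.-1) P0.
rewrite coefB coefXn coef0 coef_sum gtn_eqF ?subr0; last first.
  by rewrite -ltnS prednK // (leq_trans _ iJ).
move=> E; rewrite -[RHS]E; apply: eq_bigr => j _; rewrite coefZ.
have := lead_coef_prod_XsubC (index_enum J) (fun l => l != j) x.
by rewrite lead_coefE sp => ->; rewrite mulr1.
Qed.
End Lagrange.

Lemma coprimez_expr_inj (F : fieldType) (a : int) (k : nat) (y y' : F) : coprimez a k ->
  y != 0 -> y' != 0 -> y ^ a = y' ^ a -> y ^+ k = y' ^+ k -> y = y'.
Proof.
move=> /eqP cop y0 y0' Ea Ek; have [u [v E]] := Bezoutz a k; rewrite cop in E.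
have Ek' : y ^ k%:Z = y' ^ k%:Z := Ek.
rewrite -[y]expr1z -[y']expr1z -E !expfzDr // ![_ * a]mulrC ![_ * k%:Z]mulrC -!exprz_exp.
by rewrite Ea Ek'.
Qed.

(** With u a + v k = 1, take y = s^u x^v. *)
Lemma coprimez_root (F : fieldType) (a : int) (k : nat) (s x : F) : coprimez a k ->
  s != 0 -> x != 0 -> s ^+ k = x ^ a -> exists y, [/\ y != 0, y ^+ k = x & y ^ a = s].
Proof.
move=> /eqP cop s0 x0 sx; have [u [v E]] := Bezoutz a k; rewrite cop in E.
have sx' : s ^ k%:Z = x ^ a := sx.
exists (s ^ u * x ^ v); split; first by rewrite mulf_neq0 ?expfz_neq0.
  rewrite -[_ ^+ k]/(_ ^ k%:Z) expfzMl.
  rewrite !exprz_exp [u * _]mulrC -[s ^ _]exprz_exp sx' exprz_exp -expfzDr // [a * u]mulrC E.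
  exact: expr1z.
rewrite expfzMl !exprz_exp [v * _]mulrC -[x ^ _]exprz_exp -sx' exprz_exp -expfzDr //.
by rewrite [k%:Z * v]mulrC E expr1z.
Qed.

(** * Solutions of the system correspond to normalised differentials *)

Section Correspondence.
Variables (C : numClosedFieldType) (k n : nat) (a : int) (r : 'I_n.+1 -> C).
Hypothesis k_gt0 : (0 < k)%N.
Hypothesis cop : coprimez a k.
Hypothesis r_generic : generic_weights k r.

Definition tail_weights (j : 'I_n) : C := r (lift ord0 j).

Definition full_coords (y : 'cV[C]_n) (j : 'I_n.+1) : C := coords y (unlift ord0 j).

Definition poles (y : 'cV[C]_n) (j : 'I_n.+1) : C := full_coords y j ^+ k.

Lemma full_coords0 y : full_coords y ord0 = 1.
Proof. by rewrite /full_coords unlift_none. Qed.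

Lemma full_coords_lift y j : full_coords y (lift ord0 j) = y j 0.
Proof. by rewrite /full_coords liftK. Qed.

Lemma big_unlift0 (F : option 'I_n -> C) :
  \sum_o F o = \sum_(j < n.+1) F (unlift ord0 j).
Proof.
by rewrite big_option big_ord_recl unlift_none; under [in RHS]eq_bigr => j _ do rewrite liftK.
Qed.

Lemma weights_unlift j : weights (r ord0) tail_weights (unlift ord0 j) = r j.
Proof. by case: unliftP => [i ->|->]. Qed.

Lemma generic_weights_unlift : generic_weights k (weights (r ord0) tail_weights).
Proof.
move=> eps eP [o eo]; rewrite big_unlift0.
under eq_bigr => j _ do rewrite weights_unlift.
apply: r_generic => [j|]; first exact: eP.
by case: o eo => [i|] eo; [exists (lift ord0 i); rewrite liftK | exists ord0; rewrite unlift_none].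
Qed.

Notation sol := (residue_sol k (- a) (r ord0) tail_weights).

Lemma solP y : sol y <-> (forall j, full_coords y j != 0) /\ forall i, (i < n)%N ->
  \sum_j r j * full_coords y j ^ (- a) * poles y j ^+ i = 0.
Proof.
have sE i : (forall j, full_coords y j != 0) ->
    \sum_o weights (r ord0) tail_weights o * coords y o ^ exponent k (- a) i =
    \sum_j r j * full_coords y j ^ (- a) * poles y j ^+ i.
  move=> y0; rewrite big_unlift0; apply: eq_bigr => j _; rewrite weights_unlift.
  by rewrite -/(full_coords y j) /exponent expfzDr // /poles -mulrA -exprM mulnC.
split.
  move=> /residue_solP[ty H]; have y0 j : full_coords y j != 0 by exact: coords_neq0.
  by split=> // i ni; rewrite -sE // H.
move=> [y0 H]; apply/residue_solP; split=> [j|i ni]; last by rewrite sE // H.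
by rewrite -full_coords_lift.
Qed.

Lemma poles_neq0 y j : sol y -> poles y j != 0.
Proof. by move=> /solP[y0 _]; exact: expf_neq0. Qed.

Lemma poles0 y : poles y ord0 = 1.
Proof. by rewrite /poles full_coords0 expr1n. Qed.

Lemma poles_inj y : sol y -> injective (poles y).
Proof.
have unlift_inj : injective (unlift (@ord0 n)).
  by apply: (can_inj (g := oapp (lift ord0) ord0)) => i; case: (unliftP ord0 i).
by move=> sy i j E; apply: unlift_inj; exact: (coords_injective generic_weights_unlift sy E).
Qed.

(** The constant c of the normalised differential, read off from the k-residue r_0^k at the pole
    1. *)
Definition scale y : C := (r ord0 * node_deriv (poles y) ord0) ^+ k.

Lemma sol_kernel y j : sol y ->
  r j * full_coords y j ^ (- a) * node_deriv (poles y) j = r ord0 * node_deriv (poles y) ord0.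
Proof.
move=> sy; have /solP[_ H] := sy.
have := vandermonde_kernel (x := poles y) (v := fun j => r j * full_coords y j ^ (- a)).
rewrite card_ord => /(_ (fun i ni => H i ni) j ord0) -> /=.
by rewrite full_coords0 exp1rz mulr1.
Qed.

Lemma scale_neq0 y : sol y -> scale y != 0.
Proof.
move=> sy; apply/expf_neq0/mulf_neq0; first exact: (weights_neq0 r_generic).
exact: (node_deriv_neq0 (poles_inj sy)).
Qed.

Lemma standard_residueE c (x : 'I_n.+1 -> C) j :
  standard_residue k a c x j = c * x j ^ a / node_deriv x j ^+ k.
Proof. by rewrite /standard_residue prodrXl. Qed.

Lemma sol_residue y j : sol y -> r j ^+ k = standard_residue k a (scale y) (poles y) j.
Proof.
move=> sy; have /solP[y0 _] := sy; rewrite standard_residueE /scale -(sol_kernel j sy).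
rewrite !exprMn.
have D0 := node_deriv_neq0 (poles_inj sy) j.
have -> : (full_coords y j ^ (- a)) ^+ k = (poles y j ^ a)^-1.
  by rewrite /poles !exprnP !exprz_exp invr_expz mulNr mulrC.
have p0 : poles y j ^ a != 0 by rewrite expfz_neq0 // expf_neq0.
rewrite -![_ * node_deriv _ _ ^+ k * _]mulrA [node_deriv _ _ ^+ k * _]mulrC.
by rewrite mulrA divfK // mulfK // expf_neq0.
Qed.

(** The residue conditions say that s_j = r_j D_j / B, with D_j = [node_deriv x j], satisfies s_j^k
    = x_j^a. Roots y_j with y_j^k = x_j and y_j^a = s_j turn the system into
    [vandermonde_kernel_deriv]. *)
Lemma poles_surj c x : c != 0 -> x ord0 = 1 -> (forall j, x j != 0) -> injective x ->
  (forall j, r j ^+ k = standard_residue k a c x j) ->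
  exists y, [/\ sol y, poles y =1 x & scale y = c].
Proof.
move=> c0 x1 x0 xinj rE; have D0 := node_deriv_neq0 xinj.
have r0 := weights_neq0 r_generic.
pose B := r ord0 * node_deriv x ord0.
have B0 : B != 0 by rewrite mulf_neq0.
have Bk : B ^+ k = c.
  by rewrite exprMn rE standard_residueE x1 exp1rz mulr1 divfK // expf_neq0.
pose s j := r j * node_deriv x j / B.
have s0 j : s j != 0 by rewrite !mulf_neq0 ?invr_neq0.
have sk j : s j ^+ k = x j ^ a.
  rewrite !exprMn rE standard_residueE exprVn Bk divfK ?expf_neq0 //.
  by rewrite mulrAC divff // mul1r.
have /choice[Y YP] j : exists y, [/\ y != 0, y ^+ k = x j & y ^ a = s j].
  exact: coprimez_root.
have Y1 : Y ord0 = 1.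
  have [y0 yk ya] := YP ord0; apply: (coprimez_expr_inj cop) => //; first exact: oner_neq0.
    by rewrite ya exp1rz /s divff.
  by rewrite yk expr1n.
exists (\col_j Y (lift ord0 j)).
have fE : full_coords (\col_j Y (lift ord0 j)) =1 Y.
  by move=> j; case: (unliftP ord0 j) => [i ->|->]; rewrite ?full_coords_lift ?mxE // full_coords0.
have pE : poles (\col_j Y (lift ord0 j)) =1 x.
  by move=> j; rewrite /poles fE; have [] := YP j.
split=> //; last first.
  by rewrite /scale -Bk /B /node_deriv; under eq_bigr => i _ do rewrite !pE.
apply/solP; split=> [j|i ni]; first by rewrite fE; have [] := YP j.
transitivity (B * \sum_j x j ^+ i / node_deriv x j); last first.
  by rewrite vandermonde_kernel_deriv ?mulr0 ?card_ord.
rewrite mulr_sumr; apply: eq_bigr => j _; rewrite pE fE; have [_ _ ya] := YP j.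
rewrite -invr_expz ya /s invf_div [r j * (_ / _)]mulrC -mulrA -mulrA; congr (_ * _).
by rewrite invfM mulrACA [_^-1 * r j]mulrC mulfV // mul1r mulrC.
Qed.

Lemma poles_determine y y' : sol y -> sol y' -> poles y =1 poles y' -> y = y'.
Proof.
move=> sy sy' E; have /solP[y0 _] := sy; have /solP[y0' _] := sy'.
have dE j : node_deriv (poles y) j = node_deriv (poles y') j.
  by rewrite /node_deriv; under eq_bigr => i _ do rewrite !E.
apply/colP => j; rewrite -!full_coords_lift.
apply: (coprimez_expr_inj cop) => //; last exact: E.
apply: invr_inj; rewrite !invr_expz.
have D0 := node_deriv_neq0 (poles_inj sy) (lift ord0 j).
apply: (mulIf D0); apply: (mulfI (weights_neq0 r_generic (lift ord0 j))).
by rewrite !mulrA sol_kernel // !dE sol_kernel.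
Qed.
End Correspondence.

Local Open Scope card_scope.

Lemma uniq_card_eq (V : eqType) (l : seq V) : uniq l -> [set` l]%classic #= `I_(size l).
Proof.
elim: l => [_|x l IH /= /andP[xl ul]]; first by rewrite set_nil II0.
apply/eq_cardSP; exists x; first by rewrite /= mem_head.
suff -> : ([set` x :: l] `\ x)%classic = [set` l]%classic by exact: IH.
apply/seteqP; split=> y /=; first by rewrite inE => -[/orP[/eqP|]].
by move=> yl; rewrite inE yl orbT; split=> // xy; rewrite -xy yl in xl.
Qed.

Lemma has_card_image (V : eqType) (W : Type) (A : V -> Prop) (B : set W) (f : V -> W) d :
  has_card A d -> (forall y, A y -> B (f y)) ->
  (forall y y', A y -> A y' -> f y = f y' -> y = y') ->
  (forall w, B w -> exists2 y, A y & f y = w) -> B #= `I_d.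
Proof.
move=> [l [ul <- lP]] fB finj fsurj.
have -> : B = [set f y | y in [set` l]]%classic.
  apply/seteqP; split=> [w /fsurj[y Ay <-]|_ [y /lP Ay <-]]; last exact: fB.
  by exists y => //; apply/lP.
apply: card_eq_trans (uniq_card_eq ul); apply: inj_card_eq => y y'.
by rewrite !inE => /lP Ay /lP Ay'; exact: finj.
Qed.

Section Fiber.
Variables (C : numClosedFieldType) (k n : nat) (a1 a2 : int) (r : 'I_n.+1 -> C).
Hypothesis k_gt0 : (0 < k)%N.
Hypothesis cop : coprimez a1 k.
Hypothesis sum_a : a1 + a2 - k%:Z * n.+1%:Z = - (2 * k%:Z).
Hypothesis r_generic : generic_weights k r.
Notation sol := (residue_sol k (- a1) (r ord0) (tail_weights r)).

Lemma fiber_card d : has_card sol d ->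
  @isoresidual_fiber C k n.+1 a1 a2 (fun j => r j ^+ k) #= `I_d.
Proof.
move=> cd.
pose mk y := standard_marked k a1 (scale k r y) (poles k y).
apply: (has_card_image (f := fun y => iso_class (mk y)) cd).
- move=> y sy.
  have x0 j : poles k y j != 0 by exact: poles_neq0 sy.
  have xinj := poles_inj r_generic sy.
  have c0 := scale_neq0 r_generic sy.
  split; first by exists (mk y) => //; exact: standard_of_type.
  exists (mk y); first exact: isomorphic_refl.
  move=> j; apply/(standard_iso_residue j _ k_gt0 c0 x0 xinj (isomorphic_refl (mk y))).
  exact: sol_residue.
- move=> y y' sy sy' E; apply: (poles_determine cop r_generic sy sy').
  apply: standard_iso_points (poles0 _ _) (poles0 _ _) _.
  have : iso_class (mk y') (mk y') by exact: isomorphic_refl.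
  by rewrite -E; apply.
- move=> S [[X tX <-] [Y XY rY]].
  have [c [x [c0 x1 x0 xinj iX]]] := standardize tX.
  have iY := isomorphic_trans iX XY.
  have [|y [sy yx yc]] := poles_surj cop r_generic c0 x1 x0 xinj.
    by move=> j; apply/(standard_iso_residue j _ k_gt0 c0 x0 xinj iY).
  exists y => //; rewrite /mk yc (funext yx); exact: iso_class_eq.
Qed.
End Fiber.

Theorem corollary1p3 (R : realType) (k p : nat) (a1 a2 : int)
    (hk : (2 <= k)%N) (hp : (1 <= p)%N)
    (ha1k : coprimez a1 k) (ha2k : coprimez a2 k)
    (ha1 : - k%:Z < a1) (ha2 : - k%:Z < a2)
    (hsum : a1 + a2 - k%:Z * p%:Z = - (2 * k%:Z)) :
  exists2 d : nat,
    d%:Z = 'C(p - 1, `|Num.ceil (a1%:~R / k%:R : rat)|)%:Z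
             * kfactorial k a1 * kfactorial k a2
    & isoresidual_degree R[i] k p a1 a2 d.
Proof.
have k_gt0 : (0 < k)%N by exact: ltnW.
exists (solution_count k (- a1) (p - 1)); first exact: solution_count_kfactorial.
case: p hp hsum => // n _ hsum; rewrite subn1 /=.
have [P P0 Pr] := @generic_polynomial R[i] k n.+1 k_gt0.
exists P; first exact: P0.
move=> rho rhoP.
(* The choice of roots is immaterial: the polynomial condition on [rho] gives genericity for every
   choice. *)
pose r j : R[i] := k.-root (rho j).
have rk : (fun j => r j ^+ k) = rho by apply/funext => j; rewrite /r rootCK.
have rg : generic_weights k r by apply: Pr; rewrite rk.
rewrite -rk; apply: fiber_card => //.
apply: residue_sol_card => //.
- exact: complex_bounded_converge.
- exact: closed_field_all_roots.
- rewrite rpredN; apply: contraL ha1k => ka; rewrite /coprimez.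
  by rewrite (gcdz_idPr ka) /= eqz_nat gtn_eqF.
- exact: generic_weights_unlift.
Qed.
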